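(* A pre-proof net is sequentializable if and only if it is a proof net.
   Context: Write ⅋ for par. MLL formulas over atoms $\mathcal A$: $\mathcal A\mid\mathcal A^\perp\mid\mathsf 1\mid\bot\mid F\otimes F\mid F⅋F$. Linkings: $\mathsf 1\mid a\otimes a^\perp\mid a^\perp\otimes a\mid \bot\otimes L\mid L\otimes\bot\mid L⅋L$. A pre-proof graph $\langle P\mid\Gamma\rangle$ is a linking tree $P$ and a sequent forest $\Gamma$ whose sets of leaves coincide. A switching deletes, at each ⅋-node, one of its two child edges; the graph is correct if all switchings are connected and acyclic. Pre-proof graphs are identified by the smallest equivalence $\sim$ with: $P[Q⅋R]\sim P[R⅋Q]$, $P[(Q⅋R)⅋S]\sim P[Q⅋(R⅋S)]$, $P[Q\otimes R]\sim P[R\otimes Q]$, $P[\bot_i\otimes(Q\otimes\bot_j)]\sim P[(\bot_i\otimes Q)\otimes\bot_j]$, and $P[Q⅋(R\otimes\bot_i)]\sim P[(Q⅋R)\otimes\bot_i]$ provided in every switching with also the edge between $\bot_i$ and its parent removed, no node of $Q$ is connected to $\bot_i$. A pre-proof net is a $\sim$-class; it is a proof net if one (equivalently every) member is correct. Cut-free sequent proofs translate into pre-proof graphs by: $\mathsf{id}$ gives $\langle a\otimes a^\perp\mid a,a^\perp\rangle$; $\mathsf 1$ gives $\langle\mathsf1\mid\mathsf1\rangle$; exchange keeps $P$; $\bot$-rule sends $\langle P\mid\Gamma\rangle$ to $\langle\bot\otimes P\mid\bot,\Gamma\rangle$; ⅋-rule sends $\langle P\mid A,B,\Gamma\rangle$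 to $\langle P\mid A⅋B,\Gamma\rangle$; $\otimes$-rule combines $\langle P\mid\Gamma,A\rangle$ and $\langle Q\mid B,\Delta\rangle$ into $\langle P⅋Q\mid\Gamma,A\otimes B,\Delta\rangle$. A pre-proof net is sequentializable if one of its representatives is obtained from a sequent proof via this translation. *)

(* Defs.v *)
From Stdlib Require Import List Permutation Relations.
Import ListNotations.
Set Implicit Arguments.

Section MLL.
Variable A : Type.

Inductive kind : Type :=
| KAt (a : A)
| KNAt (a : A)
| KOne
| KBot.

(* Binary trees with tensor/par nodes and leaves that are *named* occurrences.
   Both formulas of the sequent forest and linking trees are such trees; the
   leaf name identifies a leaf of the linking with a leaf of the forest. *)
Inductive tree : Type :=
| Leaf (x : nat) (k : kind)
| Tens (l r : tree)
| Par (l r : tree).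

Fixpoint leaves (t : tree) : list (nat * kind) :=
  match t with
  | Leaf x k => [(x, k)]
  | Tens l r | Par l r => leaves l ++ leaves r
  end.

Definition names (t : tree) : list nat := map fst (leaves t).

Inductive linking : tree -> Prop :=
| lk_one x : linking (Leaf x KOne)
| lk_ax1 x y a : linking (Tens (Leaf x (KAt a)) (Leaf y (KNAt a)))
| lk_ax2 x y a : linking (Tens (Leaf x (KNAt a)) (Leaf y (KAt a)))
| lk_botl x L : linking L -> linking (Tens (Leaf x KBot) L)
| lk_botr x L : linking L -> linking (Tens L (Leaf x KBot))
| lk_par L M : linking L -> linking M -> linking (Par L M).

Definition pre_proof_graph (P : tree) (G : list tree) : Prop :=
  linking P /\ NoDup (names P) /\ Permutation (leaves P) (concat (map leaves G)).

(* Vertices: leaves (shared, identified by name), internal nodes of P (by path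
   from the root), internal nodes of the i-th forest tree (by path). *)
Inductive vtx : Type :=
| VL (x : nat)
| VP (p : list bool)
| VG (i : nat) (p : list bool).

Definition rootv (mk : list bool -> vtx) (t : tree) (p : list bool) : vtx :=
  match t with Leaf x _ => VL x | _ => mk p end.

(* Edge: (parent, parent_is_par, side (false = left child), child). *)
Definition edge : Type := (vtx * bool * bool * vtx)%type.

Fixpoint tedges (mk : list bool -> vtx) (t : tree) (p : list bool) : list edge :=
  match t with
  | Leaf _ _ => []
  | Tens l r =>
      (mk p, false, false, rootv mk l (p ++ [false])) ::
      (mk p, false, true, rootv mk r (p ++ [true])) ::
      tedges mk l (p ++ [false]) ++ tedges mk r (p ++ [true])
  | Par l r =>
      (mk p, true, false, rootv mk l (p ++ [false])) ::
      (mk p, true, true, rootv mk r (p ++ [true])) ::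
      tedges mk l (p ++ [false]) ++ tedges mk r (p ++ [true])
  end.

Fixpoint tverts (mk : list bool -> vtx) (t : tree) (p : list bool) : list vtx :=
  match t with
  | Leaf x _ => [VL x]
  | Tens l r | Par l r => mk p :: tverts mk l (p ++ [false]) ++ tverts mk r (p ++ [true])
  end.

Fixpoint forest_edges (i : nat) (G : list tree) : list edge :=
  match G with
  | [] => []
  | t :: G' => tedges (VG i) t [] ++ forest_edges (S i) G'
  end.

Fixpoint forest_verts (i : nat) (G : list tree) : list vtx :=
  match G with
  | [] => []
  | t :: G' => tverts (VG i) t [] ++ forest_verts (S i) G'
  end.

Definition gedges (P : tree) (G : list tree) : list edge :=
  tedges VP P [] ++ forest_edges 0 G.

Definition gverts (P : tree) (G : list tree) : list vtx :=
  tverts VP P [] ++ forest_verts 0 G.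

(* A switching chooses, at each par node, which child edge is KEPT
   (equivalently, which of the two child edges is deleted). *)
Definition switching : Type := vtx -> bool.

Definition kept (s : switching) (e : edge) : Prop :=
  match e with (v, ispar, side, _) => ispar = false \/ s v = side end.

Definition sadj (P : tree) (G : list tree) (s : switching) (removed : edge -> Prop)
    (u v : vtx) : Prop :=
  exists e, In e (gedges P G) /\ kept s e /\ ~ removed e /\
    match e with (a, _, _, b) => (a = u /\ b = v) \/ (a = v /\ b = u) end.

Definition no_removal (e : edge) : Prop := False.

Definition sconnected (P : tree) (G : list tree) (s : switching) : Prop :=
  forall u v, In u (gverts P G) -> In v (gverts P G) ->
    clos_refl_trans vtx (sadj P G s no_removal) u v.

(* A cycle: pairwise distinct vertices v0 ... vk (k >= 2), consecutive ones
   adjacent and vk adjacent to v0.  (The graph has no parallel edges.) *)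
Fixpoint chain (R : vtx -> vtx -> Prop) (v : vtx) (l : list vtx) : Prop :=
  match l with
  | [] => True
  | w :: l' => R v w /\ chain R w l'
  end.

Definition sacyclic (P : tree) (G : list tree) (s : switching) : Prop :=
  ~ exists v0 l vk,
      NoDup (v0 :: l ++ [vk]) /\ l <> [] /\
      chain (sadj P G s no_removal) v0 (l ++ [vk]) /\
      sadj P G s no_removal vk v0.

Definition correct (P : tree) (G : list tree) : Prop :=
  forall s : switching, sconnected P G s /\ sacyclic P G s.

Fixpoint subtree (t : tree) (p : list bool) : option tree :=
  match p, t with
  | [], _ => Some t
  | false :: p', Tens l _ | false :: p', Par l _ => subtree l p'
  | true :: p', Tens _ r | true :: p', Par _ r => subtree r p'
  | _ :: _, Leaf _ _ => None
  end.

Fixpoint replace (t : tree) (p : list bool) (u : tree) : tree :=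
  match p, t with
  | [], _ => u
  | false :: p', Tens l r => Tens (replace l p' u) r
  | false :: p', Par l r => Par (replace l p' u) r
  | true :: p', Tens l r => Tens l (replace r p' u)
  | true :: p', Par l r => Par l (replace r p' u)
  | _ :: _, Leaf _ _ => t
  end.

Inductive local_rule : tree -> tree -> Prop :=
| r_parC Q R : local_rule (Par Q R) (Par R Q)
| r_parA Q R S : local_rule (Par (Par Q R) S) (Par Q (Par R S))
| r_tensC Q R : local_rule (Tens Q R) (Tens R Q)
| r_botA i j Q :
    local_rule (Tens (Leaf i KBot) (Tens Q (Leaf j KBot)))
               (Tens (Tens (Leaf i KBot) Q) (Leaf j KBot)).

Inductive step (G : list tree) : tree -> tree -> Prop :=
| st_local P p X X' :
    subtree P p = Some X -> local_rule X X' ->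
    step G P (replace P p X')
| st_bot P p Q R i :
    subtree P p = Some (Par Q (Tens R (Leaf i KBot))) ->
    (* side condition: in every switching of <P | G>, with additionally the edge
       between bot_i and its parent (the tensor node at path p++[true]) removed,
       no node of Q is connected to bot_i *)
    (forall s : switching, forall u, In u (tverts VP Q (p ++ [false])) ->
       ~ clos_refl_trans vtx
           (sadj P G s (fun e => match e with (a, _, _, b) =>
                              a = VP (p ++ [true]) /\ b = VL i end)) u (VL i)) ->
    step G P (replace P p (Tens (Par Q R) (Leaf i KBot))).

Definition equiv (G : list tree) : tree -> tree -> Prop :=
  clos_refl_sym_trans tree (step G).

Definition disjoint_names (l1 l2 : list nat) : Prop :=
  forall x, In x l1 -> In x l2 -> False.

(* [translates P G] : <P | G> is the translation of some cut-free sequent proof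
   of the sequent G (leaf occurrences carry distinct names). *)
Inductive translates : tree -> list tree -> Prop :=
| tr_id x y a : x <> y ->
    translates (Tens (Leaf x (KAt a)) (Leaf y (KNAt a)))
               [Leaf x (KAt a); Leaf y (KNAt a)]
| tr_one x : translates (Leaf x KOne) [Leaf x KOne]
| tr_exch P G G' : translates P G -> Permutation G G' -> translates P G'
| tr_bot x P G : translates P G -> ~ In x (names P) ->
    translates (Tens (Leaf x KBot) P) (Leaf x KBot :: G)
| tr_par P F1 F2 G : translates P (F1 :: F2 :: G) -> translates P (Par F1 F2 :: G)
| tr_tens P Q G F1 F2 D :
    translates P (G ++ [F1]) -> translates Q (F2 :: D) ->
    disjoint_names (names P) (names Q) ->
    translates (Par P Q) (G ++ Tens F1 F2 :: D).

(* A pre-proof net (~-class of <P | G>) is sequentializable if one of its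
   representatives is the translation of a sequent proof. *)
Definition sequentializable (P : tree) (G : list tree) : Prop :=
  exists P', equiv G P P' /\ translates P' G.

Definition proof_net (P : tree) (G : list tree) : Prop :=
  exists P', equiv G P P' /\ correct P' G.

End MLL.

(* Main.v *)
(** A switching of a tree only matters through the partition of the leaves that it
    induces and the block containing the root; in these terms correctness of
    [<P | G>] says that the blocks of [P] and of [G] always form a tree, which makes
    translations of sequent proofs correct by induction.

    Conversely, in a correct graph a subtree [(Q par R) * bot_i] may always be
    replaced by [Q par (R * bot_i)]: comparing the two switchings of the par, the
    roots of [Q] and [R] are connected elsewhere, and the side condition of the rule
    follows. So [P] becomes a par of stars, each an axiom or a [1] tensored with
    bottoms, and every star is a provable sequent. The sequent proof is then built
    from the leaves of [G] downwards, starting from these sequents. Some rule is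
    always applicable: if no tensor has both premises derived, a par and a switching
    for which the component of its premises (without the edge of the par) is minimal
    has its two premises in the same derived sequent. *)

Require Import Defs.
From Stdlib Require Import List Permutation Relations.
From Stdlib Require Import Classical Lia Arith.
Import ListNotations.
Set Implicit Arguments.

(** * Connectivity and forests *)

(** The internal vertices of a linking are named by paths, so a rewriting renames them; only the
    leaves survive. This is why both sides are reduced to edge lists on leaves and a subtree is
    compared with its replacement against arbitrary remaining edges. Two edge lists are identified
    when they agree on acyclicity and on the components of the observed vertices; the moves used are
    sliding an edge along a path and deleting a pendant vertex.

    Bottoms must leave the pars because the bottom rule tensors a bottom with a whole linking, while
    the order of the rules is dictated by the forest. Once every bottom sits in a star, a tensor
    rule only forms the par of two linkings; whatever the order of the rules, the result is a par of
    the same stars, and associativity and commutativity of par bring it back to the given class.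

    Minimality is a descent over all switchings at once: changing the choice at one par makes the
    component found at another par smaller. At a minimum, the premises stay connected when any one
    par edge is deleted. Since a path in a forest is unique, they are then connected without any par
    edge. *)

Definition sing (T : Type) (x : T) : list T := [x].

(** One rotation for [perm]: the head atom moves to the end, in front of the terminating [[]] that
    [perm_pad] installs. *)
Lemma perm_rot (T : Type) (x a b : list T) :
  Permutation x (b ++ a ++ []) -> Permutation x (a ++ b).
Proof. intros H; rewrite H, app_nil_r; apply Permutation_app_comm. Qed.

Lemma perm_pad (T : Type) (a b : list T) :
  Permutation (a ++ []) (b ++ []) -> Permutation a b.
Proof. now rewrite !app_nil_r. Qed.

Ltac perm_norm := repeat rewrite <- app_assoc; rewrite ?app_nil_l.
Ltac perm_match n :=
  match n with
  | O => fail
  | S ?m => first [ apply Permutation_app_head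
                  | apply perm_rot; perm_norm; perm_match m ]
  end.
(* Rotates the right-hand side until the heads agree; the bound only has to exceed
   the number of concatenated atoms. *)
Ltac perm :=
  apply perm_pad;
  repeat match goal with
  | |- context[?x :: ?l] => change (x :: l) with (sing x ++ l)
  end;
  perm_norm;
  repeat (first [ apply Permutation_refl | perm_match 12 ]).

Section Graph.
Variable V : Type.
Implicit Types E F B : list (V * V).

Definition conn E : V -> V -> Prop :=
  clos_refl_sym_trans V (fun u v => In (u, v) E).

Lemma conn_refl E u : conn E u u.
Proof. unfold conn; apply rst_refl. Qed.
Lemma conn_sym E u v : conn E u v -> conn E v u.
Proof. unfold conn; apply rst_sym. Qed.
Lemma conn_trans E u v w : conn E u v -> conn E v w -> conn E u w.
Proof. unfold conn; apply rst_trans. Qed.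
Lemma conn_in E u v : In (u, v) E -> conn E u v.
Proof. intros H; now apply rst_step. Qed.

Lemma conn_lift E F u v :
  (forall a b, In (a, b) E -> conn F a b) -> conn E u v -> conn F u v.
Proof.
  intros H; induction 1; eauto using conn_refl, conn_sym, conn_trans.
Qed.

Lemma conn_incl E F u v : incl E F -> conn E u v -> conn F u v.
Proof. intros H; apply conn_lift; auto using conn_in. Qed.

Lemma conn_perm E F u v : Permutation E F -> conn E u v -> conn F u v.
Proof. intros H; apply conn_incl; intros x; now apply Permutation_in. Qed.

(** A connection uses the new edge at most once, in one of two directions. This case split is behind
    most of the reasoning on forests. *)
Lemma conn_cons a b E u v :
  conn ((a, b) :: E) u v <->
  conn E u v \/ (conn E u a /\ conn E b v) \/ (conn E u b /\ conn E a v).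
Proof.
  split.
  - induction 1 as [x y [H|H]| x | x y _ IH | x y z _ IH1 _ IH2].
    + inversion H; subst; right; left; split; apply conn_refl.
    + left; now apply conn_in.
    + left; apply conn_refl.
    + intuition eauto using conn_sym.
    + intuition eauto 6 using conn_trans, conn_sym.
  - assert (H : forall x y, conn E x y -> conn ((a, b) :: E) x y)
      by (intros; eapply conn_incl; eauto; intro; simpl; auto).
    assert (H' : conn ((a, b) :: E) a b) by (apply conn_in; simpl; auto).
    intuition eauto 6 using conn_trans, conn_sym.
Qed.

Lemma conn_wk a b E u v : conn E u v -> conn ((a, b) :: E) u v.
Proof. rewrite conn_cons; auto. Qed.

Definition avoid v E := forall a b, In (a, b) E -> a <> v /\ b <> v.

Lemma conn_avoid v E u w : avoid v E -> conn E u w -> u = v \/ w = v -> u = w.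
Proof.
  intros H; induction 1 as [x y Hi| | x y _ IH | x y z _ IH1 _ IH2]; auto.
  - apply H in Hi; intuition congruence.
  - intuition.
  - intros [Hx|Hz].
    + assert (x = y) by auto; subst; auto.
    + assert (y = z) by auto; subst; auto.
Qed.

(** Acyclicity by insertion: each edge joins two different components of the edges after it. Loops
    and repeated edges, also reversed ones, are thereby excluded. *)
Fixpoint forest E : Prop :=
  match E with
  | [] => True
  | (u, v) :: E' => ~ conn E' u v /\ forest E'
  end.

Lemma forest_perm E F : Permutation E F -> forest E -> forest F.
Proof.
  induction 1 as [|[a b] E F HP IH|[a b] [c d] E|]; simpl; auto.
  - intros [H1 H2]; split; auto.
    intros H; apply H1; revert H; apply conn_perm; now symmetry.
  - rewrite !conn_cons; intros [H1 [H2 H3]]; repeat split; auto.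
    intros H; apply H1. intuition eauto using conn_sym.
Qed.

(** Graphs as seen from the observed vertices [O]: the other vertices may be eliminated, but cycles
    are tracked everywhere. *)
Definition sim (O : V -> Prop) E F : Prop :=
  (forest E <-> forest F) /\
  forall u v, O u -> O v -> (conn E u v <-> conn F u v).

Definition all (v : V) : Prop := True.

Lemma sim_refl O E : sim O E E.
Proof. split; intros; reflexivity. Qed.
Lemma sim_sym O E F : sim O E F -> sim O F E.
Proof. intros [H1 H2]; split; intros; symmetry; auto. Qed.
Lemma sim_trans O E F B : sim O E F -> sim O F B -> sim O E B.
Proof. intros [H1 H2] [H3 H4]; split; intros; etransitivity; eauto. Qed.
Lemma sim_weak (O O' : V -> Prop) E F :
  (forall v, O' v -> O v) -> sim O E F -> sim O' E F.
Proof. intros H [H1 H2]; split; auto. Qed.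

Lemma sim_perm O E F : Permutation E F -> sim O E F.
Proof.
  intros H; assert (H' := Permutation_sym H).
  split; intros; split; eauto using forest_perm, conn_perm.
Qed.

Definition within (O : V -> Prop) E := forall a b, In (a, b) E -> O a /\ O b.

Lemma within_app O E F : within O (E ++ F) <-> within O E /\ within O F.
Proof.
  unfold within; split.
  - intros H; split; intros; apply H; apply in_or_app; auto.
  - intros [H1 H2] a b H; apply in_app_or in H; destruct H; eauto.
Qed.

Lemma within_cons O a b E : within O ((a, b) :: E) <-> (O a /\ O b) /\ within O E.
Proof.
  unfold within; split; simpl.
  - intros H; split; auto.
  - intros [H1 H2] c d [H|H]; [inversion H; subst|]; auto.
Qed.

Lemma within_nil O : within O [].
Proof. intros a b []. Qed.

Lemma within_impl (O O' : V -> Prop) E :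
  (forall v, O v -> O' v) -> within O E -> within O' E.
Proof. intros H H' a b Hi; apply H' in Hi; intuition. Qed.

Lemma within_avoid (O : V -> Prop) v E : within O E -> ~ O v -> avoid v E.
Proof. intros H Hv a b Hi; apply H in Hi; intuition congruence. Qed.

(** An edge between observed vertices only asks about connections of observed vertices, so it can be
    added to both sides. *)
Lemma sim_app O E F B : sim O E F -> within O B -> sim O (B ++ E) (B ++ F).
Proof.
  intros H; induction B as [|[a b] B IH]; simpl; auto.
  rewrite within_cons; intros [[Ha Hb] HB]; destruct (IH HB) as [H1 H2].
  split; simpl.
  - rewrite H1, H2 by auto; reflexivity.
  - intros u v Hu Hv; rewrite !conn_cons, !H2 by auto; reflexivity.
Qed.

Lemma sim_cons O a b E F : sim O E F -> O a -> O b -> sim O ((a, b) :: E) ((a, b) :: F).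
Proof.
  intros H Ha Hb; apply (@sim_app O E F [(a, b)]); auto.
  intros c d [Hi|[]]; inversion Hi; subst; auto.
Qed.

(** The edges of [E] alone connect [a] and [a'], so both versions of the edge join the same two
    components. *)
Lemma sim_slide O a a' b E : conn E a a' -> sim O ((a, b) :: E) ((a', b) :: E).
Proof.
  intros H; split; simpl.
  - split; intros [H1 H2]; split; eauto using conn_trans, conn_sym.
  - intros u v _ _; rewrite !conn_cons.
    intuition eauto 6 using conn_trans, conn_sym.
Qed.

Lemma sim_flip O a b E : sim O ((a, b) :: E) ((b, a) :: E).
Proof.
  split; simpl.
  - split; intros [H1 H2]; split; eauto using conn_sym.
  - intros u v _ _; rewrite !conn_cons; tauto.
Qed.

Lemma sim_slide_r O a b b' E : conn E b b' -> sim O ((a, b) :: E) ((a, b') :: E).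
Proof.
  intros H; eapply sim_trans; [apply sim_flip|].
  eapply sim_trans; [apply sim_slide; eauto|apply sim_flip].
Qed.

Lemma sim_pendant (O : V -> Prop) v a E :
  avoid v E -> v <> a -> ~ O v -> sim O ((v, a) :: E) E.
Proof.
  intros H Ha HO; split; simpl.
  - split; [tauto|]; intros HE; split; auto.
    intros Hc; apply Ha; eapply conn_avoid; eauto.
  - intros x y Hx Hy; rewrite conn_cons; split; auto.
    intros [?|[[H1 H2]|[H1 H2]]]; auto; exfalso; apply HO.
    + apply (conn_avoid H) in H1; auto; congruence.
    + apply (conn_avoid H) in H2; auto; congruence.
Qed.

(** Once the edge to [a] is slid along the edge to [b], the vertex [v] is pendant. *)
Lemma sim_elim2 (O : V -> Prop) v a b E :
  avoid v E -> v <> a -> v <> b -> ~ O v ->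
  sim O ((v, a) :: (v, b) :: E) ((a, b) :: E).
Proof.
  intros H Ha Hb HO.
  eapply sim_trans; [|apply (@sim_pendant O v b); auto].
  - eapply sim_trans; [apply sim_slide, conn_in; simpl; eauto|].
    eapply sim_trans; [apply sim_flip|apply sim_perm, perm_swap].
  - intros c d [Hi|Hi]; [inversion Hi; subst; auto|eauto].
Qed.
End Graph.

(** * Simple cycles *)

Section Disjoint.
Variable V : Type.
Implicit Types E F : list (V * V).

Lemma conn_within (O : V -> Prop) E u v : within O E -> conn E u v -> u = v \/ (O u /\ O v).
Proof.
  intros H; induction 1 as [x y Hi| x | x y _ IH | x y z _ IH1 _ IH2].
  - right; now apply H.
  - now left.
  - intuition.
  - intuition congruence.
Qed.

Lemma conn_app_disjoint (O1 O2 : V -> Prop) E F u v :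
  within O1 E -> within O2 F -> (forall w, O1 w -> O2 w -> False) ->
  conn (E ++ F) u v -> conn E u v \/ conn F u v.
Proof.
  intros H1 H2 Hd; induction 1 as [x y Hi| x | x y _ IH | x y z _ IH1 _ IH2].
  - apply in_app_or in Hi; intuition auto using conn_in.
  - left; apply conn_refl.
  - intuition auto using conn_sym.
  - destruct IH1 as [A1|A1], IH2 as [A2|A2]; eauto using conn_trans.
    + destruct (conn_within H1 A1) as [->|[_ Hy]]; auto.
      destruct (conn_within H2 A2) as [->|[Hy' _]]; auto.
      exfalso; eauto.
    + destruct (conn_within H2 A1) as [->|[_ Hy]]; auto.
      destruct (conn_within H1 A2) as [->|[Hy' _]]; auto.
      exfalso; eauto.
Qed.

Lemma forest_app_disjoint (O1 O2 : V -> Prop) E F :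
  within O1 E -> within O2 F -> (forall w, O1 w -> O2 w -> False) ->
  forest E -> forest F -> forest (E ++ F).
Proof.
  intros H1 H2 Hd; induction E as [|[a b] E IH]; simpl; auto.
  apply within_cons in H1; destruct H1 as [[Ha Hb] H1].
  intros [Hn HE] HF; split; auto.
  intros Hc; destruct (conn_app_disjoint H1 H2 Hd Hc) as [Hc'|Hc']; auto.
  destruct (conn_within H2 Hc') as [->|[Ha' _]]; eauto using conn_refl.
Qed.
End Disjoint.

Section Cycle.
Implicit Types E F : list (vtx * vtx).

Definition adj E (u v : vtx) : Prop := In (u, v) E \/ In (v, u) E.

Lemma conn_adj E u v : adj E u v -> conn E u v.
Proof. intros [H|H]; auto using conn_in, conn_sym. Qed.

Lemma chain_impl (R S : vtx -> vtx -> Prop) v l :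
  (forall a b, R a b -> S a b) -> chain R v l -> chain S v l.
Proof. intros H; revert v; induction l; simpl; intuition. Qed.

Lemma last_cons (T : Type) (l : list T) x d : last (x :: l) d = last l x.
Proof.
  revert x d; induction l as [|y l IH]; intros x d; auto.
  change (last (y :: l) d = last (y :: l) x); now rewrite !IH.
Qed.

Lemma last_app_cons (T : Type) (p q : list T) b d : last (p ++ b :: q) d = last q b.
Proof.
  revert d; induction p as [|y p IH]; intros d; simpl app; rewrite last_cons; auto.
Qed.

Lemma chain_app R v l w l' :
  chain R v l -> R (last l v) w -> chain R w l' -> chain R v (l ++ w :: l').
Proof.
  revert v; induction l as [|x l IH]; intros v; [simpl; auto|].
  rewrite last_cons; intros [H1 H2] H3 H4; split; auto.
Qed.

Lemma chain_conn E v l w : chain (adj E) v l -> In w (v :: l) -> conn E v w.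
Proof.
  revert v; induction l as [|x l IH]; intros v; simpl.
  - intros _ [->|[]]; apply conn_refl.
  - intros [H1 H2] [->|H3]; [apply conn_refl|].
    eapply conn_trans; [apply conn_adj; eauto|apply IH; auto].
Qed.

Lemma NoDup_disjoint_app (T : Type) (l l' : list T) :
  NoDup l -> NoDup l' -> (forall x, In x l -> In x l' -> False) -> NoDup (l ++ l').
Proof.
  intros H1 H2 H; induction H1 as [|x l Hx Hl IH]; simpl; auto.
  constructor.
  - intros Hi; apply in_app_or in Hi; destruct Hi; eauto using in_eq.
  - apply IH; intros; eapply H; eauto using in_cons.
Qed.

(** Induction on the edges: if the new edge has to be used, the two halves of the path lie in
    different components of [E], so their concatenation repeats no vertex. *)
Lemma conn_path E u v : conn E u v ->
  exists p, NoDup (u :: p) /\ chain (adj E) u p /\ last p u = v.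
Proof.
  revert u v; induction E as [|[a b] E IH]; intros u v H.
  - exists []; repeat split; simpl; auto using NoDup_nil, NoDup_cons.
    induction H as [? ? []| | |]; congruence.
  - assert (Hm : forall x y, adj E x y -> adj ((a, b) :: E) x y)
      by (unfold adj; simpl; tauto).
    assert (K : forall a' b', adj ((a, b) :: E) a' b' -> ~ conn E u v ->
      conn E u a' -> conn E b' v ->
      exists p, NoDup (u :: p) /\ chain (adj ((a, b) :: E)) u p /\ last p u = v).
    { intros a' b' Hab Hn H1 H2.
      destruct (IH _ _ H1) as [p [P1 [P2 P3]]], (IH _ _ H2) as [q [Q1 [Q2 Q3]]].
      exists (p ++ b' :: q); repeat split.
      - change (NoDup ((u :: p) ++ (b' :: q))); apply NoDup_disjoint_app; auto.
        intros x X1 X2; apply Hn; apply conn_trans with x.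
        + eapply chain_conn; eauto.
        + apply conn_trans with b'; auto. apply conn_sym; eapply chain_conn; eauto.
      - apply chain_app; eauto using chain_impl. now rewrite P3.
      - now rewrite last_app_cons. }
    destruct (classic (conn E u v)) as [H'|H'].
    + destruct (IH _ _ H') as [p [P1 [P2 P3]]]; exists p; eauto using chain_impl.
    + apply conn_cons in H; destruct H as [H|[[H1 H2]|[H1 H2]]]; [tauto| |];
        eapply K; eauto; unfold adj; simpl; auto.
Qed.

Definition has_cycle (R : vtx -> vtx -> Prop) : Prop :=
  exists v0 l vk, NoDup (v0 :: l ++ [vk]) /\ l <> [] /\ chain R v0 (l ++ [vk]) /\ R vk v0.

(** A simple path between the ends of an edge closes to a cycle. It has an intermediate vertex
    because neither the edge nor its reverse occurs again, which gives the length demanded of a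
    cycle. *)
Lemma acyclic_forest E (R : vtx -> vtx -> Prop) :
  (forall a b, In (a, b) E -> R a b /\ R b a) -> NoDup E ->
  (forall a b, In (a, b) E -> ~ In (b, a) E) -> ~ has_cycle R -> forest E.
Proof.
  intros HR HN HA HC; induction E as [|[a b] E IH]; simpl; auto.
  inversion HN as [|? ? N1 N2]; subst.
  assert (Hab : a <> b) by (intros ->; eapply HA; simpl; eauto).
  split; [|apply IH; auto; intros; [apply HR|intro; eapply HA]; simpl; eauto].
  intros H; apply conn_path in H; destruct H as [p [P1 [P2 P3]]].
  destruct (@exists_last _ p) as [l [c ->]]; [intros ->; simpl in P3; auto|].
  rewrite last_last in P3; subst c.
  apply HC; exists a, l, b; repeat split; auto.
  - intros ->; simpl in P2; destruct P2 as [[P|P] _]; auto.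
    apply (HA a b); simpl; auto.
  - eapply chain_impl; [|exact P2]; intros x y [Hx|Hx];
      [apply (HR x y)|apply (HR y x)]; simpl; auto.
  - apply (HR a b); simpl; auto.
Qed.

(** The edge closing the cycle is moved to the front. The other steps of the cycle use other edges,
    as its vertices are distinct, and so they connect the ends of that edge without it. *)
Lemma forest_acyclic E (R : vtx -> vtx -> Prop) :
  (forall a b, R a b -> adj E a b) -> forest E -> ~ has_cycle R.
Proof.
  intros HR HF [v0 [l [vk [HN [Hl [HC HK]]]]]].
  assert (Hs : exists e E', Permutation E (e :: E') /\ (e = (vk, v0) \/ e = (v0, vk))).
  { destruct (HR _ _ HK) as [Hi|Hi]; apply in_split in Hi; destruct Hi as [E1 [E2 ->]];
      eexists _, (E1 ++ E2); (split; [symmetry; apply Permutation_middle|auto]). }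
  destruct Hs as [e [E' [HP He]]].
  assert (Hst : forall x y, R x y -> (x = v0 -> y = vk -> False) ->
     (x = vk -> y = v0 -> False) -> conn E' x y).
  { intros x y Hxy A1 A2; destruct (HR _ _ Hxy) as [Hi|Hi]; apply (Permutation_in _ HP) in Hi;
      destruct Hi as [Hi|Hi]; auto using conn_in, conn_sym;
      destruct He; subst e; inversion Hi; subst; exfalso; eauto. }
  assert (Hch : forall q w, chain R w q -> ~ In v0 (w :: q) -> conn E' w (last q w)).
  { induction q as [|y q IH]; intros w; [intros; apply conn_refl|].
    intros [C1 C2] Hn; rewrite last_cons; eapply conn_trans with y.
    - apply Hst; auto; intros -> ->; apply Hn; simpl; auto.
    - apply IH; auto. intros Hi; apply Hn; simpl in *; tauto. }
  assert (Hconn : conn E' v0 vk).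
  { destruct l as [|w l]; [tauto|]. simpl in HC, HN; destruct HC as [C1 C2].
    inversion HN as [|? ? N1 N2]; subst; inversion N2 as [|? ? N3 N4]; subst.
    eapply conn_trans with w.
    - apply Hst; auto; intros A1 A2; subst; [apply N3|apply N1]; simpl; auto.
      apply in_or_app; simpl; auto.
    - replace vk with (last (l ++ [vk]) w) by apply last_last. apply Hch; auto. }
  apply (forest_perm HP) in HF.
  destruct He; subst e; destruct HF as [HF _]; auto using conn_sym.
Qed.
End Cycle.

(** * Contracting paired graphs *)

Section Paired.
Variable V : Type.
Variable eq_dec : forall u v : V, {u = v} + {u <> v}.
Implicit Types (E U L : list (V * V)) (D : list (V * V * V)) (s : V -> bool).

(** Paths in a forest are unique: if [x] and [y] stay connected whenever one edge of [L] is deleted,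
    their path uses none of these edges. With cycles this fails, since two routes could each use a
    different edge. *)
Lemma conn_dec_edges U L x y :
  forest (L ++ U) -> conn (L ++ U) x y ->
  (forall e E2, In e L -> Permutation (L ++ U) (e :: E2) -> conn E2 x y) ->
  conn U x y.
Proof.
  induction L as [|[a b] L IH]; auto.
  intros HF HC HE; apply IH.
  - simpl in HF; tauto.
  - apply (HE (a, b)); simpl; auto.
  - intros [a1 b1] E3 Hi HP.
    assert (P1 : Permutation (((a, b) :: L) ++ U) ((a, b) :: (a1, b1) :: E3))
      by (simpl; now constructor).
    assert (P2 : Permutation (((a, b) :: L) ++ U) ((a1, b1) :: (a, b) :: E3))
      by (rewrite P1; constructor).
    assert (C1 : conn ((a1, b1) :: E3) x y) by (apply (HE (a, b)); simpl; auto).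
    assert (C2 : conn ((a, b) :: E3) x y) by (apply (HE (a1, b1)); simpl; auto).
    (* If deleting both edges separated [x] from [y], either edge alone would reconnect them, and
       the two would lie on a cycle. *)
    apply (forest_perm P1) in HF; destruct HF as [HF _].
    rewrite conn_cons in HF, C1, C2; apply NNPP; intros Hn; apply HF.
    destruct C1 as [C1|[[C1 C1']|[C1 C1']]]; [tauto| |];
      (destruct C2 as [C2|[[C2 C2']|[C2 C2']]]; [tauto| |]);
      intuition eauto 6 using conn_trans, conn_sym.
Qed.

Definition par_vertex (t : V * V * V) : V := fst (fst t).

Definition pick s (t : V * V * V) : V * V :=
  let '(c, x, y) := t in (c, if s c then y else x).

Definition upd s c b : V -> bool := fun v => if eq_dec v c then b else s v.

Lemma upd_same s c b : upd s c b c = b.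
Proof. unfold upd; destruct (eq_dec c c); congruence. Qed.

Lemma pick_upd s c b D :
  ~ In c (map par_vertex D) -> map (pick (upd s c b)) D = map (pick s) D.
Proof.
  intros H; apply map_ext_in; intros [[c' x] y] Hi; simpl; unfold upd.
  destruct (eq_dec c' c) as [->|]; auto.
  exfalso; apply H; apply in_map_iff; now exists (c, x, y).
Qed.

(** The component in the fixed edges [U] that holds both premises of the par contains the conclusion
    of no par. In this situation the par rule will apply. *)
Definition contractible U D : Prop :=
  exists c x y, In (c, x, y) D /\ conn U x y /\
    forall t, In t D -> ~ conn U (par_vertex t) x.

(* Descent on the component [S] of the premises of [c] in a switching with the
   edge of [c] removed: a par [c'] in [S] whose kept edge does not lead back to
   both premises of [c] has, for a suitable choice at [c], a smaller component. *)
Lemma contractible_descent U D (Vs : V -> Prop) :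
  NoDup (map par_vertex D) ->
  (forall s, forest (U ++ map (pick s) D)) ->
  (forall c x y, In (c, x, y) D -> Vs c /\ Vs x /\ Vs y) ->
  (forall s u v, Vs u -> Vs v -> conn (U ++ map (pick s) D) u v) ->
  forall n s c x y D' l, Permutation D ((c, x, y) :: D') -> length l <= n ->
  (forall v, conn (U ++ map (pick s) D') (if s c then y else x) v -> In v l) ->
  contractible U D.
Proof.
  intros HN HF HV HC; induction n as [n IH] using lt_wf_ind.
  intros s c x y D' l HP Hl HS.
  set (E := U ++ map (pick s) D') in *.
  assert (Hc : ~ In c (map par_vertex D')).
  { apply (Permutation_map par_vertex) in HP; apply (Permutation_NoDup HP) in HN.
    now inversion HN. }
  assert (PE : forall b : bool, Permutation (U ++ map (pick (upd s c b)) D)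
                 ((c, if b then y else x) :: E)).
  { intros b; rewrite (Permutation_map _ HP); simpl; rewrite upd_same, pick_upd by auto.
    unfold E; perm. }
  (* Both choices at [c] give forests, so without the edge of [c] neither premise is connected to
     [c]. *)
  assert (F1 : forall b : bool, ~ conn E c (if b then y else x)).
  { intros b; specialize (HF (upd s c b)); apply (forest_perm (PE b)) in HF; apply HF. }
  assert (Hcxy : In (c, x, y) D) by (rewrite HP; simpl; auto).
  assert (FE : forest E).
  { specialize (HF (upd s c true)); apply (forest_perm (PE true)) in HF; apply HF. }
  (* The switching keeping [x] connects the two premises, and its edge at [c] cannot help, because
     [c] is separated from both. *)
  assert (Cxy : conn E x y).
  { destruct (HV _ _ _ Hcxy) as [V1 [V2 V3]].
    assert (H := HC (upd s c false) _ _ V3 V2); apply (conn_perm (PE false)) in H.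
    assert (F2 := F1 true); assert (F3 := F1 false).
    rewrite conn_cons in H; simpl in *; intuition auto using conn_sym.
    exfalso; auto using conn_sym. }
  assert (HS' : forall v, conn E x v -> In v l).
  { intros v Hv; apply HS; destruct (s c); eauto using conn_trans, conn_sym. }
  assert (K : forall t D2, In t D' -> Permutation D' (t :: D2) -> conn E x (par_vertex t) ->
     contractible U D \/ forall b, conn (U ++ map (pick s) D2) (if b : bool then y else x)
                                        (snd (pick s t))).
  { intros [[c' x'] y'] D2 Hi HP2 Hc'; unfold par_vertex in Hc'; simpl in Hc'.
    set (z' := snd (pick s (c', x', y'))) in *.
    set (E2 := U ++ map (pick s) D2).
    assert (PE2 : Permutation E ((c', z') :: E2)).
    { unfold E; rewrite (Permutation_map _ HP2); simpl; unfold E2, z'; simpl; perm. }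
    assert (Hcc : c' <> c).
    { intros ->; apply Hc; apply in_map_iff; now exists (c, x', y'). }
    assert (Hc2 : ~ In c (map par_vertex D2)).
    { intros H; apply Hc; rewrite (Permutation_map _ HP2); simpl; auto. }
    assert (I2 : forall u v, conn E2 u v -> conn E u v).
    { intros u v H; apply (conn_perm (Permutation_sym PE2)); now apply conn_wk. }
    assert (F2 : ~ conn E2 c' z').
    { apply (forest_perm PE2) in FE; apply FE. }
    assert (Cz : conn E x z').
    { apply conn_trans with c'; auto.
      apply (conn_perm (Permutation_sym PE2)), conn_in; simpl; auto. }
    destruct (classic (forall b : bool, conn E2 (if b then y else x) z')) as [|Hb]; auto.
    (* With the choice [b] at [c], the kept premise of [c'] is cut off from [c] and from the premise
       that [c] keeps. Its component therefore stays inside that of [x], and it misses [c']. *)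
    left; apply not_all_ex_not in Hb; destruct Hb as [b Hb].
    assert (Hl' : In c' l) by auto.
    assert (HL := remove_length_lt eq_dec l c' Hl').
    apply (IH (length (remove eq_dec c' l))) with (s := upd s c b) (c := c') (x := x')
      (y := y') (D' := (c, x, y) :: D2) (l := remove eq_dec c' l); auto; [lia| |].
    - rewrite HP, HP2; apply perm_swap.
    - intros v Hv.
      replace (if upd s c b c' then y' else x') with z' in Hv
        by (unfold z', upd; simpl; destruct (eq_dec c' c); congruence).
      assert (Hv2 : conn ((c, if b then y else x) :: E2) z' v).
      { revert Hv; apply conn_perm; simpl; rewrite upd_same, pick_upd by auto.
        unfold E2; perm. }
      assert (Hv3 : conn E2 z' v).
      { apply conn_cons in Hv2; destruct Hv2 as [Hv2|[[Hv2 _]|[Hv2 _]]]; auto.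
        - exfalso; apply (F1 false); simpl; apply I2 in Hv2.
          eauto using conn_trans, conn_sym.
        - exfalso; auto using conn_sym. }
      apply in_in_remove.
      + intros ->; auto using conn_sym.
      + apply HS'; eauto using conn_trans. }
  destruct (classic (contractible U D)) as [|Hno]; auto.
  assert (K' : forall t D2, In t D' -> Permutation D' (t :: D2) -> conn E x (par_vertex t) ->
     forall b, conn (U ++ map (pick s) D2) (if b : bool then y else x) (snd (pick s t))).
  { intros t D2 H1 H2 H3; destruct (K t D2 H1 H2 H3); tauto. }
  clear K; exists c, x, y; split; [auto|split].
  (* Deleting one par edge keeps [x] and [y] connected: by [K'] if its conclusion is in the
     component of [x], and otherwise because their connection cannot reach that edge. *)
  - apply conn_dec_edges with (map (pick s) D').
    + revert FE; apply forest_perm; unfold E; perm.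
    + revert Cxy; apply conn_perm; unfold E; perm.
    + intros e E2 He HPe; apply in_map_iff in He; destruct He as [t [He Ht]].
      destruct (in_split _ _ Ht) as [Da [Db HD]].
      assert (HP2 : Permutation D' (t :: Da ++ Db)) by (rewrite HD; symmetry; apply Permutation_middle).
      assert (PE2 : Permutation (U ++ map (pick s) (Da ++ Db)) E2).
      { apply Permutation_cons_inv with e; rewrite <- HPe, <- He, (Permutation_map _ HP2).
        simpl; perm. }
      assert (PE3 : Permutation E (e :: E2)) by (rewrite <- HPe; unfold E; perm).
      destruct (classic (conn E x (par_vertex t))) as [Hxt|Hxt].
      * apply (conn_perm PE2). assert (H := K' t _ Ht HP2 Hxt).
        apply conn_trans with (snd (pick s t)); [apply (H false)|apply conn_sym, (H true)].
      * assert (I2 : forall u v, conn E2 u v -> conn E u v).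
        { intros u v H; apply (conn_perm (Permutation_sym PE3)); destruct e; now apply conn_wk. }
        assert (Cxy' := conn_perm PE3 Cxy); destruct t as [[c' x'] y'], e as [c'' z'].
        inversion He; subst c''; unfold par_vertex in Hxt; simpl in Hxt.
        apply conn_cons in Cxy'; destruct Cxy' as [H|[[H _]|[_ H]]]; auto; exfalso;
          apply Hxt; eauto using conn_trans, conn_sym.
  - intros t Ht Hct. assert (Hxt : conn E x (par_vertex t)).
    { apply conn_sym; revert Hct; apply conn_incl, incl_appl, incl_refl. }
    rewrite HP in Ht; destruct Ht as [<-|Ht].
    + apply (F1 false); auto using conn_sym.
    + destruct (in_split _ _ Ht) as [Da [Db HD]].
      assert (HP2 : Permutation D' (t :: Da ++ Db)) by (rewrite HD; symmetry; apply Permutation_middle).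
      (* [K'] connects [x] to the kept premise of this par without the edge of the par. With its
         conclusion connected to [x] in [U], that edge would close a cycle. *)
      assert (H := K' t _ Ht HP2 Hxt false); simpl in H.
      assert (PE3 : Permutation E (pick s t :: U ++ map (pick s) (Da ++ Db)))
        by (unfold E; rewrite (Permutation_map _ HP2); simpl; perm).
      apply (forest_perm PE3) in FE; destruct t as [[c' x'] y']; simpl in FE, H.
      apply FE. apply conn_trans with x; auto.
      revert Hct; apply conn_incl, incl_appl, incl_refl.
Qed.

Theorem contractible_or_nil U D (Vs : V -> Prop) :
  NoDup (map par_vertex D) ->
  (forall s, forest (U ++ map (pick s) D)) ->
  (forall c x y, In (c, x, y) D -> Vs c /\ Vs x /\ Vs y) ->
  (forall s u v, Vs u -> Vs v -> conn (U ++ map (pick s) D) u v) ->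
  D = [] \/ contractible U D.
Proof.
  intros HN HF HV HC; destruct D as [|[[c x] y] D]; auto; right.
  set (E := U ++ map (pick (fun _ => false)) D).
  (* Any par and any switching can start the descent. The endpoints of all edges, with [x] added in
     case it is isolated, bound the component. *)
  eapply (contractible_descent U Vs HN HF HV HC) with (s := fun _ => false)
    (l := x :: flat_map (fun e => [fst e; snd e]) E); eauto.
  intros v Hv; simpl in Hv.
  assert (HW : within (fun w => In w (flat_map (fun e => [fst e; snd e]) E)) E).
  { intros a b Hi; split; apply in_flat_map; exists (a, b); simpl; auto. }
  destruct (conn_within HW Hv) as [<-|[_ H]]; simpl; auto.
Qed.
End Paired.
Arguments par_vertex {V} t.

(** * Switchings seen on the leaves *)

Notation edges := (list (vtx * vtx)).

Section Switch.
Variable A : Type.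
Implicit Types (t l r : tree A) (s : switching) (E B : edges).

(* [psw t v E]: some switching of [t] partitions its leaves into the connected
   components of [E], and [v] is a leaf in the component of the root. *)
Inductive psw : tree A -> vtx -> edges -> Prop :=
| psw_leaf x k : psw (Leaf x k) (VL x) []
| psw_tens l r u v El Er :
    psw l u El -> psw r v Er -> psw (Tens l r) u ((u, v) :: El ++ Er)
| psw_parl l r u v El Er :
    psw l u El -> psw r v Er -> psw (Par l r) u (El ++ Er)
| psw_parr l r u v El Er :
    psw l u El -> psw r v Er -> psw (Par l r) v (El ++ Er).

(** [rep] and [leaf_edges] compute the data of [psw] for a given switching. A par adds no edge,
    since its vertex hangs on a single premise. *)
Fixpoint rep s (mk : list bool -> vtx) t (p : list bool) : vtx :=
  match t with
  | Leaf x _ => VL x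
  | Tens l r => rep s mk l (p ++ [false])
  | Par l r => if s (mk p) then rep s mk r (p ++ [true]) else rep s mk l (p ++ [false])
  end.

Fixpoint leaf_edges s (mk : list bool -> vtx) t (p : list bool) : edges :=
  match t with
  | Leaf _ _ => []
  | Tens l r => (rep s mk l (p ++ [false]), rep s mk r (p ++ [true])) ::
      leaf_edges s mk l (p ++ [false]) ++ leaf_edges s mk r (p ++ [true])
  | Par l r => leaf_edges s mk l (p ++ [false]) ++ leaf_edges s mk r (p ++ [true])
  end.

Fixpoint kept_edges s (mk : list bool -> vtx) t (p : list bool) : edges :=
  match t with
  | Leaf _ _ => []
  | Tens l r =>
      (mk p, rootv mk l (p ++ [false])) :: (mk p, rootv mk r (p ++ [true])) ::
      kept_edges s mk l (p ++ [false]) ++ kept_edges s mk r (p ++ [true])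
  | Par l r =>
      (mk p, if s (mk p) then rootv mk r (p ++ [true]) else rootv mk l (p ++ [false])) ::
      kept_edges s mk l (p ++ [false]) ++ kept_edges s mk r (p ++ [true])
  end.

Lemma psw_rep s mk t p : psw t (rep s mk t p) (leaf_edges s mk t p).
Proof.
  revert p; induction t as [x k|l IHl r IHr|l IHl r IHr]; intros p; simpl.
  - constructor.
  - now constructor.
  - destruct (s (mk p)); [eapply psw_parr|eapply psw_parl]; eauto.
Qed.

(** Agreement with [f] is required only below [p], so that the choices for subtrees, and later for
    different trees, can be glued into one switching. *)
Lemma psw_switching t v E : psw t v E ->
  exists f : list bool -> bool, forall s mk p, (forall q, s (mk (p ++ q)) = f q) ->
    rep s mk t p = v /\ leaf_edges s mk t p = E.
Proof.
  assert (K : forall b (fl fr : list bool -> bool), exists f : list bool -> bool,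
    forall s (mk : list bool -> vtx) p, (forall q, s (mk (p ++ q)) = f q) ->
      s (mk p) = b /\ (forall q, s (mk ((p ++ [false]) ++ q)) = fl q) /\
      (forall q, s (mk ((p ++ [true]) ++ q)) = fr q)).
  { intros b fl fr.
    exists (fun q => match q with [] => b | false :: q' => fl q' | true :: q' => fr q' end).
    intros s mk p H; repeat split.
    - specialize (H []); now rewrite app_nil_r in H.
    - intros q; rewrite <- app_assoc; apply (H (false :: q)).
    - intros q; rewrite <- app_assoc; apply (H (true :: q)). }
  induction 1 as [x k|l r u v El Er _ [fl IHl] _ [fr IHr]
    |l r u v El Er _ [fl IHl] _ [fr IHr]|l r u v El Er _ [fl IHl] _ [fr IHr]].
  - exists (fun _ => false); auto.
  - destruct (K false fl fr) as [f Hf]; exists f; intros s mk p H; simpl.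
    destruct (Hf s mk p H) as [_ [H1 H2]].
    destruct (IHl s mk _ H1) as [-> ->], (IHr s mk _ H2) as [-> ->]; auto.
  - destruct (K false fl fr) as [f Hf]; exists f; intros s mk p H; simpl.
    destruct (Hf s mk p H) as [-> [H1 H2]].
    destruct (IHl s mk _ H1) as [-> ->], (IHr s mk _ H2) as [_ ->]; auto.
  - destruct (K true fl fr) as [f Hf]; exists f; intros s mk p H; simpl.
    destruct (Hf s mk p H) as [-> [H1 H2]].
    destruct (IHl s mk _ H1) as [_ ->], (IHr s mk _ H2) as [-> ->]; auto.
Qed.

Definition is_leaf_of t (v : vtx) : Prop := exists x, v = VL x /\ In x (names t).

Lemma names_tens l r : names (Tens l r) = names l ++ names r.
Proof. unfold names; simpl; apply map_app. Qed.
Lemma names_par l r : names (Par l r) = names l ++ names r.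
Proof. unfold names; simpl; apply map_app. Qed.

Lemma is_leaf_of_l l r v : is_leaf_of l v -> is_leaf_of (Tens l r) v.
Proof. intros [x [-> H]]; exists x; rewrite names_tens, in_app_iff; auto. Qed.
Lemma is_leaf_of_r l r v : is_leaf_of r v -> is_leaf_of (Tens l r) v.
Proof. intros [x [-> H]]; exists x; rewrite names_tens, in_app_iff; auto. Qed.

Lemma psw_within t v E : psw t v E -> is_leaf_of t v /\ within (is_leaf_of t) E.
Proof.
  assert (K : forall l r El Er, within (is_leaf_of l) El -> within (is_leaf_of r) Er ->
    within (is_leaf_of (Tens l r)) (El ++ Er)).
  { intros l r El Er H1 H2; apply within_app; split.
    - revert H1; apply within_impl; intros; now apply is_leaf_of_l.
    - revert H2; apply within_impl; intros; now apply is_leaf_of_r. }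
  induction 1 as [x k|l r u v El Er _ [H1 H2] _ [H3 H4]
    |l r u v El Er _ [H1 H2] _ [H3 H4]|l r u v El Er _ [H1 H2] _ [H3 H4]].
  - split; [exists x; simpl; auto|apply within_nil].
  - rewrite within_cons; auto using is_leaf_of_l, is_leaf_of_r.
  - split; [now apply is_leaf_of_l|now apply K].
  - split; [now apply is_leaf_of_r|now apply K].
Qed.

(** The edge joining a tree to what lies above it; [None] at a root, or when a par above drops the
    edge. *)
Definition link (c : option vtx) (v : vtx) : edges :=
  match c with Some k => [(k, v)] | None => [] end.

Definition proper (mk : list bool -> vtx) : Prop :=
  (forall p q, mk p = mk q -> p = q) /\ forall p x, mk p <> VL x.

Definition outside (mk : list bool -> vtx) p (v : vtx) : Prop :=
  forall q, v <> mk (p ++ q).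

(** * Elimination of the internal vertices of a tree *)

Section Outside.
Variable mk : list bool -> vtx.
Hypothesis Hmk : proper mk.

Lemma outside_leaf p x : outside mk p (VL x).
Proof. intros q H; symmetry in H; revert H; apply Hmk. Qed.

Lemma outside_is_leaf t p v : is_leaf_of t v -> outside mk p v.
Proof. intros [x [-> _]]; apply outside_leaf. Qed.

Lemma outside_child p d v : outside mk p v -> outside mk (p ++ [d]) v.
Proof. intros H q; rewrite <- app_assoc; apply H. Qed.

Lemma outside_self p d : outside mk (p ++ [d]) (mk p).
Proof.
  intros q H; apply Hmk in H; rewrite <- app_assoc in H.
  rewrite <- (app_nil_r p) in H at 1; apply app_inv_head in H; discriminate.
Qed.

Lemma outside_sibling p d d' q : d <> d' -> outside mk (p ++ [d]) (mk ((p ++ [d']) ++ q)).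
Proof.
  intros Hd q' H; apply Hmk in H; rewrite <- !app_assoc in H.
  apply app_inv_head in H; simpl in H; congruence.
Qed.

Lemma rootv_outside t p d d' : d <> d' ->
  outside mk (p ++ [d]) (rootv mk t (p ++ [d'])).
Proof.
  intros Hd; destruct t; simpl; [apply outside_leaf| |];
    rewrite <- (app_nil_r (p ++ [d'])); now apply outside_sibling.
Qed.

Lemma rootv_neq t p d : rootv mk t (p ++ [d]) <> mk p.
Proof.
  intros H; destruct t; simpl in H; [symmetry in H; revert H; apply Hmk| |];
    symmetry in H; revert H; rewrite <- (app_nil_r (p ++ [d])); apply outside_self.
Qed.

Lemma kept_edges_shape s t p a b : In (a, b) (kept_edges s mk t p) ->
  exists q, a = mk (p ++ q) /\
    ((exists x, b = VL x /\ In x (names t)) \/ exists d, b = mk (p ++ q ++ [d])).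
Proof.
  assert (K1 : forall l r t' d p, (t' = l \/ t' = r) -> exists q, mk p = mk (p ++ q) /\
    ((exists x, rootv mk t' (p ++ [d]) = VL x /\ In x (names (Tens l r))) \/
      exists d', rootv mk t' (p ++ [d]) = mk (p ++ q ++ [d']))).
  { intros l r t' d p0 Hl; exists []; rewrite app_nil_r; split; auto.
    destruct t' as [x k| |]; simpl; [left; exists x; split; auto|eauto|eauto].
    rewrite names_tens, in_app_iff; destruct Hl; subst; simpl; auto. }
  assert (K2 : forall l r t' d p a b, (t' = l \/ t' = r) ->
    (exists q, a = mk ((p ++ [d]) ++ q) /\
      ((exists x, b = VL x /\ In x (names t')) \/ exists d', b = mk ((p ++ [d]) ++ q ++ [d']))) ->
    exists q, a = mk (p ++ q) /\
      ((exists x, b = VL x /\ In x (names (Tens l r))) \/ exists d', b = mk (p ++ q ++ [d']))).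
  { intros l r t' d p0 a0 b0 Ht [q [-> H]]; exists (d :: q); split.
    - now rewrite <- app_assoc.
    - destruct H as [[x [-> Hx]]|[d' ->]].
      + left; exists x; rewrite names_tens, in_app_iff; destruct Ht; subst; auto.
      + right; exists d'; now rewrite <- app_assoc. }
  revert p a b; induction t as [x k|l IHl r IHr|l IHl r IHr]; intros p a b; simpl.
  - tauto.
  - rewrite in_app_iff; intros [H|[H|[H|H]]]; try (inversion H; subst); eauto.
  - change (names (Par l r)) with (names (Tens l r)).
    rewrite in_app_iff; intros [H|[H|H]]; try (inversion H; subst); eauto.
    destruct (s (mk p)); eauto.
Qed.

Lemma kept_edges_outside s t p d d' : d <> d' ->
  within (outside mk (p ++ [d])) (kept_edges s mk t (p ++ [d'])).
Proof.
  intros Hd a b H; destruct (kept_edges_shape _ _ _ _ _ H) as [q [-> Hb]].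
  split; [now apply outside_sibling|].
  destruct Hb as [[x [-> _]]|[d0 ->]]; [apply outside_leaf|now apply outside_sibling].
Qed.

Lemma kept_edges_avoid s t p d : avoid (mk p) (kept_edges s mk t (p ++ [d])).
Proof.
  intros a b H; destruct (kept_edges_shape _ _ _ _ _ H) as [q [-> Hb]].
  assert (K : forall q, mk ((p ++ [d]) ++ q) <> mk p)
    by (intros q' H'; symmetry in H'; revert H'; apply outside_self).
  split; [apply K|].
  destruct Hb as [[x [-> _]]|[d0 ->]]; [intros H'; symmetry in H'; revert H'; apply Hmk|apply K].
Qed.

Lemma leaf_edges_outside s t p p' : within (outside mk p') (leaf_edges s mk t p).
Proof.
  destruct (psw_within (psw_rep s mk t p)) as [_ H]; revert H; apply within_impl.
  intros v; apply outside_is_leaf.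
Qed.

Lemma rep_outside s t p p' : outside mk p' (rep s mk t p).
Proof. exact (outside_is_leaf _ (proj1 (psw_within (psw_rep s mk t p)))). Qed.

Lemma within_avoid_self p B : within (outside mk p) B -> avoid (mk p) B.
Proof.
  intros H; eapply within_avoid; [exact H|]; intros Hp; apply (Hp []); now rewrite app_nil_r.
Qed.

Lemma avoid_app v E F : avoid v E -> avoid v F -> avoid v (E ++ F).
Proof. intros H1 H2 a b H; apply in_app_or in H; destruct H; eauto. Qed.
Lemma avoid_cons v a b E : a <> v -> b <> v -> avoid v E -> avoid v ((a, b) :: E).
Proof. intros H1 H2 H3 c d [H|H]; [inversion H; subst; auto|eauto]. Qed.

(* Internal vertices are eliminated from the root upwards: after sliding the edge
   [c] below a vertex to one of its children, that vertex is pendant or has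
   degree two. *)
Lemma kept_leaf_sim s t p (c : option vtx) B :
  (forall k, c = Some k -> outside mk p k) -> within (outside mk p) B ->
  sim (outside mk p) (link c (rootv mk t p) ++ B ++ kept_edges s mk t p)
                     (link c (rep s mk t p) ++ B ++ leaf_edges s mk t p).
Proof.
  assert (TR : forall O (E F G : edges), sim O E F -> sim O F G -> sim O E G)
    by (intros; eapply sim_trans; eauto).
  assert (PE : forall O (E F G : edges), Permutation E F -> sim O F G -> sim O E G)
    by (intros; eapply sim_trans; [apply sim_perm|]; eauto).
  assert (Hself : forall p, ~ outside mk p (mk p))
    by (intros p0 H; apply (H []); now rewrite app_nil_r).
  revert p c B; induction t as [x k|l IHl r IHr|l IHl r IHr]; intros p c B Hc HB.
  - simpl; apply sim_refl.
  - simpl rootv; simpl rep; simpl kept_edges; simpl leaf_edges.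
    set (v := mk p); set (a := rootv mk l (p ++ [false])); set (b := rootv mk r (p ++ [true])).
    set (Kl := kept_edges s mk l (p ++ [false])); set (Kr := kept_edges s mk r (p ++ [true])).
    set (u := rep s mk l (p ++ [false])); set (w := rep s mk r (p ++ [true])).
    set (El := leaf_edges s mk l (p ++ [false])); set (Er := leaf_edges s mk r (p ++ [true])).
    assert (Hav : avoid v (B ++ Kl ++ Kr))
      by (apply avoid_app; [now apply within_avoid_self|apply avoid_app; apply kept_edges_avoid]).
    assert (Hva : a <> v) by apply rootv_neq.
    assert (Hvb : b <> v) by apply rootv_neq.
    assert (Ol : forall v, outside mk p v -> outside mk (p ++ [false]) v)
      by (intros; now apply outside_child).
    assert (Or : forall v, outside mk p v -> outside mk (p ++ [true]) v)
      by (intros; now apply outside_child).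
    assert (HBl := within_impl _ Ol HB); assert (HBr := within_impl _ Or HB).
    assert (HKr : within (outside mk (p ++ [false])) Kr) by (apply kept_edges_outside; congruence).
    assert (HEl : within (outside mk (p ++ [true])) El) by apply leaf_edges_outside.
    assert (Hbl : outside mk (p ++ [false]) b) by (apply rootv_outside; congruence).
    assert (Hur : outside mk (p ++ [true]) u) by apply rep_outside.
    destruct c as [k|]; simpl.
    (* The tensor vertex has degree three. Sliding the edge of [k] onto [a] leaves degree two, and
       the contracted edge is slid to [k], so that both subtrees hang from [k]. *)
    + specialize (Hc k eq_refl).
      eapply PE with ((k, v) :: (v, a) :: (v, b) :: B ++ Kl ++ Kr); [perm|].
      eapply TR; [apply sim_slide_r with (b' := a), conn_in; simpl; auto|].
      eapply PE with ((v, a) :: (v, b) :: (k, a) :: B ++ Kl ++ Kr); [perm|].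
      eapply TR; [apply sim_elim2; auto; apply avoid_cons; auto; intros ->; now apply (Hself p)|].
      eapply TR; [apply sim_slide with (a' := k), conn_sym, conn_in; simpl; auto|].
      eapply PE with (link (Some k) a ++ ((k, b) :: B ++ Kr) ++ Kl); [simpl; perm|].
      eapply TR; [eapply sim_weak; [exact Ol|]; apply IHl|].
      * intros k' [= <-]; auto.
      * apply within_cons; split; [auto|apply within_app; auto].
      * fold u; fold El.
        eapply PE with (link (Some k) b ++ ((k, u) :: B ++ El) ++ Kr); [simpl; perm|].
        eapply TR; [eapply sim_weak; [exact Or|]; apply IHr|].
        -- intros k' [= <-]; auto.
        -- apply within_cons; split; [auto|apply within_app; auto].
        -- fold w; fold Er; simpl.
           eapply TR; [apply sim_slide with (a' := u), conn_in; simpl; auto|].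
           apply sim_perm; perm.
    + eapply PE with ((v, a) :: (v, b) :: B ++ Kl ++ Kr); [perm|].
      eapply TR; [apply sim_elim2; auto|].
      eapply TR; [apply sim_flip|].
      eapply PE with (link (Some b) a ++ (B ++ Kr) ++ Kl); [simpl; perm|].
      eapply TR; [eapply sim_weak; [exact Ol|]; apply IHl|].
      * intros k' [= <-]; auto.
      * apply within_app; auto.
      * fold u; fold El; simpl. eapply TR; [apply sim_flip|].
        eapply PE with (link (Some u) b ++ (B ++ El) ++ Kr); [simpl; perm|].
        eapply TR; [eapply sim_weak; [exact Or|]; apply IHr|].
        -- intros k' [= <-]; auto.
        -- apply within_app; auto.
        -- fold w; fold Er; simpl. apply sim_perm; perm.
  - simpl rootv; simpl rep; simpl kept_edges; simpl leaf_edges.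
    set (v := mk p).
    set (Kl := kept_edges s mk l (p ++ [false])); set (Kr := kept_edges s mk r (p ++ [true])).
    set (El := leaf_edges s mk l (p ++ [false])); set (Er := leaf_edges s mk r (p ++ [true])).
    assert (Ol : forall v, outside mk p v -> outside mk (p ++ [false]) v)
      by (intros; now apply outside_child).
    assert (Or : forall v, outside mk p v -> outside mk (p ++ [true]) v)
      by (intros; now apply outside_child).
    assert (HBl := within_impl _ Ol HB); assert (HBr := within_impl _ Or HB).
    assert (HKr : within (outside mk (p ++ [false])) Kr) by (apply kept_edges_outside; congruence).
    assert (HEl : within (outside mk (p ++ [true])) El) by apply leaf_edges_outside.
    assert (Hav : avoid v (B ++ Kl ++ Kr))
      by (apply avoid_app; [now apply within_avoid_self|apply avoid_app; apply kept_edges_avoid]).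
    (* After the edge above is slid to the kept premise [x], the par vertex is pendant. *)
    assert (K : forall x, x <> v -> sim (outside mk p)
      (link c v ++ B ++ (v, x) :: Kl ++ Kr) (link c x ++ B ++ Kl ++ Kr)).
    { intros x Hx; destruct c as [k|]; simpl.
      - specialize (Hc k eq_refl).
        eapply PE with ((k, v) :: (v, x) :: B ++ Kl ++ Kr); [perm|].
        eapply TR; [apply sim_slide_r with (b' := x), conn_in; simpl; auto|].
        eapply PE with ((v, x) :: (k, x) :: B ++ Kl ++ Kr); [perm|].
        apply sim_pendant; auto. apply avoid_cons; auto; intros ->; now apply (Hself p).
      - eapply PE with ((v, x) :: B ++ Kl ++ Kr); [perm|]. now apply sim_pendant; auto. }
    eapply TR; [apply K; destruct (s v); apply rootv_neq|].
    (* The premise that is not kept is a detached tree, whence its [link None]. *)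
    destruct (s v).
    + eapply PE with (link None (rootv mk l (p ++ [false])) ++
        (link c (rootv mk r (p ++ [true])) ++ B ++ Kr) ++ Kl); [simpl; perm|].
      eapply TR; [eapply sim_weak; [exact Ol|]; apply IHl|].
      * discriminate.
      * apply within_app; split; [|apply within_app; auto].
        destruct c as [k|]; simpl; [|apply within_nil]. apply within_cons; split;
          [split; [auto|apply rootv_outside; congruence]|apply within_nil].
      * fold El; simpl.
        eapply PE with (link c (rootv mk r (p ++ [true])) ++ (B ++ El) ++ Kr); [simpl; perm|].
        eapply TR; [eapply sim_weak; [exact Or|]; apply IHr|].
        -- intros k ->; auto.
        -- apply within_app; auto.
        -- fold Er; apply sim_perm; perm.
    + eapply PE with (link c (rootv mk l (p ++ [false])) ++ (B ++ Kr) ++ Kl); [perm|].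
      eapply TR; [eapply sim_weak; [exact Ol|]; apply IHl|].
      * intros k ->; auto.
      * apply within_app; auto.
      * fold El; set (u := rep s mk l (p ++ [false])).
        eapply PE with (link None (rootv mk r (p ++ [true])) ++ (link c u ++ B ++ El) ++ Kr);
          [simpl; perm|].
        eapply TR; [eapply sim_weak; [exact Or|]; apply IHr|].
        -- discriminate.
        -- apply within_app; split; [|apply within_app; auto].
           destruct c as [k|]; simpl; [|apply within_nil]. apply within_cons; split;
             [split; [auto|apply rep_outside]|apply within_nil].
        -- fold Er; simpl; apply sim_perm; perm.
Qed.
End Outside.
End Switch.

(** * Correctness seen on the leaves *)

Section Correct.
Variable A : Type.
Implicit Types (t l r P : tree A) (G : list (tree A)) (s : switching) (E B : edges).

(** The root representatives are dropped, as nothing is attached above a formula of the sequent. *)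
Inductive fsw : list (tree A) -> edges -> Prop :=
| fsw_nil : fsw [] []
| fsw_cons t G v E F : psw t v E -> fsw G F -> fsw (t :: G) (E ++ F).

Fixpoint kept_forest s i G : edges :=
  match G with
  | [] => []
  | t :: G' => kept_edges s (VG i) t [] ++ kept_forest s (S i) G'
  end.

Fixpoint leaf_forest s i G : edges :=
  match G with
  | [] => []
  | t :: G' => leaf_edges s (VG i) t [] ++ leaf_forest s (S i) G'
  end.

Definition tree_on (W : vtx -> Prop) E : Prop :=
  forest E /\ forall u v, W u -> W v -> conn E u v.

(** Correctness without names for internal nodes: it quantifies over leaf partitions instead of
    switchings and can thus be compared along rewritings of [P]. *)
Definition net P G : Prop :=
  forall v E F, psw P v E -> fsw G F -> tree_on (is_leaf_of P) (E ++ F).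

Lemma tree_on_sim (O W : vtx -> Prop) E F :
  sim O E F -> (forall v, W v -> O v) -> tree_on W E -> tree_on W F.
Proof.
  intros [H1 H2] H [H3 H4]; split; [tauto|].
  intros u v Hu Hv; apply H2; auto.
Qed.

Lemma proper_VP : proper VP.
Proof. split; congruence. Qed.
Lemma proper_VG i : proper (VG i).
Proof. split; congruence. Qed.

Lemma fsw_leaf_forest s i G : fsw G (leaf_forest s i G).
Proof.
  revert i; induction G as [|t G IH]; intros i; simpl; [constructor|].
  econstructor; [apply psw_rep|apply IH].
Qed.

Lemma fsw_switching G F : fsw G F ->
  exists f : nat -> list bool -> bool, forall s i,
    (forall j q, s (VG (i + j) q) = f j q) -> leaf_forest s i G = F.
Proof.
  induction 1 as [|t G v E F H _ [f IH]].
  - exists (fun _ _ => false); auto.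
  - destruct (psw_switching H) as [g Hg].
    exists (fun j => match j with O => g | S j => f j end); intros s i Hs; simpl.
    rewrite (IH s (S i)).
    + rewrite (proj2 (Hg s (VG i) [] (fun q => eq_trans (f_equal (fun k => s (VG k q)) (plus_n_O i)) (Hs 0 q)))).
      reflexivity.
    + intros j q; rewrite <- (Hs (S j) q); f_equal; f_equal; lia.
Qed.

Lemma net_switching P G v E F : psw P v E -> fsw G F ->
  exists s, leaf_edges s VP P [] = E /\ leaf_forest s 0 G = F.
Proof.
  intros H1 H2; destruct (psw_switching H1) as [f Hf], (fsw_switching H2) as [g Hg].
  (* A leaf makes no choice; [false] is a default there. *)
  exists (fun v => match v with VL _ => false | VP p => f p | VG i p => g i p end).
  split; [apply (Hf _ VP []); auto|apply Hg; auto].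
Qed.

Definition leaf_vtx (v : vtx) : Prop := exists x, v = VL x.

Lemma kept_forest_shape s i G a b : In (a, b) (kept_forest s i G) ->
  exists j q, i <= j /\ a = VG j q /\
    (leaf_vtx b \/ exists d, b = VG j (q ++ [d])).
Proof.
  revert i; induction G as [|t G IH]; intros i; simpl; [tauto|].
  rewrite in_app_iff; intros [H|H].
  - destruct (kept_edges_shape _ _ _ _ _ _ H) as [q [-> Hb]].
    exists i, q; repeat split; auto.
    destruct Hb as [[x [-> _]]|[d ->]]; [left; now exists x|right; now exists d].
  - destruct (IH _ H) as [j [q [Hj H']]]; exists j, q; split; [lia|auto].
Qed.

(** One tree is reduced at a time, the others counting among the surrounding edges. *)
Lemma kept_forest_sim s i G B :
  within (fun v => forall j q, i <= j -> v <> VG j q) B ->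
  sim leaf_vtx (B ++ kept_forest s i G) (B ++ leaf_forest s i G).
Proof.
  revert i B; induction G as [|t G IH]; intros i B HB; simpl; [apply sim_refl|].
  set (O := outside (VG i) []).
  assert (HO : forall v, leaf_vtx v -> O v)
    by (intros v [x ->]; apply outside_leaf, proper_VG).
  eapply sim_trans; [apply sim_perm with (F := (B ++ kept_forest s (S i) G) ++ kept_edges s (VG i) t []); perm|].
  eapply sim_trans.
  - eapply sim_weak; [exact HO|].
    apply (@kept_leaf_sim A _ (proper_VG i) s t [] None); [discriminate|].
    apply within_app; split.
    + revert HB; apply within_impl; intros v H q; apply H; auto.
    + intros a b H; destruct (kept_forest_shape _ _ _ _ _ H) as [j [q [Hj [-> Hb]]]].
      split; [intros q' [= <-]; lia|].
      destruct Hb as [[x ->]|[d ->]]; intros q'; [discriminate|intros [= <-]; lia].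
  - simpl. eapply sim_trans; [|eapply sim_trans; [apply (IH (S i) (B ++ leaf_edges s (VG i) t []))|]].
    + apply sim_perm; perm.
    + apply within_app; split.
      * revert HB; apply within_impl; intros v H j q Hj; apply H; lia.
      * intros a b H.
        assert (K : is_leaf_of t a /\ is_leaf_of t b)
          by (eapply psw_within; [apply psw_rep|exact H]).
        destruct K as [[x [-> _]] [y [-> _]]]; split; discriminate.
    + apply sim_perm; perm.
Qed.

Definition kept_graph s P G : edges := kept_edges s VP P [] ++ kept_forest s 0 G.

Lemma kept_graph_half_sim s P G :
  sim (outside VP []) (kept_graph s P G) (leaf_edges s VP P [] ++ kept_forest s 0 G).
Proof.
  eapply sim_trans; [apply sim_perm with (F := kept_forest s 0 G ++ kept_edges s VP P []);
    unfold kept_graph; perm|].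
  eapply sim_trans; [apply (@kept_leaf_sim A _ proper_VP s P [] None)|].
  - discriminate.
  - intros a b H; destruct (kept_forest_shape _ _ _ _ _ H) as [j [q [_ [-> Hb]]]].
    split; [discriminate|]; destruct Hb as [[x ->]|[d ->]]; discriminate.
  - simpl; apply sim_perm; perm.
Qed.

(** The left-hand graph, with only the linking reduced to its leaves, is also where the construction
    of the sequent proof starts. *)
Lemma leaf_kept_sim s P G :
  sim leaf_vtx (leaf_edges s VP P [] ++ kept_forest s 0 G)
               (leaf_edges s VP P [] ++ leaf_forest s 0 G).
Proof.
  apply kept_forest_sim; intros a b H.
  assert (K : is_leaf_of P a /\ is_leaf_of P b)
    by (eapply psw_within; [apply psw_rep|exact H]).
  destruct K as [[x [-> _]] [y [-> _]]]; split; discriminate.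
Qed.

Lemma kept_graph_sim s P G :
  sim leaf_vtx (kept_graph s P G) (leaf_edges s VP P [] ++ leaf_forest s 0 G).
Proof.
  eapply sim_trans; [eapply sim_weak; [|apply kept_graph_half_sim]|apply leaf_kept_sim].
  intros v [x ->]; discriminate.
Qed.

(** * Agreement with the graphs and switchings of the definitions *)

Lemma tedges_kept s mk t p a b :
  In (a, b) (kept_edges s mk t p) <->
  exists ip sd, In (a, ip, sd, b) (tedges mk t p) /\ kept s (a, ip, sd, b).
Proof.
  revert p; induction t as [x k|l IHl r IHr|l IHl r IHr]; intros p; simpl.
  - split; [tauto|intros [? [? [[] _]]]].
  - rewrite in_app_iff, IHl, IHr; split.
    + intros [H|[H|[[ip [sd [H1 H2]]]|[ip [sd [H1 H2]]]]]].
      * inversion H; subst; exists false, false; auto.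
      * inversion H; subst; exists false, true; auto.
      * exists ip, sd; rewrite in_app_iff; auto.
      * exists ip, sd; rewrite in_app_iff; auto.
    + intros [ip [sd [H1 H2]]]; rewrite in_app_iff in H1.
      destruct H1 as [H1|[H1|[H1|H1]]]; [inversion H1; auto|inversion H1; auto| |];
        right; right; [left|right]; eauto.
  - rewrite in_app_iff, IHl, IHr; split.
    + intros [H|[[ip [sd [H1 H2]]]|[ip [sd [H1 H2]]]]].
      * destruct (s (mk p)) eqn:Hs; inversion H; subst; [exists true, true|exists true, false];
          split; auto; right; auto.
      * exists ip, sd; rewrite in_app_iff; auto.
      * exists ip, sd; rewrite in_app_iff; auto.
    + intros [ip [sd [H1 H2]]]; rewrite in_app_iff in H1.
      destruct H1 as [H1|[H1|[H1|H1]]]; [| |right; left; eauto|right; right; eauto];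
        inversion H1; subst; destruct H2 as [H2|H2]; try discriminate; rewrite H2; auto.
Qed.

Lemma gedges_kept s P G a b :
  In (a, b) (kept_graph s P G) <->
  exists ip sd, In (a, ip, sd, b) (gedges P G) /\ kept s (a, ip, sd, b).
Proof.
  unfold kept_graph, gedges.
  assert (K : forall i, In (a, b) (kept_forest s i G) <->
    exists ip sd, In (a, ip, sd, b) (forest_edges i G) /\ kept s (a, ip, sd, b)).
  { induction G as [|t G IH]; intros i; simpl.
    - split; [tauto|intros [? [? [[] _]]]].
    - rewrite in_app_iff, tedges_kept, IH; split.
      + intros [[ip [sd [H1 H2]]]|[ip [sd [H1 H2]]]]; exists ip, sd; rewrite in_app_iff; auto.
      + intros [ip [sd [H1 H2]]]; rewrite in_app_iff in H1; destruct H1; eauto. }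
  rewrite in_app_iff, tedges_kept, K; split.
  - intros [[ip [sd [H1 H2]]]|[ip [sd [H1 H2]]]]; exists ip, sd; rewrite in_app_iff; auto.
  - intros [ip [sd [H1 H2]]]; rewrite in_app_iff in H1; destruct H1; eauto.
Qed.

Lemma sadj_adj s P G u v :
  sadj P G s no_removal u v <-> adj (kept_graph s P G) u v.
Proof.
  unfold sadj, adj; rewrite !gedges_kept; split.
  - intros [[[[a ip] sd] b] [H1 [H2 [_ H3]]]].
    destruct H3 as [[-> ->]|[-> ->]]; [left|right]; eauto.
  - intros [[ip [sd [H1 H2]]]|[ip [sd [H1 H2]]]]; eexists; repeat split; eauto; simpl; auto.
Qed.

Lemma conn_sadj s P G u v :
  conn (kept_graph s P G) u v <-> clos_refl_trans vtx (sadj P G s no_removal) u v.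
Proof.
  split.
  - assert (Hs : forall u v, clos_refl_trans vtx (sadj P G s no_removal) u v ->
      clos_refl_trans vtx (sadj P G s no_removal) v u).
    { induction 1 as [x y H| |]; eauto using rt_refl, rt_trans.
      apply rt_step; rewrite sadj_adj in *; unfold adj in *; tauto. }
    induction 1 as [x y H| | |]; eauto using rt_refl, rt_trans.
    apply rt_step, sadj_adj; left; auto.
  - induction 1 as [x y H| |]; eauto using conn_refl, conn_trans.
    now apply conn_adj, sadj_adj.
Qed.

Lemma rootv_tverts mk t p : In (rootv mk t p) (tverts mk t p).
Proof. destruct t; simpl; auto. Qed.

(** Every internal vertex keeps an edge to some child, so descending ends in a leaf. *)
Lemma tverts_conn s mk t p u : In u (tverts mk t p) ->
  exists x, In x (names t) /\ conn (kept_edges s mk t p) u (VL x).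
Proof.
  assert (K : forall l r p, 
    (forall p u, In u (tverts mk l p) -> exists x, In x (names l) /\ conn (kept_edges s mk l p) u (VL x)) ->
    (forall p u, In u (tverts mk r p) -> exists x, In x (names r) /\ conn (kept_edges s mk r p) u (VL x)) ->
    forall u E, In u (tverts mk l (p ++ [false]) ++ tverts mk r (p ++ [true])) ->
    exists x, In x (names (Tens l r)) /\ conn (E ++ kept_edges s mk l (p ++ [false]) ++ kept_edges s mk r (p ++ [true])) u (VL x)).
  { intros l r p0 Hl Hr u0 E H; rewrite in_app_iff in H; destruct H as [H|H];
      [destruct (Hl _ _ H) as [x [H1 H2]]|destruct (Hr _ _ H) as [x [H1 H2]]];
      exists x; rewrite names_tens, in_app_iff; split; auto; revert H2; apply conn_incl;
      intros e He; rewrite !in_app_iff; auto. }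
  assert (K2 : forall l r p a E,
    (forall u E, In u (tverts mk l (p ++ [false]) ++ tverts mk r (p ++ [true])) ->
    exists x, In x (names (Tens l r)) /\ conn (E ++ kept_edges s mk l (p ++ [false]) ++ kept_edges s mk r (p ++ [true])) u (VL x)) ->
    In (mk p, a) E -> In a (tverts mk l (p ++ [false]) ++ tverts mk r (p ++ [true])) ->
    exists x, In x (names (Tens l r)) /\ conn (E ++ kept_edges s mk l (p ++ [false]) ++ kept_edges s mk r (p ++ [true])) (mk p) (VL x)).
  { intros l r p0 a E H H1 H2; destruct (H _ E H2) as [x [H3 H4]]; exists x; split; auto.
    apply conn_trans with a; auto; apply conn_in, in_app_iff; auto. }
  revert p u; induction t as [x k|l IHl r IHr|l IHl r IHr]; intros p u; simpl.
  - intros [<-|[]]; exists x; split; [simpl; auto|apply conn_refl].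
  - intros [<-|H].
    + apply (K2 l r p (rootv mk l (p ++ [false])) [_; _]); simpl; auto.
      rewrite in_app_iff; auto using rootv_tverts.
    + apply (K l r p IHl IHr u [_; _] H).
  - change (names (Par l r)) with (names (Tens l r)); intros [<-|H].
    + eapply (K2 l r p _ [_]); [auto|simpl; auto|].
      rewrite in_app_iff; destruct (s (mk p)); auto using rootv_tverts.
    + apply (K l r p IHl IHr u [_] H).
Qed.

Lemma kept_edges_NoDup s mk t p : proper mk -> NoDup (names t) -> NoDup (kept_edges s mk t p).
Proof.
  intros Hmk.
  assert (K : forall l r p, NoDup (kept_edges s mk l (p ++ [false])) ->
    NoDup (kept_edges s mk r (p ++ [true])) ->
    NoDup (kept_edges s mk l (p ++ [false]) ++ kept_edges s mk r (p ++ [true]))).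
  { intros l r p0 H1 H2; apply NoDup_disjoint_app; auto.
    intros [a b] Hl Hr; destruct (kept_edges_shape _ _ _ _ _ _ Hl) as [q [-> _]].
    assert (Hd : false <> true) by discriminate.
    destruct (kept_edges_outside Hmk s r p0 Hd _ _ Hr) as [Hr' _]; now apply (Hr' q). }
  assert (K2 : forall b l r p, ~ In (mk p, b) (kept_edges s mk l (p ++ [false]) ++ kept_edges s mk r (p ++ [true]))).
  { intros b l r p0 H; rewrite in_app_iff in H; destruct H as [H|H];
      [exact (proj1 (kept_edges_avoid Hmk s l p0 false _ _ H) eq_refl)
      |exact (proj1 (kept_edges_avoid Hmk s r p0 true _ _ H) eq_refl)]. }
  revert p; induction t as [x k|l IHl r IHr|l IHl r IHr]; intros p; simpl.
  - constructor.
  - rewrite names_tens; intros Hn.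
    constructor; [|constructor; [apply K2|apply K; eauto using NoDup_app_remove_l, NoDup_app_remove_r]].
    intros [H|H]; [|now apply K2 in H].
    (* The two edges of a tensor could coincide only if both children were the same leaf, against
       the distinctness of names. *)
    inversion H as [H']. clear H. destruct l as [x k| |].
    + destruct r as [y k'| |]; simpl in H'.
      * inversion H'; subst. inversion Hn as [|? ? N _]; simpl in N; tauto.
      * exact (proj2 Hmk _ _ H').
      * exact (proj2 Hmk _ _ H').
    + assert (Hd : false <> true) by discriminate.
      apply (rootv_outside Hmk r p Hd []); rewrite H', app_nil_r; auto.
    + assert (Hd : false <> true) by discriminate.
      apply (rootv_outside Hmk r p Hd []); rewrite H', app_nil_r; auto.
  - rewrite names_par; intros Hn.
    constructor; [apply K2|apply K; eauto using NoDup_app_remove_l, NoDup_app_remove_r].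
Qed.

Definition forest_names G : list nat := concat (map (@names A) G).

Lemma kept_forest_NoDup s i G : NoDup (forest_names G) -> NoDup (kept_forest s i G).
Proof.
  unfold forest_names; revert i; induction G as [|t G IH]; intros i; simpl; [constructor|].
  intros Hn; apply NoDup_disjoint_app.
  - apply kept_edges_NoDup; [apply proper_VG|eauto using NoDup_app_remove_r].
  - apply IH; eauto using NoDup_app_remove_l.
  - intros [a b] H1 H2.
    destruct (kept_edges_shape _ _ _ _ _ _ H1) as [q [-> _]].
    destruct (kept_forest_shape _ _ _ _ _ H2) as [j [q' [Hj [H _]]]].
    inversion H; lia.
Qed.

Lemma kept_graph_NoDup s P G :
  NoDup (names P) -> NoDup (forest_names G) -> NoDup (kept_graph s P G).
Proof.
  intros H1 H2; apply NoDup_disjoint_app.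
  - now apply kept_edges_NoDup; [apply proper_VP|].
  - now apply kept_forest_NoDup.
  - intros [a b] H3 H4.
    destruct (kept_edges_shape _ _ _ _ _ _ H3) as [q [-> _]].
    destruct (kept_forest_shape _ _ _ _ _ H4) as [j [q' [Hj [H _]]]]; discriminate.
Qed.

(** An edge leads to a leaf or to a strictly longer path, and a leaf is never a parent. *)
Lemma kept_graph_asym s P G a b : In (a, b) (kept_graph s P G) -> ~ In (b, a) (kept_graph s P G).
Proof.
  assert (L : forall (p : list bool) d d', p <> (p ++ [d]) ++ [d']).
  { intros p d d' H; apply (f_equal (@length bool)) in H; rewrite !length_app in H.
    simpl in H; lia. }
  assert (K : forall a b, In (a, b) (kept_graph s P G) ->
    (exists q, a = VP q /\ (leaf_vtx b \/ exists d, b = VP (q ++ [d]))) \/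
    (exists j q, a = VG j q /\ (leaf_vtx b \/ exists d, b = VG j (q ++ [d])))).
  { intros a' b' H; apply in_app_iff in H; destruct H as [H|H].
    - destruct (kept_edges_shape _ _ _ _ _ _ H) as [q [-> Hb]]; left.
      exists q; split; auto; destruct Hb as [[x [-> _]]|[d ->]]; [left; now exists x|right; now exists d].
    - destruct (kept_forest_shape _ _ _ _ _ H) as [j [q [_ H']]]; eauto. }
  intros H1 H2; apply K in H1, H2.
  destruct H1 as [[q [-> Hb]]|[j [q [-> Hb]]]]; destruct Hb as [[x ->]|[d ->]];
    destruct H2 as [[q' [Hq Hb']]|[j' [q' [Hq Hb']]]]; try discriminate;
    inversion Hq; subst; destruct Hb' as [[x Hx]|[d' Hd]]; try discriminate;
    inversion Hd as [Hd']; eapply L; exact Hd'.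
Qed.

Lemma pre_proof_graph_forest_names P G :
  pre_proof_graph P G -> Permutation (names P) (forest_names G).
Proof.
  intros [_ [_ H]]; apply (Permutation_map fst) in H.
  unfold forest_names, names; rewrite concat_map, map_map in H; exact H.
Qed.

Lemma forest_verts_conn s i G u : In u (forest_verts i G) ->
  exists x, In x (forest_names G) /\ conn (kept_forest s i G) u (VL x).
Proof.
  unfold forest_names; revert i; induction G as [|t G IH]; intros i; simpl; [tauto|].
  rewrite in_app_iff; intros [H|H].
  - destruct (tverts_conn s _ _ _ _ H) as [x [H1 H2]]; exists x; rewrite in_app_iff; split; auto.
    revert H2; apply conn_incl, incl_appl, incl_refl.
  - destruct (IH _ H) as [x [H1 H2]]; exists x; rewrite in_app_iff; split; auto.
    revert H2; apply conn_incl, incl_appr, incl_refl.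
Qed.

Lemma gverts_conn s P G u :
  Permutation (names P) (forest_names G) -> In u (gverts P G) ->
  exists v, is_leaf_of P v /\ conn (kept_graph s P G) u v.
Proof.
  intros HP; unfold gverts; rewrite in_app_iff; intros [H|H].
  - destruct (tverts_conn s _ _ _ _ H) as [x [H1 H2]]; exists (VL x); split; [now exists x|].
    revert H2; apply conn_incl; unfold kept_graph; apply incl_appl, incl_refl.
  - destruct (forest_verts_conn s _ _ _ H) as [x [H1 H2]]; exists (VL x); split.
    + exists x; split; auto; now rewrite HP.
    + revert H2; apply conn_incl; unfold kept_graph; apply incl_appr, incl_refl.
Qed.

Lemma leaf_gverts P G v : is_leaf_of P v -> In v (gverts P G).
Proof.
  intros [x [-> H]]; unfold gverts; rewrite in_app_iff; left.
  generalize (@nil bool); induction P as [y k|l IHl r IHr|l IHl r IHr]; intros p; simpl.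
  - destruct H as [<-|[]]; auto.
  - rewrite names_tens, in_app_iff in H; rewrite in_app_iff; destruct H; auto.
  - rewrite names_par, in_app_iff in H; rewrite in_app_iff; destruct H; auto.
Qed.

Lemma is_leaf_vtx P v : is_leaf_of P v -> leaf_vtx v.
Proof. intros [x [-> _]]; now exists x. Qed.

(** Connectivity and acyclicity transfer along [kept_graph_sim]. Simple cycles match [forest]
    because the edge list has neither repetitions nor reversed pairs; internal vertices count
    through the leaves they are connected to. *)
Theorem correct_net P G : NoDup (names P) -> Permutation (names P) (forest_names G) ->
  correct P G <-> net P G.
Proof.
  intros HN HP; split.
  - intros HC v E F HE HF; destruct (net_switching HE HF) as [s [<- <-]].
    destruct (HC s) as [H1 H2].
    apply tree_on_sim with (1 := kept_graph_sim s P G); [apply is_leaf_vtx|].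
    split.
    + apply acyclic_forest with (R := sadj P G s no_removal).
      * intros a b H; rewrite !sadj_adj; unfold adj; auto.
      * apply kept_graph_NoDup; auto. now rewrite <- HP.
      * apply kept_graph_asym.
      * exact H2.
    + intros u w Hu Hw; apply conn_sadj, H1; now apply leaf_gverts.
  - intros HC s.
    assert (H := HC _ _ _ (psw_rep s VP P []) (fsw_leaf_forest s 0 G)).
    apply tree_on_sim with (1 := sim_sym (kept_graph_sim s P G)) in H; [|apply is_leaf_vtx].
    destruct H as [H1 H2]; split.
    + intros u w Hu Hw.
      destruct (gverts_conn s _ _ _ HP Hu) as [u' [Hu1 Hu2]], (gverts_conn s _ _ _ HP Hw) as [w' [Hw1 Hw2]].
      apply conn_sadj; eauto using conn_trans, conn_sym.
    + apply (forest_acyclic (E := kept_graph s P G)); auto.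
      intros a b; apply sadj_adj.
Qed.
End Correct.

(** * Translations of sequent proofs are correct *)

Section Sound.
Variable A : Type.
Implicit Types (t l r P : tree A) (G : list (tree A)) (E B : edges).

Lemma fsw_app_inv G H F : fsw (G ++ H) F ->
  exists F1 F2, F = F1 ++ F2 /\ fsw G F1 /\ fsw H F2.
Proof.
  revert F; induction G as [|t G IH]; simpl; intros F HF.
  - exists [], F; repeat split; auto; constructor.
  - inversion HF as [|? ? v E F' HE HF']; subst.
    destruct (IH _ HF') as [F1 [F2 [-> [H1 H2]]]].
    exists (E ++ F1), F2; rewrite app_assoc; repeat split; auto; econstructor; eauto.
Qed.

Lemma fsw_app G H F1 F2 : fsw G F1 -> fsw H F2 -> fsw (G ++ H) (F1 ++ F2).
Proof.
  induction 1; simpl; auto. intros; rewrite <- app_assoc; econstructor; eauto.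
Qed.

Lemma fsw_perm G G' F : Permutation G G' -> fsw G' F -> exists F', fsw G F' /\ Permutation F F'.
Proof.
  intros HP; revert F; induction HP as [|t G G' HP IH|t t' G|G G' G'' H1 IH1 H2 IH2]; intros F HF.
  - eauto.
  - inversion HF as [|? ? v E F0 HE HF']; subst; destruct (IH _ HF') as [F' [H1 H2]].
    exists (E ++ F'); split; [econstructor; eauto|now apply Permutation_app_head].
  - inversion HF as [|? ? v E F0 HE HF']; subst.
    inversion HF' as [|? ? v' E' F1 HE' HF'']; subst.
    exists (E' ++ E ++ F1); split; [repeat (econstructor; eauto)|perm].
  - destruct (IH2 _ HF) as [F' [H3 H4]], (IH1 _ H3) as [F'' [H5 H6]].
    exists F''; split; auto; etransitivity; eauto.
Qed.

Definition is_name (ns : list nat) (v : vtx) : Prop := exists x, v = VL x /\ In x ns.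

Lemma fsw_within G F : fsw G F -> within (is_name (forest_names G)) F.
Proof.
  unfold forest_names; induction 1 as [|t G v E F HE _ IH]; simpl; [apply within_nil|].
  apply within_app; split.
  - destruct (psw_within HE) as [_ H]; revert H; apply within_impl.
    intros u [x [-> Hx]]; exists x; rewrite in_app_iff; auto.
  - revert IH; apply within_impl; intros u [x [-> Hx]]; exists x; rewrite in_app_iff; auto.
Qed.

Lemma tree_on_perm W E F : Permutation E F -> tree_on W E -> tree_on W F.
Proof.
  intros H; apply tree_on_sim with (O := fun _ => True); auto; now apply sim_perm.
Qed.

(** The common shape of the identity, bottom and tensor rules: one edge between two disjoint
    trees. *)
Lemma tree_on_join (W1 W2 W : vtx -> Prop) E1 E2 a b :
  within W1 E1 -> within W2 E2 -> (forall v, W1 v -> W2 v -> False) ->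
  W1 a -> W2 b -> (forall v, W v -> W1 v \/ W2 v) ->
  tree_on W1 E1 -> tree_on W2 E2 -> tree_on W ((a, b) :: E1 ++ E2).
Proof.
  intros H1 H2 Hd Ha Hb HW [F1 C1] [F2 C2]; split.
  - simpl; split; [|eapply forest_app_disjoint; eauto].
    intros H; destruct (conn_app_disjoint H1 H2 Hd H) as [H'|H'].
    + destruct (conn_within H1 H') as [->|[_ K]]; eauto.
    + destruct (conn_within H2 H') as [->|[K _]]; eauto.
  - assert (D1 : forall u v, W1 u -> W1 v -> conn ((a, b) :: E1 ++ E2) u v).
    { intros u v Hu Hv; eapply conn_incl; [|exact (C1 _ _ Hu Hv)].
      apply incl_tl, incl_appl, incl_refl. }
    assert (D2 : forall u v, W2 u -> W2 v -> conn ((a, b) :: E1 ++ E2) u v).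
    { intros u v Hu Hv; eapply conn_incl; [|exact (C2 _ _ Hu Hv)].
      apply incl_tl, incl_appr, incl_refl. }
    assert (D3 : conn ((a, b) :: E1 ++ E2) a b) by (apply conn_in; simpl; auto).
    intros u v Hu Hv; destruct (HW _ Hu), (HW _ Hv);
      eauto 6 using conn_trans, conn_sym.
Qed.

Lemma forest_names_app G H : forest_names (G ++ H) = forest_names G ++ forest_names H.
Proof. unfold forest_names; now rewrite map_app, concat_app. Qed.

Lemma forest_names_perm G H : Permutation G H -> Permutation (forest_names G) (forest_names H).
Proof.
  intros HP; unfold forest_names; rewrite <- !flat_map_concat_map.
  now apply Permutation_flat_map.
Qed.

Lemma switchings_within P G v E F : Permutation (names P) (forest_names G) ->
  psw P v E -> fsw G F -> is_leaf_of P v /\ within (is_leaf_of P) (E ++ F).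
Proof.
  intros HP HE HF; destruct (psw_within HE) as [H1 H2]; split; auto.
  apply within_app; split; auto.
  eapply within_impl; [|apply (fsw_within HF)].
  intros u [x [-> Hx]]; exists x; split; auto; now rewrite HP.
Qed.

(** A par in the sequent adds no leaf edge, so the par rule keeps the edges of its premise; the
    identity, bottom and tensor rules add the one edge of [tree_on_join]. *)
Theorem translates_net P G : translates P G ->
  NoDup (names P) /\ Permutation (names P) (forest_names G) /\ net P G.
Proof.
  induction 1 as [x y a Hxy|x|P G G' _ [IH1 [IH2 IH3]] HP|x P G _ [IH1 [IH2 IH3]] Hx
    |P F1 F2 G _ [IH1 [IH2 IH3]]|P Q G F1 F2 D _ [IH1 [IH2 IH3]] _ [IH4 [IH5 IH6]] Hd].
  - split; [|split; [apply Permutation_refl|]].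
    + repeat constructor; simpl; intuition.
    + intros v E F HE HF.
      inversion HE as [|? ? u w El Er Hl Hr| |]; subst.
      inversion Hl; inversion Hr; subst.
      inversion HF as [|? ? v1 E1 F' HE1 HF']; subst; inversion HE1; subst.
      inversion HF' as [|? ? v2 E2 F'' HE2 HF'']; subst; inversion HE2; inversion HF''; subst.
      apply tree_on_join with (W1 := is_name [x]) (W2 := is_name [y])
        (E1 := []) (E2 := []).
      * apply within_nil.
      * apply within_nil.
      * intros v [z [-> Hz]] [z' [Hz' Hz'']]; simpl in *; inversion Hz'; subst; intuition congruence.
      * exists x; simpl; auto.
      * exists y; simpl; auto.
      * intros v [z [-> [Hz|[Hz|[]]]]]; subst; [left|right]; eexists; simpl; eauto.
      * split; [exact I|]. intros v w [z [-> [Hz|[]]]] [z' [-> [Hz'|[]]]]; subst; apply conn_refl.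
      * split; [exact I|]. intros v w [z [-> [Hz|[]]]] [z' [-> [Hz'|[]]]]; subst; apply conn_refl.
  - split; [|split; [apply Permutation_refl|]].
    + repeat constructor; simpl; intuition.
    + intros v E F HE HF.
      inversion HE; subst.
      inversion HF as [|? ? v1 E1 F' HE1 HF']; subst; inversion HE1; inversion HF'; subst.
      split; [exact I|]. intros v w [z [-> [Hz|[]]]] [z' [-> [Hz'|[]]]]; simpl in *; subst; apply conn_refl.
  - split; [auto|split].
    + rewrite IH2; now apply forest_names_perm.
    + intros v E F HE HF; destruct (fsw_perm HP HF) as [F' [H1 H2]].
      apply tree_on_perm with (E ++ F'); [now apply Permutation_app_head; symmetry|eauto].
  - rewrite names_tens; split; [|split].
    + constructor; auto.
    + simpl; now apply Permutation_cons.
    + intros v E F HE HF.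
      inversion HE as [|? ? u w El Er Hl Hr| |]; subst; inversion Hl; subst.
      inversion HF as [|? ? v1 E1 F' HE1 HF']; subst; inversion HE1; subst; simpl.
      destruct (switchings_within IH2 Hr HF') as [K1 K2].
      apply tree_on_join with (W1 := is_name [x]) (W2 := is_leaf_of P) (E1 := []); auto.
      * apply within_nil.
      * intros v [z [-> [Hz|[]]]] [z' [Hz' Hz'']]; subst; inversion Hz'; subst; auto.
      * exists x; simpl; auto.
      * intros v [z [-> Hz]]; rewrite names_tens in Hz; destruct Hz as [Hz|Hz];
          [left|right]; exists z; simpl in *; auto.
      * split; [exact I|]. intros v w' [z [-> [Hz|[]]]] [z' [-> [Hz'|[]]]]; subst; apply conn_refl.
      * eapply IH3; eauto.
  - split; [auto|split].
    + rewrite IH2; unfold forest_names; simpl; now rewrite names_par, app_assoc.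
    + intros v E F HE HF.
      inversion HF as [|? ? v1 E1 F' HE1 HF']; subst.
      inversion HE1 as [| |? ? u w El Er Hl Hr|? ? u w El Er Hl Hr]; subst;
        rewrite <- app_assoc; eapply IH3; eauto; repeat (econstructor; eauto).
  - assert (PN : Permutation (names (Par P Q)) (forest_names (G ++ Tens F1 F2 :: D))).
    { rewrite names_par, IH2, IH5, !forest_names_app; unfold forest_names; simpl.
      rewrite names_tens, app_nil_r; perm. }
    split; [|split]; auto.
    + rewrite names_par; now apply NoDup_disjoint_app.
    + intros v E F HE HF.
      destruct (fsw_app_inv _ _ HF) as [FG [F' [-> [HG HF']]]].
      inversion HF' as [|? ? v1 E1 FD HE1 HD]; subst.
      inversion HE1 as [|? ? f1 f2 El Er Hl Hr| |]; subst.
      (* Whichever side [Par P Q] keeps, it adds no edge; the only edge between the two premises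
         comes from the new tensor. *)
      assert (K : forall u w EP EQ, psw P u EP -> psw Q w EQ ->
        tree_on (is_leaf_of (Par P Q)) ((EP ++ EQ) ++ FG ++ ((v1, f2) :: El ++ Er) ++ FD)).
      { intros u w EP EQ HEP HEQ.
        assert (H1 : fsw (G ++ [F1]) (FG ++ El ++ []))
          by (apply fsw_app; auto; econstructor; eauto; constructor).
        assert (H2 : fsw (F2 :: D) (Er ++ FD)) by (econstructor; eauto).
        destruct (switchings_within IH2 HEP H1) as [K1 K2].
        destruct (switchings_within IH5 HEQ H2) as [K3 K4].
        apply tree_on_perm with ((v1, f2) :: (EP ++ FG ++ El ++ []) ++ (EQ ++ Er ++ FD)); [perm|].
        apply tree_on_join with (is_leaf_of P) (is_leaf_of Q); auto.
        - intros x [n [-> Hn]] [m [Hm Hm']]; inversion Hm; subst; eauto.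
        - destruct (psw_within Hl) as [[n [-> Hn]] _]; exists n; split; auto.
          rewrite IH2, forest_names_app; apply in_or_app; right; unfold forest_names; simpl.
          now rewrite app_nil_r.
        - destruct (psw_within Hr) as [[n [-> Hn]] _]; exists n; split; auto.
          rewrite IH5; unfold forest_names; simpl; apply in_or_app; auto.
        - intros x [n [-> Hn]]; rewrite names_par, in_app_iff in Hn; destruct Hn;
            [left|right]; exists n; auto.
        - eapply IH3; eauto.
        - eapply IH6; eauto. }
      inversion HE; subst; eapply K; eauto.
Qed.
End Sound.

(** * Extruding bottoms from pars *)

Section Extrude.
Variable A : Type.
Implicit Types (t l r P Q R X Y : tree A) (G : list (tree A)) (E B : edges).

Inductive ctx : Type :=
| Hole
| CTl (C : ctx) (r : tree A)
| CTr (l : tree A) (C : ctx)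
| CPl (C : ctx) (r : tree A)
| CPr (l : tree A) (C : ctx).

Fixpoint fill (C : ctx) X : tree A :=
  match C with
  | Hole => X
  | CTl C r => Tens (fill C X) r
  | CTr l C => Tens l (fill C X)
  | CPl C r => Par (fill C X) r
  | CPr l C => Par l (fill C X)
  end.

Fixpoint hole_path (C : ctx) : list bool :=
  match C with
  | Hole => []
  | CTl C _ | CPl C _ => false :: hole_path C
  | CTr _ C | CPr _ C => true :: hole_path C
  end.

Fixpoint comp (C D : ctx) : ctx :=
  match C with
  | Hole => D
  | CTl C r => CTl (comp C D) r
  | CTr l C => CTr l (comp C D)
  | CPl C r => CPl (comp C D) r
  | CPr l C => CPr l (comp C D)
  end.

Lemma fill_comp C D X : fill (comp C D) X = fill C (fill D X).
Proof. induction C; simpl; congruence. Qed.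

Lemma subtree_fill C X : subtree (fill C X) (hole_path C) = Some X.
Proof. induction C; simpl; auto. destruct X; auto. Qed.

Lemma replace_fill C X Y : replace (fill C X) (hole_path C) Y = fill C Y.
Proof. induction C; simpl; try congruence. destruct X; auto. Qed.

Lemma leaves_fill C X Y :
  Permutation (leaves X) (leaves Y) -> Permutation (leaves (fill C X)) (leaves (fill C Y)).
Proof.
  intros H; induction C; simpl; auto using Permutation_app_head, Permutation_app_tail.
Qed.

Lemma names_perm X Y : Permutation (leaves X) (leaves Y) -> Permutation (names X) (names Y).
Proof. apply Permutation_map. Qed.

(** All that a context can attach to [X] or [Y] is an edge [c] from above and further edges [B].
    There are two predicates because one induction on contexts serves both the preservation of
    correctness and the side condition of [st_bot]. *)
Definition refines (Phi Psi : edges -> Prop) X Y : Prop := forall (c : option vtx) B,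
  (forall v E, psw X v E -> Phi (link c v ++ B ++ E)) ->
  (forall v E, psw Y v E -> Psi (link c v ++ B ++ E)).

Definition invariant (Phi : edges -> Prop) : Prop :=
  forall E F, sim (@all vtx) E F -> Phi E -> Phi F.

Lemma refines_fill Phi Psi C X Y : invariant Phi -> invariant Psi ->
  refines Phi Psi X Y -> refines Phi Psi (fill C X) (fill C Y).
Proof.
  intros I1 I2 H.
  assert (P1 : forall E F, Permutation E F -> Phi E -> Phi F)
    by (intros E F HP; apply I1; now apply sim_perm).
  assert (P2 : forall E F, Permutation E F -> Psi E -> Psi F)
    by (intros E F HP; apply I2; now apply sim_perm).
  (* At the left of a tensor, the root [v] of the hole carries the edge from above and the tensor
     edge. The latter is slid to [k], leaving the link as the only edge from the context to [v]. *)
  assert (S : forall k v w E, sim (@all vtx) ((k, v) :: (k, w) :: E) ((k, v) :: (v, w) :: E)).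
  { intros k v w E; eapply sim_trans; [apply sim_perm, perm_swap|].
    eapply sim_trans; [apply sim_slide with (a' := v), conn_in; simpl; auto|].
    apply sim_perm, perm_swap. }
  induction C as [|C IH r|l C IH|C IH r|l C IH]; simpl; auto; intros c B HX v E HY.
  - inversion HY as [|? ? v1 w E1 Er H1 H2| |]; subst.
    destruct c as [k|]; simpl.
    + apply (P2 ((k, v) :: (v, w) :: B ++ E1 ++ Er)); [perm|].
      apply (I2 _ _ (S k v w _)).
      apply (P2 (link (Some k) v ++ ((k, w) :: B ++ Er) ++ E1)); [simpl; perm|].
      apply (IH (Some k)); auto; intros u E0 H0.
      apply (P1 ((k, u) :: (k, w) :: B ++ E0 ++ Er)); [simpl; perm|].
      apply (I1 _ _ (sim_sym (S k u w _))).
      apply (P1 (link (Some k) u ++ B ++ (u, w) :: E0 ++ Er)); [simpl; perm|].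
      apply HX; now constructor.
    + apply (P2 ((v, w) :: B ++ E1 ++ Er)); [perm|].
      apply (I2 _ _ (sim_flip _ w v _)).
      apply (P2 (link (Some w) v ++ (B ++ Er) ++ E1)); [simpl; perm|].
      apply (IH (Some w)); auto; intros u E0 H0; simpl.
      apply (I1 _ _ (sim_flip _ u w _)).
      apply (P1 (link None u ++ B ++ (u, w) :: E0 ++ Er)); [simpl; perm|].
      apply HX; now constructor.
  - inversion HY as [|? ? v1 w E1 Er H1 H2| |]; subst.
    apply (P2 (link (Some v) w ++ (link c v ++ B ++ E1) ++ Er)); [simpl; perm|].
    apply (IH (Some v)); auto; intros u E0 H0.
    apply (P1 (link c v ++ B ++ (v, u) :: E1 ++ E0)); [simpl; perm|].
    apply HX; now constructor.
  - inversion HY as [| |? ? v1 w E1 Er H1 H2|? ? w v1 E1 Er H1 H2]; subst.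
    + apply (P2 (link c v ++ (B ++ Er) ++ E1)); [perm|].
      apply (IH c); auto; intros u E0 H0.
      apply (P1 (link c u ++ B ++ E0 ++ Er)); [perm|].
      apply HX; eapply psw_parl; eauto.
    + apply (P2 (link None w ++ (link c v ++ B ++ Er) ++ E1)); [simpl; perm|].
      apply (IH None); auto; intros u E0 H0; simpl.
      apply (P1 (link c v ++ B ++ E0 ++ Er)); [perm|].
      apply HX; eapply psw_parr; eauto.
  - inversion HY as [| |? ? v1 w E1 Er H1 H2|? ? w v1 E1 Er H1 H2]; subst.
    + apply (P2 (link None w ++ (link c v ++ B ++ E1) ++ Er)); [simpl; perm|].
      apply (IH None); auto; intros u E0 H0; simpl.
      apply (P1 (link c v ++ B ++ E1 ++ E0)); [perm|].
      apply HX; eapply psw_parl; eauto.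
    + apply (P2 (link c v ++ (B ++ E1) ++ Er)); [perm|].
      apply (IH c); auto; intros u E0 H0.
      apply (P1 (link c u ++ B ++ E1 ++ E0)); [perm|].
      apply HX; eapply psw_parr; eauto.
Qed.

Lemma tree_on_invariant W : invariant (tree_on W).
Proof. intros E F H; apply tree_on_sim with (1 := H); now intros. Qed.

Lemma is_leaf_of_perm X Y v :
  Permutation (leaves X) (leaves Y) -> is_leaf_of X v -> is_leaf_of Y v.
Proof.
  intros H [x [-> Hx]]; exists x; split; auto; now rewrite <- (names_perm _ _ H).
Qed.

Lemma net_refines C X Y G : Permutation (leaves X) (leaves Y) ->
  refines (tree_on (is_leaf_of (fill C X))) (tree_on (is_leaf_of (fill C X))) X Y ->
  net (fill C X) G -> net (fill C Y) G.
Proof.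
  intros HP H HX v E F HE HF.
  assert (HI := tree_on_invariant (W := is_leaf_of (fill C X))).
  assert (K : tree_on (is_leaf_of (fill C X)) (link None v ++ F ++ E)).
  { apply (refines_fill C HI HI H None); auto; intros u E0 H0.
    apply tree_on_perm with (E0 ++ F); [simpl; perm|eauto]. }
  apply tree_on_perm with (F := E ++ F) in K; [|simpl; perm].
  destruct K as [K1 K2]; split; auto; intros u w Hu Hw.
  assert (HP' := Permutation_sym (leaves_fill C _ _ HP)).
  apply K2; eapply is_leaf_of_perm; eauto.
Qed.

(** Only the representative of the root changes, between two vertices joined by the tensor edge, so
    the edge above slides. *)
Lemma refines_tensC W X Y : refines (tree_on W) (tree_on W) (Tens X Y) (Tens Y X).
Proof.
  intros c B H v E HE; inversion HE as [|? ? y x Ey Ex Hy Hx| |]; subst.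
  assert (K := H _ _ (psw_tens Hx Hy)); clear H.
  destruct c as [k|]; simpl in *.
  - apply tree_on_perm with ((k, v) :: (v, x) :: B ++ Ey ++ Ex); [perm|].
    apply tree_on_sim with (W := W) (O := @all vtx)
      (E := (k, x) :: (x, v) :: B ++ Ey ++ Ex); [|now intros|].
    + eapply sim_trans; [apply sim_slide_r with (b' := v), conn_in; simpl; auto|].
      apply sim_cons; [apply sim_flip| |]; exact I.
    + revert K; apply tree_on_perm; perm.
  - apply tree_on_perm with ((v, x) :: B ++ Ey ++ Ex); [perm|].
    apply tree_on_sim with (W := W) (O := @all vtx)
      (E := (x, v) :: B ++ Ey ++ Ex); [apply sim_flip|now intros|].
    revert K; apply tree_on_perm; perm.
Qed.

(* Both choices at the par above [Q] and [R] give a tree once [z] (and [c]) is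
   attached; comparing them, the roots of [Q] and [R] are already connected. *)
Lemma par_roots_conn W c (q r z : vtx) H : W q -> W r ->
  tree_on W (link c q ++ (q, z) :: H) -> tree_on W (link c r ++ (r, z) :: H) ->
  conn H q r /\ ~ conn (link c r ++ H) r z.
Proof.
  intros Wq Wr [_ C1] [F2 _]; specialize (C1 q r Wq Wr).
  destruct c as [k|]; cbn [link app] in *.
  - assert (F3 : forest ((r, z) :: (k, r) :: H)) by (eapply forest_perm; [apply perm_swap|exact F2]).
    destruct F3 as [F3 _]; split; auto.
    destruct F2 as [N1 [N2 _]]; rewrite !conn_cons in N1, C1.
    assert (N3 : ~ conn H k r) by tauto.
    assert (N4 : ~ conn H z r) by auto using conn_sym.
    rewrite !(@conn_cons _ q z) in C1; tauto.
  - destruct F2 as [N2 _]; split; auto; rewrite conn_cons in C1.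
    assert (N4 : ~ conn H z r) by auto using conn_sym.
    tauto.
Qed.

(** At each par above the leaf, the side containing the leaf is kept. *)
Lemma psw_root t x : is_leaf_of t x -> exists v E, psw t v E /\ conn E v x.
Proof.
  assert (Ex : forall t, exists v E, psw t v E).
  { intros t0; eexists _, _; apply (psw_rep (fun _ => false) VP t0 []). }
  induction t as [y k|l IHl r IHr|l IHl r IHr]; intros [n [-> Hn]].
  - destruct Hn as [Hn|[]]; simpl in Hn; subst; exists (VL n), []; split; [constructor|apply conn_refl].
  - rewrite names_tens, in_app_iff in Hn; destruct (Ex l) as [u [El Hl]], (Ex r) as [w [Er Hr]].
    destruct Hn as [Hn|Hn].
    + destruct IHl as [v [E [H1 H2]]]; [now exists n|].
      exists v, ((v, w) :: E ++ Er); split; [now constructor|].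
      revert H2; apply conn_incl, incl_tl, incl_appl, incl_refl.
    + destruct IHr as [v [E [H1 H2]]]; [now exists n|].
      exists u, ((u, v) :: El ++ E); split; [now constructor|].
      apply conn_trans with v; [apply conn_in; simpl; auto|].
      revert H2; apply conn_incl, incl_tl, incl_appr, incl_refl.
  - rewrite names_par, in_app_iff in Hn; destruct (Ex l) as [u [El Hl]], (Ex r) as [w [Er Hr]].
    destruct Hn as [Hn|Hn].
    + destruct IHl as [v [E [H1 H2]]]; [now exists n|].
      exists v, (E ++ Er); split; [eapply psw_parl; eauto|].
      revert H2; apply conn_incl, incl_appl, incl_refl.
    + destruct IHr as [v [E [H1 H2]]]; [now exists n|].
      exists v, (El ++ E); split; [eapply psw_parr; eauto|].
      revert H2; apply conn_incl, incl_appr, incl_refl.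
Qed.

(** The path is cut at its first and last use of [E]; the outer pieces run in [F]. Keeping both
    pieces makes the induction pass through symmetry and concatenation. *)
Lemma conn_app_last (O : vtx -> Prop) E F u v : within O E -> conn (E ++ F) u v ->
  conn F u v \/ ((exists x, O x /\ conn F u x) /\ exists x, O x /\ conn F x v).
Proof.
  intros HO; induction 1 as [x y Hi| x | x y _ IH | x y z _ IH1 _ IH2].
  - apply in_app_iff in Hi; destruct Hi as [Hi|Hi].
    + destruct (HO _ _ Hi); right; split; eauto using conn_refl.
    + left; now apply conn_in.
  - left; apply conn_refl.
  - destruct IH as [IH|[[a [H1 H2]] [b [H3 H4]]]]; [left|right; split]; eauto using conn_sym.
  - destruct IH1 as [IH1|[[a [H1 H2]] [b [H3 H4]]]],
      IH2 as [IH2|[[a' [H1' H2']] [b' [H3' H4']]]].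
    + left; eauto using conn_trans.
    + right; split; eauto using conn_trans.
    + right; split; eauto using conn_trans.
    + right; split; eauto.
Qed.

Section Bot.
Variables (Q R : tree A) (i : nat) (k : kind A) (W : vtx -> Prop).
Hypothesis HW : forall v, is_leaf_of Q v \/ is_leaf_of R v -> W v.

Lemma extrude_roots c B :
  (forall v E, psw (Tens (Par Q R) (Leaf i k)) v E -> tree_on W (link c v ++ B ++ E)) ->
  forall q EQ (r : vtx) ER, psw Q q EQ -> psw R r ER ->
    tree_on W (link c q ++ (q, VL i) :: B ++ EQ ++ ER) /\
    tree_on W (link c r ++ (r, VL i) :: B ++ EQ ++ ER) /\
    conn (B ++ EQ ++ ER) q r /\ ~ conn (link c r ++ B ++ EQ ++ ER) r (VL i).
Proof.
  intros H q EQ r ER HQ HR.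
  assert (T1 : tree_on W (link c q ++ (q, VL i) :: B ++ EQ ++ ER)).
  { apply tree_on_perm with (link c q ++ B ++ (q, VL i) :: (EQ ++ ER) ++ []); [perm|].
    apply H; constructor; [eapply psw_parl; eauto|constructor]. }
  assert (T2 : tree_on W (link c r ++ (r, VL i) :: B ++ EQ ++ ER)).
  { apply tree_on_perm with (link c r ++ B ++ (r, VL i) :: (EQ ++ ER) ++ []); [perm|].
    apply H; constructor; [eapply psw_parr; eauto|constructor]. }
  split; [auto|split; [auto|]].
  apply par_roots_conn with (W := W); auto; apply HW;
    [left; exact (proj1 (psw_within HQ))|right; exact (proj1 (psw_within HR))].
Qed.

(** The graphs differ only when the par keeps [Q]: the edge to [i] moves from the root of [Q] to
    that of [R], and these roots are connected by the remaining edges. *)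
Lemma refines_extrude : refines (tree_on W) (tree_on W)
  (Tens (Par Q R) (Leaf i k)) (Par Q (Tens R (Leaf i k))).
Proof.
  intros c B H; assert (K := extrude_roots _ _ H); intros v E HE.
  assert (K' : forall q EQ (r : vtx) ER, psw Q q EQ -> psw R r ER -> v = q \/ v = r ->
    tree_on W (link c v ++ B ++ EQ ++ (r, VL i) :: ER ++ [])).
  { intros q EQ r ER HQ HR Hv; destruct (K _ _ _ _ HQ HR) as [T1 [T2 [C _]]].
    destruct Hv; subst v.
    - apply tree_on_perm with ((r, VL i) :: link c q ++ B ++ EQ ++ ER); [perm|].
      apply tree_on_sim with (W := W) (O := @all vtx) (E := (q, VL i) :: link c q ++ B ++ EQ ++ ER);
        [|now intros|revert T1; apply tree_on_perm; perm].
      apply sim_slide; revert C; apply conn_incl, incl_appr, incl_refl.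
    - revert T2; apply tree_on_perm; perm. }
  inversion HE as [| |? ? v1 w EQ E2 HQ H2|? ? w v1 EQ E2 HQ H2]; subst;
    inversion H2 as [|? ? r z ER Ei HR Hi| |]; subst; inversion Hi; subst; eapply K'; eauto.
Qed.

(** A path from [Q] to [i] without the edge of [i] leaves [Q] for the last time at a leaf [x']. The
    switching of [Q] is changed so that its root reaches [x']. The root of [R] is connected to that
    root, so it would reach [i] without its edge to [i], against acyclicity. *)
Lemma refines_side x : is_leaf_of Q x ->
  refines (tree_on W) (fun E => ~ conn E x (VL i)) (Tens (Par Q R) (Leaf i k)) (Par Q R).
Proof.
  intros Hx c B H; assert (K := extrude_roots _ _ H); intros v E HE.
  assert (K' : forall q EQ (r : vtx) ER, psw Q q EQ -> psw R r ER ->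
    ~ conn (link c r ++ B ++ EQ ++ ER) x (VL i)).
  { intros q EQ r ER HQ HR Hc.
    destruct (psw_within HQ) as [Hq WQ].
    assert (Hc' : conn (EQ ++ link c r ++ B ++ ER) x (VL i))
      by (revert Hc; apply conn_perm; perm).
    assert (Hx' : exists x', is_leaf_of Q x' /\ conn (link c r ++ B ++ ER) x' (VL i)).
    { destruct (conn_app_last _ WQ Hc') as [?|[_ ?]]; eauto. }
    destruct Hx' as [x' [Qx' Cx']].
    destruct (psw_root Qx') as [q' [EQ' [HQ' Cq']]].
    destruct (K _ _ _ _ HQ' HR) as [_ [_ [C N]]]; apply N.
    apply conn_trans with q'.
    - apply conn_sym; revert C; apply conn_incl, incl_appr, incl_refl.
    - apply conn_trans with x'.
      + revert Cq'; apply conn_incl; intros e; rewrite !in_app_iff; auto.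
      + revert Cx'; apply conn_incl; intros e; rewrite !in_app_iff; tauto. }
  inversion HE as [| |? ? v1 r EQ ER HQ HR|? ? q v1 EQ ER HQ HR]; subst.
  (* When the par keeps [Q], the edge above slides from the root of [Q] to the root of [R]. *)
  - intros Hc; apply (K' _ _ _ _ HQ HR); destruct (K _ _ _ _ HQ HR) as [_ [_ [C _]]].
    destruct c as [k'|]; simpl in *; auto.
    apply (proj2 (@sim_slide_r _ (@all vtx) k' v r _ C)); auto; exact I.
  - eauto.
Qed.
End Bot.
End Extrude.

(** * Linkings as pars of stars *)

Section Normal.
Variable A : Type.
Implicit Types (t l r P Q R X Y : tree A) (G : list (tree A)) (E B : edges) (C : ctx A).

Lemma equiv_local G C X Y : local_rule X Y -> Defs.equiv G (fill C X) (fill C Y).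
Proof.
  intros H; apply rst_step. rewrite <- (replace_fill C X Y).
  eapply st_local; eauto using subtree_fill.
Qed.

Lemma net_tensC C X Y G : net (fill C (Tens X Y)) G -> net (fill C (Tens Y X)) G.
Proof.
  apply net_refines; [apply Permutation_app_comm|apply refines_tensC].
Qed.

Lemma is_leaf_of_fill C X v : is_leaf_of X v -> is_leaf_of (fill C X) v.
Proof.
  intros [x [-> H]]; exists x; split; auto.
  induction C; simpl; auto; rewrite ?names_tens, ?names_par, in_app_iff; auto.
Qed.

Lemma is_leaf_of_par Q R v : is_leaf_of (Par Q R) v <-> is_leaf_of Q v \/ is_leaf_of R v.
Proof.
  unfold is_leaf_of; rewrite names_par; split.
  - intros [x [-> H]]; rewrite in_app_iff in H; destruct H; eauto.
  - intros [[x [-> H]]|[x [-> H]]]; exists x; rewrite in_app_iff; auto.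
Qed.

Lemma tedges_fill_incl mk C X p :
  incl (tedges mk X (p ++ hole_path C)) (tedges mk (fill C X) p).
Proof.
  revert p; induction C; simpl; intros p e H.
  - now rewrite app_nil_r in H.
  - right; right; apply in_app_iff; left; apply IHC; now rewrite <- app_assoc.
  - right; right; apply in_app_iff; right; apply IHC; now rewrite <- app_assoc.
  - right; right; apply in_app_iff; left; apply IHC; now rewrite <- app_assoc.
  - right; right; apply in_app_iff; right; apply IHC; now rewrite <- app_assoc.
Qed.

Lemma rootv_fill mk C X Y p :
  rootv mk X (p ++ hole_path C) = rootv mk Y (p ++ hole_path C) ->
  rootv mk (fill C X) p = rootv mk (fill C Y) p.
Proof. destruct C; simpl; auto. now rewrite app_nil_r. Qed.

(** Equality of the [rootv] fixes the edge entering the hole, so the trees differ only inside it. *)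
Lemma tedges_fill_inv mk C X Y p e :
  rootv mk X (p ++ hole_path C) = rootv mk Y (p ++ hole_path C) ->
  In e (tedges mk (fill C X) p) ->
  In e (tedges mk (fill C Y) p) \/ In e (tedges mk X (p ++ hole_path C)).
Proof.
  revert p; induction C as [|C IH r|l C IH|C IH r|l C IH]; simpl; intros p HR.
  - rewrite app_nil_r; auto.
  - assert (HR' : forall d, rootv mk X ((p ++ [d]) ++ hole_path C) = rootv mk Y ((p ++ [d]) ++ hole_path C) ->
      rootv mk (fill C X) (p ++ [d]) = rootv mk (fill C Y) (p ++ [d])) by (intros; now apply rootv_fill).
    specialize (IH (p ++ [false])); specialize (HR' false); rewrite <- !app_assoc in IH, HR'; simpl in IH, HR'.
    rewrite HR' by auto; rewrite !in_app_iff; intuition.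
  - assert (HR' : forall d, rootv mk X ((p ++ [d]) ++ hole_path C) = rootv mk Y ((p ++ [d]) ++ hole_path C) ->
      rootv mk (fill C X) (p ++ [d]) = rootv mk (fill C Y) (p ++ [d])) by (intros; now apply rootv_fill).
    specialize (IH (p ++ [true])); specialize (HR' true); rewrite <- !app_assoc in IH, HR'; simpl in IH, HR'.
    rewrite HR' by auto; rewrite !in_app_iff; intuition.
  - assert (HR' : forall d, rootv mk X ((p ++ [d]) ++ hole_path C) = rootv mk Y ((p ++ [d]) ++ hole_path C) ->
      rootv mk (fill C X) (p ++ [d]) = rootv mk (fill C Y) (p ++ [d])) by (intros; now apply rootv_fill).
    specialize (IH (p ++ [false])); specialize (HR' false); rewrite <- !app_assoc in IH, HR'; simpl in IH, HR'.
    rewrite HR' by auto; rewrite !in_app_iff; intuition.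
  - assert (HR' : forall d, rootv mk X ((p ++ [d]) ++ hole_path C) = rootv mk Y ((p ++ [d]) ++ hole_path C) ->
      rootv mk (fill C X) (p ++ [d]) = rootv mk (fill C Y) (p ++ [d])) by (intros; now apply rootv_fill).
    specialize (IH (p ++ [true])); specialize (HR' true); rewrite <- !app_assoc in IH, HR'; simpl in IH, HR'.
    rewrite HR' by auto; rewrite !in_app_iff; intuition.
Qed.

(** A context attaches edges only to the root representative, which is the same for [X] and [Y], so
    the extra edge passes through unchanged. *)
Lemma psw_fill_extra C X Y z :
  (forall v E, psw X v E -> exists a E', psw Y v E' /\ Permutation E ((a, z) :: E')) ->
  forall v E, psw (fill C X) v E -> exists a E', psw (fill C Y) v E' /\ Permutation E ((a, z) :: E').
Proof.
  intros H; induction C as [|C IH r|l C IH|C IH r|l C IH]; simpl; auto; intros v E HE.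
  - inversion HE as [|? ? v1 w E1 Er H1 H2| |]; subst; destruct (IH _ _ H1) as [a [E' [K1 K2]]].
    exists a, ((v, w) :: E' ++ Er); split; [now constructor|rewrite K2; perm].
  - inversion HE as [|? ? v1 w E1 Er H1 H2| |]; subst; destruct (IH _ _ H2) as [a [E' [K1 K2]]].
    exists a, ((v, w) :: E1 ++ E'); split; [now constructor|rewrite K2; perm].
  - inversion HE as [| |? ? v1 w E1 Er H1 H2|? ? v1 w E1 Er H1 H2]; subst;
      destruct (IH _ _ H1) as [a [E' [K1 K2]]]; exists a, (E' ++ Er);
      (split; [|rewrite K2; perm]); [eapply psw_parl|eapply psw_parr]; eauto.
  - inversion HE as [| |? ? v1 w E1 Er H1 H2|? ? v1 w E1 Er H1 H2]; subst;
      destruct (IH _ _ H2) as [a [E' [K1 K2]]]; exists a, (E1 ++ E');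
      (split; [|rewrite K2; perm]); [eapply psw_parl|eapply psw_parr]; eauto.
Qed.

Lemma psw_par_extra Q R j k v E : psw (Par Q (Tens R (Leaf j k))) v E ->
  exists a E', psw (Par Q R) v E' /\ Permutation E ((a, VL j) :: E').
Proof.
  intros HE; inversion HE as [| |? ? v1 w EQ E2 HQ H2|? ? w v1 EQ E2 HQ H2]; subst;
    inversion H2 as [|? ? r z ER Ei HR Hi| |]; subst; inversion Hi; subst.
  - exists w, (EQ ++ ER); split; [eapply psw_parl; eauto|perm].
  - exists v, (EQ ++ ER); split; [eapply psw_parr; eauto|perm].
Qed.

Lemma fresh (ns : list nat) : exists j, ~ In j ns.
Proof.
  exists (S (list_max ns)); intros H.
  assert (K : list_max ns <= list_max ns) by lia.
  apply list_max_le in K; rewrite Forall_forall in K; apply K in H; lia.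
Qed.

Definition ok P G : Prop := net P G /\ Permutation (names P) (forest_names G).

(* The edge above [i] is simulated by a pendant edge to a fresh leaf [j]. *)
Lemma extrude_side C Q R i k G (s : switching) u :
  ok (fill C (Tens (Par Q R) (Leaf i k))) G ->
  In u (tverts VP Q (hole_path C ++ [false])) ->
  ~ clos_refl_trans vtx
      (sadj (fill C (Par Q (Tens R (Leaf i k)))) G s
        (fun e => match e with (a, _, _, b) =>
           a = VP (hole_path C ++ [true]) /\ b = VL i end)) u (VL i).
Proof.
  set (P := fill C (Tens (Par Q R) (Leaf i k))); intros [HN HP] Hu Hc.
  destruct (fresh (i :: names P)) as [j Hj].
  set (Pj := fill C (Par Q (Tens R (Leaf j k)))).
  (* The removed edge is the only one absent from the tree with [j], so every step of the path
     survives. *)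
  assert (S1 : conn (kept_graph s Pj G) u (VL i)).
  { clear Hu; revert Hc; generalize (VL i) at 2 3 as w; intros w; induction 1 as [x y H| |];
      eauto using conn_refl, conn_trans.
    destruct H as [[[[a ip] sd] b] [H1 [H2 [H3 H4]]]].
    assert (H5 : In (a, ip, sd, b) (gedges Pj G)).
    { unfold gedges in *; rewrite in_app_iff in *; destruct H1 as [H1|H1]; auto; left.
      apply (tedges_fill_inv VP C _ (Par Q (Tens R (Leaf j k))) []) in H1; auto.
      destruct H1 as [H1|H1]; auto.
      apply (tedges_fill_incl VP C (Par Q (Tens R (Leaf j k))) []); simpl in H1 |- *.
      rewrite in_app_iff in *; simpl in *.
      destruct H1 as [H1|[H1|[H1|[H1|[H1|H1]]]]]; auto 8.
      exfalso; apply H3; inversion H1; auto. }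
    assert (H6 : In (a, b) (kept_graph s Pj G)) by (apply gedges_kept; eauto).
    destruct H4 as [[-> ->]|[-> ->]]; auto using conn_in, conn_sym. }
  (* The path is restarted at a leaf of [Q], as internal vertices disappear in the reduction to
     leaves. *)
  assert (S2 : exists x, In x (names Q) /\ conn (kept_graph s Pj G) u (VL x)).
  { destruct (tverts_conn s _ _ _ _ Hu) as [x [X1 X2]]; exists x; split; auto.
    revert X2; apply conn_incl; intros [a b] H; apply tedges_kept in H.
    destruct H as [ip [sd [H1 H2]]]; apply gedges_kept; exists ip, sd; split; auto.
    unfold gedges; apply in_app_iff; left.
    apply (tedges_fill_incl VP C (Par Q (Tens R (Leaf j k))) []).
    simpl; right; right; apply in_app_iff; auto. }
  destruct S2 as [x [Hx S2]].
  assert (Qx : is_leaf_of Q (VL x)) by (now exists x).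
  assert (S3 : conn (leaf_edges s VP Pj [] ++ leaf_forest s 0 G) (VL x) (VL i)).
  { apply (proj2 (kept_graph_sim s Pj G)); [now exists x|now exists i|].
    eauto using conn_trans, conn_sym. }
  assert (HF := fsw_leaf_forest s 0 G).
  destruct (psw_fill_extra C (@psw_par_extra Q R j k) (psw_rep s VP Pj []))
    as [a [E' [H1 H2]]].
  assert (HL : forall v, is_leaf_of (Par Q R) v -> is_leaf_of P v).
  { intros v [y [-> Hy]]; apply is_leaf_of_fill; exists y; split; auto.
    rewrite names_tens, in_app_iff; auto. }
  assert (Hxj : VL x <> VL j).
  { intros [= ->]; apply Hj; right.
    destruct (HL (VL j)) as [y [[= <-] Hy]]; auto; apply is_leaf_of_par; auto. }
  assert (Hij : VL i <> VL j) by (intros [= ->]; apply Hj; simpl; auto).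
  assert (HPQ : forall v, is_leaf_of (fill C (Par Q R)) v -> is_leaf_of P v).
  { clear - HL; intros v [y [-> Hy]]; exists y; split; auto; revert Hy; unfold P.
    assert (incl (names (Par Q R)) (names (Tens (Par Q R) (Leaf i k)))).
    { rewrite (names_tens (Par Q R)); apply incl_appl, incl_refl. }
    clear HL; revert y; induction C; simpl; auto; intros y;
      rewrite ?names_tens, ?names_par, !in_app_iff; intuition. }
  assert (Hav : avoid (VL j) (E' ++ leaf_forest s 0 G)).
  { apply within_avoid with (is_leaf_of P).
    - apply within_app; split.
      + eapply within_impl; [exact HPQ|]; apply (psw_within H1).
      + eapply within_impl; [|apply (fsw_within HF)].
        intros v [y [-> Hy]]; exists y; split; auto; now rewrite HP.
    - intros [y [[= <-] Hy]]; apply Hj; simpl; auto. }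
  assert (S4 : conn (E' ++ leaf_forest s 0 G) (VL x) (VL i)).
  { assert (S4 : conn ((a, VL j) :: E' ++ leaf_forest s 0 G) (VL x) (VL i)).
    { revert S3; apply conn_perm. rewrite H2; perm. }
    apply conn_cons in S4; destruct S4 as [S4|[[_ S4]|[S4 _]]]; auto.
    - apply (conn_avoid Hav) in S4; auto; congruence.
    - apply (conn_avoid Hav) in S4; auto; congruence. }
  assert (HS : refines (tree_on (is_leaf_of P)) (fun E => ~ conn E (VL x) (VL i))
                 (fill C (Tens (Par Q R) (Leaf i k))) (fill C (Par Q R))).
  { apply refines_fill.
    - apply tree_on_invariant.
    - intros E F [_ HEF] Hn Hc'; apply Hn, HEF; auto; exact I.
    - apply refines_side; auto. intros v Hv; apply HL; now apply is_leaf_of_par. }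
  apply (HS None (leaf_forest s 0 G)) with (E := E') (v := rep s VP Pj []); auto.
  - intros v E HE; apply tree_on_perm with (E ++ leaf_forest s 0 G); [simpl; perm|].
    eapply HN; eauto.
  - revert S4; apply conn_perm; simpl; perm.
Qed.

(** Correctness travels with the equivalence, because each extrusion derives its side condition from
    the correctness of the current graph. *)
Definition reach G P P' : Prop :=
  Defs.equiv G P P' /\ net P' G /\ Permutation (leaves P) (leaves P').

Lemma reach_ok G P P' : reach G P P' -> ok P G -> ok P' G.
Proof.
  intros [_ [H1 H2]] [_ H3]; split; auto. now rewrite <- (names_perm _ _ H2).
Qed.

Lemma reach_trans G P P' P'' : reach G P P' -> reach G P' P'' -> reach G P P''.
Proof.
  intros [H1 [H2 H3]] [H4 [H5 H6]]; split; [|split]; auto.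
  - eapply rst_trans; eauto.
  - eapply Permutation_trans; eauto.
Qed.

Lemma reach_refl G P : ok P G -> reach G P P.
Proof. intros [H _]; split; [apply rst_refl|auto]. Qed.

Lemma reach_tensC G C X Y : ok (fill C (Tens X Y)) G ->
  reach G (fill C (Tens X Y)) (fill C (Tens Y X)).
Proof.
  intros [H _]; split; [|split].
  - apply equiv_local; constructor.
  - now apply net_tensC.
  - apply leaves_fill, Permutation_app_comm.
Qed.

Lemma reach_extrude G C Q R i : ok (fill C (Tens (Par Q R) (Leaf i (KBot A)))) G ->
  reach G (fill C (Tens (Par Q R) (Leaf i (KBot A))))
          (fill C (Par Q (Tens R (Leaf i (KBot A))))).
Proof.
  intros H; split; [|split].
  (* The rule is used backwards: its source, and hence its side condition, belongs to the graph
     being reached. *)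
  - apply rst_sym, rst_step.
    rewrite <- (replace_fill C (Par Q (Tens R (Leaf i (KBot A)))) (Tens (Par Q R) _)).
    apply st_bot; [apply subtree_fill|].
    intros s u Hu; now apply extrude_side.
  - destruct H as [H _]; revert H; apply net_refines; [simpl; now rewrite app_assoc|].
    apply refines_extrude; intros v Hv; apply is_leaf_of_fill, is_leaf_of_l.
    now apply is_leaf_of_par.
  - apply leaves_fill; simpl; now rewrite app_assoc.
Qed.

(** The linkings produced by an axiom and bottom rules, with the atoms oriented as in [tr_id]. *)
Inductive star : tree A -> Prop :=
| star_one x : star (Leaf x (KOne A))
| star_ax x y a : star (Tens (Leaf x (KAt a)) (Leaf y (KNAt a)))
| star_bot x L : star L -> star (Tens (Leaf x (KBot A)) L).

Fixpoint parts t : list (tree A) :=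
  match t with
  | Par l r => parts l ++ parts r
  | _ => [t]
  end.

(** The bottom is handed down to the rightmost part: commuted to the right of the tensor, extruded
    into [R], commuted back. The context is arbitrary because correctness concerns the whole
    graph. *)
Lemma reach_bot x G L : Forall star (parts L) ->
  forall C, ok (fill C (Tens (Leaf x (KBot A)) L)) G ->
  exists L', Forall star (parts L') /\ reach G (fill C (Tens (Leaf x (KBot A)) L)) (fill C L').
Proof.
  assert (K : forall L, parts L = [L] -> Forall star (parts L) ->
    forall C, ok (fill C (Tens (Leaf x (KBot A)) L)) G ->
    exists L', Forall star (parts L') /\ reach G (fill C (Tens (Leaf x (KBot A)) L)) (fill C L')).
  { intros L0 HL H C HC; exists (Tens (Leaf x (KBot A)) L0); split; [|now apply reach_refl].
    rewrite HL in H; inversion H; subst; repeat constructor; auto. }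
  induction L as [y k|l _ r _|Q _ R IH]; auto.
  intros H C HC; simpl in H; apply Forall_app in H; destruct H as [HQ HR].
  assert (S1 := reach_tensC C _ _ HC); assert (O1 := reach_ok S1 HC).
  assert (S2 := reach_extrude C _ _ _ O1); assert (O2 := reach_ok S2 O1).
  set (D := comp C (CPr Q (Hole A))).
  assert (HD : forall X, fill C (Par Q X) = fill D X) by (intros; unfold D; now rewrite fill_comp).
  rewrite HD in O2, S2.
  assert (S3 := reach_tensC D _ _ O2); assert (O3 := reach_ok S3 O2).
  destruct (IH HR D O3) as [R' [H1 H2]].
  exists (Par Q R'); split; [simpl; now apply Forall_app|].
  rewrite HD; eauto using reach_trans.
Qed.

Lemma reach_stars G L : linking L -> forall C, ok (fill C L) G ->
  exists L', Forall star (parts L') /\ reach G (fill C L) (fill C L').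
Proof.
  induction 1 as [x|x y a|x y a|x L HL IH|x L HL IH|L M HL IHL HM IHM]; intros C HC.
  - exists (Leaf x (KOne A)); split; [repeat constructor|now apply reach_refl].
  - exists (Tens (Leaf x (KAt a)) (Leaf y (KNAt a))); split; [repeat constructor|now apply reach_refl].
  - exists (Tens (Leaf y (KAt a)) (Leaf x (KNAt a))); split; [repeat constructor|now apply reach_tensC].
  - set (D := comp C (CTr (Leaf x (KBot A)) (Hole A))).
    assert (HD : forall X, fill C (Tens (Leaf x (KBot A)) X) = fill D X)
      by (intros; unfold D; now rewrite fill_comp).
    rewrite HD in HC |- *; destruct (IH _ HC) as [L1 [H1 H2]].
    assert (O1 := reach_ok H2 HC); rewrite <- HD in O1.
    destruct (reach_bot _ _ H1 C O1) as [L2 [H3 H4]]; exists L2; split; auto.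
    rewrite HD in H4; eauto using reach_trans.
  - assert (S1 := reach_tensC C _ _ HC); assert (O1 := reach_ok S1 HC).
    set (D := comp C (CTr (Leaf x (KBot A)) (Hole A))).
    assert (HD : forall X, fill C (Tens (Leaf x (KBot A)) X) = fill D X)
      by (intros; unfold D; now rewrite fill_comp).
    rewrite HD in S1, O1; destruct (IH _ O1) as [L1 [H1 H2]].
    assert (O2 := reach_ok H2 O1); rewrite <- HD in O2.
    destruct (reach_bot _ _ H1 C O2) as [L2 [H3 H4]]; exists L2; split; auto.
    rewrite HD in H4; eauto using reach_trans.
  - set (D := comp C (CPl (Hole A) M)).
    assert (HD : forall X, fill C (Par X M) = fill D X)
      by (intros; unfold D; now rewrite fill_comp).
    rewrite HD in HC |- *; destruct (IHL _ HC) as [L1 [H1 H2]].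
    assert (O1 := reach_ok H2 HC); rewrite <- HD in O1.
    set (D' := comp C (CPr L1 (Hole A))).
    assert (HD' : forall X, fill C (Par L1 X) = fill D' X)
      by (intros; unfold D'; now rewrite fill_comp).
    rewrite <- (HD L1), HD' in H2; rewrite HD' in O1; destruct (IHM _ O1) as [M1 [H3 H4]].
    exists (Par L1 M1); split; [simpl; now apply Forall_app|].
    rewrite HD'; eauto using reach_trans.
Qed.
End Normal.

(** * Partially built sequents *)

Section Seq.
Variable A : Type.

(* A part of the sequent forest not yet built by the sequent proof: vertices are
   labelled, and a leaf carries the formula already derived at its vertex. *)
Inductive ltree : Type :=
| LLeaf (v : vtx) (f : tree A)
| LTens (v : vtx) (l r : ltree)
| LPar (v : vtx) (l r : ltree).

Implicit Types (t l r X Y : ltree) (F : list ltree) (E B : edges).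

Definition lroot t : vtx :=
  match t with LLeaf v _ => v | LTens v _ _ => v | LPar v _ _ => v end.

Fixpoint formula t : tree A :=
  match t with
  | LLeaf _ f => f
  | LTens _ l r => Tens (formula l) (formula r)
  | LPar _ l r => Par (formula l) (formula r)
  end.

Fixpoint lleaves t : list (vtx * tree A) :=
  match t with
  | LLeaf v f => [(v, f)]
  | LTens _ l r | LPar _ l r => lleaves l ++ lleaves r
  end.

Fixpoint tens_edges t : edges :=
  match t with
  | LLeaf _ _ => []
  | LTens v l r => (v, lroot l) :: (v, lroot r) :: tens_edges l ++ tens_edges r
  | LPar _ l r => tens_edges l ++ tens_edges r
  end.

Fixpoint tens_verts t : list vtx :=
  match t with
  | LLeaf _ _ => []
  | LTens v l r => v :: tens_verts l ++ tens_verts r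
  | LPar _ l r => tens_verts l ++ tens_verts r
  end.

Fixpoint pars t : list (vtx * vtx * vtx) :=
  match t with
  | LLeaf _ _ => []
  | LTens _ l r => pars l ++ pars r
  | LPar v l r => (v, lroot l, lroot r) :: pars l ++ pars r
  end.

Inductive sub X : ltree -> Prop :=
| sub_refl : sub X X
| sub_Tl v l r : sub X l -> sub X (LTens v l r)
| sub_Tr v l r : sub X r -> sub X (LTens v l r)
| sub_Pl v l r : sub X l -> sub X (LPar v l r)
| sub_Pr v l r : sub X r -> sub X (LPar v l r).

(* All that is needed of replacing an occurrence of [X] in [F] by [Y]: a common rest. *)
Definition same_context X F Y F' : Prop :=
  map formula F' = map formula F /\
  exists K1 K2 K3 K4,
    Permutation (flat_map tens_edges F) (tens_edges X ++ K1) /\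
    Permutation (flat_map tens_edges F') (tens_edges Y ++ K1) /\
    Permutation (flat_map tens_verts F) (tens_verts X ++ K2) /\
    Permutation (flat_map tens_verts F') (tens_verts Y ++ K2) /\
    Permutation (flat_map pars F) (pars X ++ K3) /\
    Permutation (flat_map pars F') (pars Y ++ K3) /\
    Permutation (flat_map lleaves F) (lleaves X ++ K4) /\
    Permutation (flat_map lleaves F') (lleaves Y ++ K4).

Lemma sub_replace X Y t : sub X t -> lroot Y = lroot X -> formula Y = formula X ->
  exists t', lroot t' = lroot t /\ same_context X [t] Y [t'].
Proof.
  intros H HR HF; induction H as [|v l r _ IH|v l r _ IH|v l r _ IH|v l r _ IH].
  - exists Y; split; auto; split; [simpl; congruence|].
    exists [], [], [], []; simpl; rewrite !app_nil_r; repeat split; apply Permutation_refl.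
  - destruct IH as [l' [H1 [H2 [K1 [K2 [K3 [K4 H]]]]]]].
    simpl in *; rewrite !app_nil_r in H; decompose [and] H; clear H; inversion H2.
    exists (LTens v l' r); split; auto; split; [simpl; congruence|].
    exists ((v, lroot l) :: (v, lroot r) :: K1 ++ tens_edges r), (v :: K2 ++ tens_verts r),
      (K3 ++ pars r), (K4 ++ lleaves r); simpl; rewrite !app_nil_r, H1.
    repeat split; repeat match goal with H : Permutation _ _ |- _ => rewrite H; clear H end; perm.
  - destruct IH as [r' [H1 [H2 [K1 [K2 [K3 [K4 H]]]]]]].
    simpl in *; rewrite !app_nil_r in H; decompose [and] H; clear H; inversion H2.
    exists (LTens v l r'); split; auto; split; [simpl; congruence|].
    exists ((v, lroot l) :: (v, lroot r) :: tens_edges l ++ K1), (v :: tens_verts l ++ K2),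
      (pars l ++ K3), (lleaves l ++ K4); simpl; rewrite !app_nil_r, H1.
    repeat split; repeat match goal with H : Permutation _ _ |- _ => rewrite H; clear H end; perm.
  - destruct IH as [l' [H1 [H2 [K1 [K2 [K3 [K4 H]]]]]]].
    simpl in *; rewrite !app_nil_r in H; decompose [and] H; clear H; inversion H2.
    exists (LPar v l' r); split; auto; split; [simpl; congruence|].
    exists (K1 ++ tens_edges r), (K2 ++ tens_verts r),
      ((v, lroot l, lroot r) :: K3 ++ pars r), (K4 ++ lleaves r); simpl; rewrite !app_nil_r, H1.
    repeat split; repeat match goal with H : Permutation _ _ |- _ => rewrite H; clear H end; perm.
  - destruct IH as [r' [H1 [H2 [K1 [K2 [K3 [K4 H]]]]]]].
    simpl in *; rewrite !app_nil_r in H; decompose [and] H; clear H; inversion H2.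
    exists (LPar v l r'); split; auto; split; [simpl; congruence|].
    exists (tens_edges l ++ K1), (tens_verts l ++ K2),
      ((v, lroot l, lroot r) :: pars l ++ K3), (lleaves l ++ K4); simpl; rewrite !app_nil_r, H1.
    repeat split; repeat match goal with H : Permutation _ _ |- _ => rewrite H; clear H end; perm.
Qed.

Lemma forest_replace X Y t F : In t F -> sub X t -> lroot Y = lroot X -> formula Y = formula X ->
  exists F', same_context X F Y F'.
Proof.
  intros Ht HX HR HF; destruct (in_split _ _ Ht) as [F1 [F2 ->]].
  destruct (sub_replace Y HX HR HF) as [t' [_ [H2 [K1 [K2 [K3 [K4 H]]]]]]].
  simpl in *; rewrite !app_nil_r in H; decompose [and] H; clear H; inversion H2.
  exists (F1 ++ t' :: F2); split; [rewrite !map_app; simpl; congruence|].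
  exists (K1 ++ flat_map tens_edges F1 ++ flat_map tens_edges F2),
    (K2 ++ flat_map tens_verts F1 ++ flat_map tens_verts F2),
    (K3 ++ flat_map pars F1 ++ flat_map pars F2),
    (K4 ++ flat_map lleaves F1 ++ flat_map lleaves F2).
  rewrite !flat_map_app; simpl.
  repeat split; repeat match goal with H : Permutation _ _ |- _ => rewrite H; clear H end; perm.
Qed.

Definition ready_tens t : Prop :=
  exists v x f y g, sub (LTens v (LLeaf x f) (LLeaf y g)) t.

Lemma sub_trans X Y t : sub X Y -> sub Y t -> sub X t.
Proof. intros H; induction 1; auto using sub. Qed.

Lemma sub_tens_edges X t : sub X t -> incl (tens_edges X) (tens_edges t).
Proof.
  induction 1; intros e He; simpl; rewrite ?in_app_iff; auto.
Qed.

Lemma sub_pars X t : sub X t -> incl (pars X) (pars t).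
Proof.
  induction 1; intros e He; simpl; rewrite ?in_app_iff; auto.
Qed.

(** Descend through tensors into a premise that is not a leaf. The descent stops at a par, reached
    by tensor edges only, or at a tensor of two leaves. *)
Lemma tens_descend t : (exists v f, t = LLeaf v f) \/ ready_tens t \/
  exists q, In q (pars t) /\ conn (tens_edges t) (lroot t) (par_vertex q).
Proof.
  assert (K : forall v l r, (forall t', t' = l \/ t' = r -> ready_tens t' ->
      ready_tens (LTens v l r))).
  { intros v l r t' Ht [w [x [f [y [g H]]]]]; exists w, x, f, y, g.
    destruct Ht; subst; auto using sub. }
  induction t as [v f|v l IHl r IHr|v l _ r _]; eauto.
  - right; destruct IHl as [[x [f ->]]|[H|[q [H1 H2]]]]; [|left; eapply K; [left; reflexivity|exact H]|right].
    + destruct IHr as [[y [g ->]]|[H|[q [H1 H2]]]]; [left|left; eapply K; [right; reflexivity|exact H]|right].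
      * exists v, x, f, y, g; constructor.
      * exists q; simpl; split; auto. apply conn_trans with (lroot r);
          [apply conn_in; simpl; auto|revert H2; apply conn_incl; intros e; simpl; auto].
    + exists q; simpl; rewrite in_app_iff; split; auto. apply conn_trans with (lroot l);
        [apply conn_in; simpl; auto|revert H2; apply conn_incl; intros e; simpl].
      rewrite in_app_iff; auto.
  - right; right; exists (v, lroot l, lroot r); split; [simpl; auto|apply conn_refl].
Qed.

Lemma pars_sub c x y t : In (c, x, y) (pars t) ->
  exists l r, sub (LPar c l r) t /\ lroot l = x /\ lroot r = y.
Proof.
  induction t as [v f|v l IHl r IHr|v l IHl r IHr]; simpl; [tauto| |].
  - rewrite in_app_iff; intros [H|H]; [destruct (IHl H) as [l' [r' [H1 H2]]]|
      destruct (IHr H) as [l' [r' [H1 H2]]]]; exists l', r'; auto using sub.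
  - rewrite in_app_iff; intros [H|[H|H]].
    + inversion H; subst; exists l, r; auto using sub.
    + destruct (IHl H) as [l' [r' [H1 H2]]]; exists l', r'; auto using sub.
    + destruct (IHr H) as [l' [r' [H1 H2]]]; exists l', r'; auto using sub.
Qed.

Lemma tens_edges_sub a b t : In (a, b) (tens_edges t) -> exists l r, sub (LTens a l r) t.
Proof.
  induction t as [v f|v l IHl r IHr|v l IHl r IHr]; simpl; [tauto| |].
  - rewrite in_app_iff; intros [H|[H|[H|H]]].
    + inversion H; subst; eauto using sub.
    + inversion H; subst; eauto using sub.
    + destruct (IHl H) as [l' [r' H1]]; eauto using sub.
    + destruct (IHr H) as [l' [r' H1]]; eauto using sub.
  - rewrite in_app_iff; intros [H|H].
    + destruct (IHl H) as [l' [r' H1]]; eauto using sub.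
    + destruct (IHr H) as [l' [r' H1]]; eauto using sub.
Qed.

(** A connection starting at [x] never meets an edge of [T]. *)
Lemma conn_component E T x y : conn (E ++ T) x y ->
  (forall a b, In (a, b) T -> ~ conn (E ++ T) x a) -> conn E x y.
Proof.
  intros H HT.
  assert (K : forall u v, conn (E ++ T) u v -> conn (E ++ T) x u -> conn E u v).
  { induction 1 as [u v Hi| u | u v Huv IH | u v w Huv IH1 Hvw IH2]; intros Hx.
    - apply in_app_iff in Hi; destruct Hi as [Hi|Hi]; [now apply conn_in|].
      exfalso; eapply HT; eauto.
    - apply conn_refl.
    - apply conn_sym, IH. eapply conn_trans; [exact Hx|]. apply conn_sym; exact Huv.
    - eapply conn_trans; eauto using conn_trans. }
  apply K; auto using conn_refl.
Qed.

Definition inner F : list vtx := map par_vertex (flat_map pars F) ++ flat_map tens_verts F.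
Definition verts F : list vtx := inner F ++ map fst (flat_map lleaves F).

(** A sequent already derived: the linking of its proof, and its formulas with the vertices of their
    roots. *)
Definition blob : Type := (tree A * list (vtx * tree A))%type.

(** [F] is the unbuilt part of the forest and [E] records the links and tensors already used. On the
    leaves of [F] the components of [E] are the derived sequents ([pg_blob]), and each switching of
    the remaining pars still gives a tree. *)
Record progress E F (bs : list blob) : Prop := {
  pg_nodup : NoDup (verts F);
  pg_forest : forall s, forest ((E ++ flat_map tens_edges F) ++ map (pick s) (flat_map pars F));
  pg_conn : forall s u v, In u (verts F) -> In v (verts F) ->
    conn ((E ++ flat_map tens_edges F) ++ map (pick s) (flat_map pars F)) u v;
  pg_avoid : forall v, In v (inner F) -> avoid v E;
  pg_leaves : Permutation (concat (map snd bs)) (flat_map lleaves F);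
  pg_blob : forall b b' x f y g, In b bs -> In b' bs -> In (x, f) (snd b) -> In (y, g) (snd b') ->
    (conn E x y <-> b = b');
  pg_proof : forall b, In b bs -> translates (fst b) (map snd (snd b));
  pg_names : NoDup (concat (map (fun b => names (fst b)) bs));
  pg_nonempty : bs <> [] }.

Lemma progress_perm E F bs bs' : Permutation bs bs' -> progress E F bs -> progress E F bs'.
Proof.
  intros HP [H1 H2 H3 H4 H5 H6 H7 H8 H9].
  assert (HP' := Permutation_sym HP).
  assert (K : forall T (h : blob -> list T), Permutation (concat (map h bs)) (concat (map h bs'))).
  { intros T h; rewrite <- !flat_map_concat_map; now apply Permutation_flat_map. }
  constructor; auto.
  - rewrite <- H5; symmetry; apply K.
  - intros b b' x f y g Hb Hb'; apply H6; eapply Permutation_in; eauto.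
  - intros b Hb; apply H7; eapply Permutation_in; eauto.
  - eapply Permutation_NoDup; [apply K|auto].
  - intros ->; apply H9; now apply Permutation_nil.
Qed.

Lemma in_blob E F bs x f : progress E F bs -> In (x, f) (flat_map lleaves F) ->
  exists b, In b bs /\ In (x, f) (snd b).
Proof.
  intros HP H; rewrite <- (pg_leaves HP) in H.
  apply in_concat in H; destruct H as [c [H1 H2]]; apply in_map_iff in H1.
  destruct H1 as [b [<- H1]]; eauto.
Qed.

Lemma in_perm (T : Type) (a : T) ls : In a ls -> exists ls', Permutation ls (a :: ls').
Proof.
  intros H; destruct (in_split _ _ H) as [l1 [l2 ->]]; exists (l1 ++ l2).
  symmetry; apply Permutation_middle.
Qed.

Lemma translates_par P f g (c : list (tree A)) D : translates P D -> Permutation D (f :: g :: c) ->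
  translates P (Par f g :: c).
Proof. intros H HP; apply tr_par; eapply tr_exch; eauto. Qed.

Lemma translates_tens P Q f g (c d : list (tree A)) D1 D2 :
  translates P D1 -> translates Q D2 -> Permutation D1 (f :: c) -> Permutation D2 (g :: d) ->
  disjoint_names (names P) (names Q) -> translates (Par P Q) (Tens f g :: c ++ d).
Proof.
  intros H1 H2 HP1 HP2 Hd.
  apply tr_exch with (c ++ Tens f g :: d); [|symmetry; apply Permutation_middle].
  apply tr_tens; auto.
  - apply tr_exch with D1; auto. rewrite HP1; apply Permutation_cons_append.
  - now apply tr_exch with D2.
Qed.
End Seq.

(** * Applying a tensor or par rule *)

Section Steps.
Variable A : Type.
Implicit Types (t l r X Y : ltree A) (F : list (ltree A)) (E B : edges) (bs : list (blob A)).

(** The multiset of stars in the linkings; no rule changes it, and it determines the final linking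
    up to equivalence. *)
Definition blob_parts bs : list (tree A) := concat (map (fun b => parts (fst b)) bs).

Lemma vtx_eq_dec (u v : vtx) : {u = v} + {u <> v}.
Proof. repeat decide equality. Qed.

Lemma leaf_nodup E F bs : progress E F bs -> NoDup (concat (map snd bs)).
Proof.
  intros HP; apply (Permutation_NoDup (Permutation_sym (pg_leaves HP))).
  eapply NoDup_map_inv; apply (NoDup_app_remove_l _ _ (pg_nodup HP)).
Qed.

(** Each open leaf is listed once, so a sequent containing one cannot be listed twice. *)
Lemma blob_head_notin E F b bs x f : progress E F (b :: bs) -> In (x, f) (snd b) -> ~ In b bs.
Proof.
  intros HP Hx Hb; assert (H := leaf_nodup HP); simpl in H.
  apply in_perm in Hx; destruct Hx as [c Hc]; rewrite Hc in H; simpl in H.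
  inversion H as [|? ? N _]; apply N; apply in_app_iff; right.
  apply in_concat; exists (snd b); split; [now apply in_map|rewrite Hc; simpl; auto].
Qed.

Lemma blob_leaf E F bs b x f : progress E F bs -> In b bs -> In (x, f) (snd b) ->
  In (x, f) (flat_map (@lleaves A) F).
Proof.
  intros HP Hb Hx; rewrite <- (pg_leaves HP).
  apply in_concat; exists (snd b); split; auto; now apply in_map.
Qed.

Lemma inner_not_leaf E F bs v b f : progress E F bs -> In v (inner F) -> In b bs ->
  ~ In (v, f) (snd b).
Proof.
  intros HP Hv Hb Hf; assert (HN := pg_nodup HP); unfold verts in HN.
  apply in_perm in Hv; destruct Hv as [ls Hls]; rewrite Hls in HN; simpl in HN.
  inversion HN as [|? ? N _]; apply N; apply in_app_iff; right.
  apply in_map_iff; exists (v, f); split; auto; eapply blob_leaf; eauto.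
Qed.

(** One rule has been applied: one internal vertex of the forest has become a derived leaf. *)
Definition done E F bs : Prop := exists F' E' bs', progress E' F' bs' /\
  map (@formula A) F' = map (@formula A) F /\
  Permutation (blob_parts bs') (blob_parts bs) /\
  length (inner F) = S (length (inner F')).

(** As [E] connects [x] and [y], both premises lie in one sequent. Turning the par into a leaf
    attached to [x] leaves exactly the switchings that keep the left premise at [v]. *)
Lemma par_step E F bs t v x f y g : progress E F bs -> In t F ->
  sub (LPar v (LLeaf x f) (LLeaf y g)) t -> conn E x y -> done E F bs.
Proof.
  intros HP Ht Hsub Hxy.
  destruct (@forest_replace A _ (LLeaf v (Par f g)) _ _ Ht Hsub eq_refl eq_refl)
    as [F' [HF [K1 [K2 [K3 [K4 [TE [TE' [TV [TV' [PS [PS' [LL LL']]]]]]]]]]]]]; simpl in *.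
  assert (Lx : In (x, f) (flat_map (@lleaves A) F)) by (rewrite LL; simpl; auto).
  assert (Ly : In (y, g) (flat_map (@lleaves A) F)) by (rewrite LL; simpl; auto).
  assert (Vv : In v (inner F)) by (unfold inner; rewrite PS; simpl; auto).
  assert (HN := pg_nodup HP); unfold verts, inner in HN.
  rewrite PS, TV, LL in HN; simpl in HN; unfold par_vertex at 1 in HN; simpl in HN.
  assert (HN' : NoDup (x :: y :: (map par_vertex K3 ++ K2) ++ v :: map fst K4)).
  { revert HN; apply Permutation_NoDup; perm. }
  inversion HN as [|? ? Hv0 _]; inversion HN' as [|? ? N1 N2]; inversion N2 as [|? ? _ N3]; subst.
  assert (Hxy' : x <> y) by (intros ->; apply N1; simpl; auto).
  destruct (in_blob _ _ HP Lx) as [b [Hb Hbx]], (in_blob _ _ HP Ly) as [b2 [Hb2 Hby]].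
  assert (b = b2) by (refine (proj1 (pg_blob HP _ _ _ _ _ _ _ _ Hbx Hby) Hxy); auto); subst b2.
  destruct (in_perm _ _ Hb) as [bs0 Hbs]; assert (HP0 := progress_perm Hbs HP).
  destruct (in_perm _ _ Hbx) as [c1 Hc1].
  assert (Hc : exists c, Permutation (snd b) ((x, f) :: (y, g) :: c)).
  { rewrite Hc1 in Hby; destruct Hby as [Hby|Hby]; [congruence|].
    destruct (in_perm _ _ Hby) as [c Hc]; exists c; rewrite Hc1; now constructor. }
  destruct Hc as [c Hc]; clear c1 Hc1.
  set (nb := (fst b, (v, Par f g) :: c) : blob A).
  assert (Hav : avoid v E) by now apply (pg_avoid HP).
  assert (Hvl : forall b' h, In b' (b :: bs0) -> ~ In (v, h) (snd b'))
    by (intros; eapply inner_not_leaf; eauto).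
  assert (Hvx : v <> x) by (intros ->; eapply (Hvl b); simpl; eauto).
  assert (SIM : sim (fun u => u <> v) ((v, x) :: E) E) by (apply sim_pendant; auto).
  assert (Hcb : forall z h, In (z, h) c -> In (z, h) (snd b))
    by (intros; rewrite Hc; simpl; auto).
  assert (Hnew : forall z h, In (z, h) (snd nb) -> conn ((v, x) :: E) z x).
  { intros z h [Hz|Hz].
    - inversion Hz; subst; apply conn_in; simpl; auto.
    - apply conn_wk; refine (proj2 (pg_blob HP0 _ _ _ _ _ _ _ _ (Hcb _ _ Hz) Hbx) eq_refl); simpl; auto. }
  assert (Hold : forall b' z h, In b' bs0 -> In (z, h) (snd b') -> ~ conn ((v, x) :: E) z x).
  { intros b' z h Hb' Hz Hcz.
    apply (proj2 SIM) in Hcz; [|intros ->; eapply (Hvl b'); simpl; eauto|auto].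
    assert (b' = b) by (refine (proj1 (pg_blob HP0 _ _ _ _ _ _ _ _ Hz Hbx) Hcz); simpl; auto); subst b'.
    eapply blob_head_notin; eauto. }
  assert (PF : forall s, Permutation
     ((E ++ flat_map (@tens_edges A) F) ++ map (pick (upd vtx_eq_dec s v false)) (flat_map (@pars A) F))
     ((((v, x) :: E) ++ flat_map (@tens_edges A) F') ++ map (pick s) (flat_map (@pars A) F'))).
  { intros s; rewrite TE, TE'.
    rewrite (Permutation_map _ PS), (Permutation_map (pick s) PS'); simpl.
    rewrite upd_same, pick_upd; [perm|].
    intros Hi; apply Hv0; rewrite !in_app_iff; auto. }
  assert (IV : Permutation (inner F) (v :: inner F')).
  { unfold inner; rewrite PS, PS', TV, TV'; simpl; perm. }
  assert (VV : incl (verts F') (verts F)).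
  { intros u; unfold verts; rewrite IV, LL, LL'; simpl; rewrite !in_app_iff; simpl; tauto. }
  exists F', ((v, x) :: E), (nb :: bs0); split; [|split; [auto|split]].
  - constructor.
    + unfold verts, inner; rewrite PS', TV', LL'; simpl; exact N3.
    + intros s; eapply forest_perm; [apply PF|apply (pg_forest HP)].
    + intros s u w Hu Hw; eapply conn_perm; [apply PF|apply (pg_conn HP); auto].
    + intros u Hu.
      assert (Hu' : In u (map par_vertex K3 ++ K2))
        by (revert Hu; unfold inner; now rewrite PS', TV').
      apply avoid_cons.
      * intros ->; apply Hv0; apply in_app_iff; auto.
      * intros ->; apply N1; right; apply in_app_iff; auto.
      * apply (pg_avoid HP); rewrite IV; simpl; auto.
    + rewrite LL'; simpl. apply Permutation_cons; auto.
      apply Permutation_cons_inv with (y, g), Permutation_cons_inv with (x, f).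
      rewrite <- LL, <- (pg_leaves HP0); simpl; rewrite Hc; reflexivity.
    + intros b1 b2 z h z' h' [<-|H1] [<-|H2] Hz Hz'.
      * split; auto; intros _.
        exact (conn_trans (Hnew _ _ Hz) (conn_sym (Hnew _ _ Hz'))).
      * split; [|intros <-; exfalso; apply (Hvl nb (Par f g)); simpl; auto].
        intros Hc'; exfalso; apply (Hold _ _ _ H2 Hz').
        exact (conn_trans (conn_sym Hc') (Hnew _ _ Hz)).
      * split; [|intros ->; exfalso; apply (Hvl nb (Par f g)); simpl; auto].
        intros Hc'; exfalso; apply (Hold _ _ _ H1 Hz).
        exact (conn_trans Hc' (Hnew _ _ Hz')).
      * rewrite (proj2 SIM); [refine (pg_blob HP0 _ _ _ _ _ _ _ _ Hz Hz'); simpl; auto| |].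
        -- intros ->; apply (Hvl b1 h); simpl; auto.
        -- intros ->; apply (Hvl b2 h'); simpl; auto.
    + intros b' [<-|Hb'].
      * simpl; eapply translates_par; [apply (pg_proof HP0 b); simpl; auto|].
        apply (Permutation_map snd) in Hc; exact Hc.
      * apply (pg_proof HP0); simpl; auto.
    + exact (pg_names HP0).
    + discriminate.
  - unfold blob_parts; rewrite <- !flat_map_concat_map, Hbs; reflexivity.
  - rewrite IV; reflexivity.
Qed.

(** Premises in the same sequent would close a cycle through [v], so they come from two sequents,
    which the rule merges. Both tensor edges pass into [E]. *)
Lemma tens_step E F bs t v x f y g : progress E F bs -> In t F ->
  sub (LTens v (LLeaf x f) (LLeaf y g)) t -> done E F bs.
Proof.
  intros HP Ht Hsub.
  destruct (@forest_replace A _ (LLeaf v (Tens f g)) _ _ Ht Hsub eq_refl eq_refl)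
    as [F' [HF [K1 [K2 [K3 [K4 [TE [TE' [TV [TV' [PS [PS' [LL LL']]]]]]]]]]]]]; simpl in *.
  assert (Lx : In (x, f) (flat_map (@lleaves A) F)) by (rewrite LL; simpl; auto).
  assert (Ly : In (y, g) (flat_map (@lleaves A) F)) by (rewrite LL; simpl; auto).
  assert (IV : Permutation (inner F) (v :: inner F')).
  { unfold inner; rewrite PS, PS', TV, TV'; simpl; perm. }
  assert (Vv : In v (inner F)) by (rewrite IV; simpl; auto).
  assert (HN := pg_nodup HP); unfold verts in HN; rewrite IV, LL in HN; simpl in HN.
  assert (HN' : NoDup (x :: y :: inner F' ++ v :: map fst K4)).
  { revert HN; apply Permutation_NoDup; perm. }
  inversion HN as [|? ? Hv0 _]; inversion HN' as [|? ? N1 N2]; inversion N2 as [|? ? N4 N3]; subst.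
  destruct (in_blob _ _ HP Lx) as [b1 [Hb1 Hbx]], (in_blob _ _ HP Ly) as [b2 [Hb2 Hby]].
  assert (Hb12 : b1 <> b2).
  { intros H; assert (Hxy : conn E x y)
      by (refine (proj2 (pg_blob HP _ _ _ _ _ _ _ _ Hbx Hby) H); auto).
    assert (HFo := pg_forest HP (fun _ => false)).
    apply forest_perm with (F := (v, x) :: (v, y) :: E ++ K1 ++
      map (pick (fun _ => false)) (flat_map (@pars A) F)) in HFo; [|rewrite TE; perm].
    destruct HFo as [HFo _]; apply HFo; apply conn_trans with y; [apply conn_in; simpl; auto|].
    apply conn_wk, conn_sym; revert Hxy; apply conn_incl, incl_appl, incl_refl. }
  destruct (in_perm _ _ Hb1) as [bs1 Hbs1].
  assert (Hb2' : In b2 bs1) by (rewrite Hbs1 in Hb2; destruct Hb2; [congruence|auto]).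
  destruct (in_perm _ _ Hb2') as [bs0 Hbs0].
  assert (Hbs : Permutation bs (b1 :: b2 :: bs0)) by (rewrite Hbs1, Hbs0; reflexivity).
  assert (HP0 := progress_perm Hbs HP).
  assert (HP0' := progress_perm (perm_swap b2 b1 bs0) HP0).
  destruct (in_perm _ _ Hbx) as [c1 Hc1], (in_perm _ _ Hby) as [c2 Hc2].
  set (nb := (Par (fst b1) (fst b2), (v, Tens f g) :: c1 ++ c2) : blob A).
  assert (Hav : avoid v E) by now apply (pg_avoid HP).
  assert (Hvl : forall b' h, In b' (b1 :: b2 :: bs0) -> ~ In (v, h) (snd b'))
    by (intros; apply inner_not_leaf with (1 := HP0); auto).
  assert (Hvx : v <> x) by (intros ->; apply (Hvl b1 f); simpl; auto).
  assert (Hvy : v <> y) by (intros ->; apply (Hvl b2 g); simpl; auto).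
  assert (SIM : sim (fun u => u <> v) ((v, x) :: (v, y) :: E) ((x, y) :: E))
    by (apply sim_elim2; auto).
  assert (Hvx' : conn ((v, x) :: (v, y) :: E) v x) by (apply conn_in; simpl; auto).
  assert (Hvy' : conn ((v, x) :: (v, y) :: E) v y) by (apply conn_in; simpl; auto).
  assert (Hcb1 : forall z h, In (z, h) c1 -> In (z, h) (snd b1))
    by (intros; rewrite Hc1; simpl; auto).
  assert (Hcb2 : forall z h, In (z, h) c2 -> In (z, h) (snd b2))
    by (intros; rewrite Hc2; simpl; auto).
  assert (Hnew : forall z h, In (z, h) (snd nb) -> conn ((v, x) :: (v, y) :: E) z x).
  { intros z h [Hz|Hz]; [|apply in_app_iff in Hz; destruct Hz as [Hz|Hz]].
    - inversion Hz; subst; auto.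
    - apply conn_wk, conn_wk.
      refine (proj2 (pg_blob HP0 _ _ _ _ _ _ _ _ (Hcb1 _ _ Hz) Hbx) eq_refl); simpl; auto.
    - apply conn_trans with y; [|eauto using conn_trans, conn_sym].
      apply conn_wk, conn_wk.
      refine (proj2 (pg_blob HP0 _ _ _ _ _ _ _ _ (Hcb2 _ _ Hz) Hby) eq_refl); simpl; auto. }
  assert (Nb1 : ~ In b1 (b2 :: bs0)) by (eapply blob_head_notin; [exact HP0|exact Hbx]).
  assert (Nb2 : ~ In b2 (b1 :: bs0)) by (eapply blob_head_notin; [exact HP0'|exact Hby]).
  assert (Hold1 : forall b' z h, In b' bs0 -> In (z, h) (snd b') -> ~ conn E z x /\ ~ conn E z y).
  { intros b' z h Hb' Hz; split; intros Hcz.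
    - assert (b' = b1) by (refine (proj1 (pg_blob HP0 _ _ _ _ _ _ _ _ Hz Hbx) Hcz); simpl; auto);
        subst b'; apply Nb1; simpl; auto.
    - assert (b' = b2) by (refine (proj1 (pg_blob HP0 _ _ _ _ _ _ _ _ Hz Hby) Hcz); simpl; auto);
        subst b'; apply Nb2; simpl; auto. }
  assert (Hold : forall b' z h, In b' bs0 -> In (z, h) (snd b') ->
    ~ conn ((v, x) :: (v, y) :: E) z x).
  { intros b' z h Hb' Hz Hcz; destruct (Hold1 _ _ _ Hb' Hz).
    apply (proj2 SIM) in Hcz; [|intros ->; eapply (Hvl b'); simpl; eauto|auto].
    apply conn_cons in Hcz; tauto. }
  assert (PF : forall s, Permutation
     ((E ++ flat_map (@tens_edges A) F) ++ map (pick s) (flat_map (@pars A) F))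
     ((((v, x) :: (v, y) :: E) ++ flat_map (@tens_edges A) F') ++ map (pick s) (flat_map (@pars A) F'))).
  { intros s; rewrite TE, TE'.
    rewrite (Permutation_map _ PS), (Permutation_map (pick s) PS'); perm. }
  assert (VV : incl (verts F') (verts F)).
  { intros u; unfold verts; rewrite IV, LL, LL'; simpl; rewrite !in_app_iff; simpl; tauto. }
  exists F', ((v, x) :: (v, y) :: E), (nb :: bs0); split; [|split; [auto|split]].
  - constructor.
    + unfold verts; rewrite LL'; simpl; exact N3.
    + intros s; eapply forest_perm; [apply PF|apply (pg_forest HP)].
    + intros s u w Hu Hw; eapply conn_perm; [apply PF|apply (pg_conn HP); auto].
    + intros u Hu.
      assert (v <> u) by (intros ->; apply Hv0; apply in_app_iff; auto).
      apply avoid_cons; auto; [|apply avoid_cons; auto].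
      * intros ->; apply N1; right; apply in_app_iff; auto.
      * intros ->; apply N4; apply in_app_iff; auto.
      * apply (pg_avoid HP); rewrite IV; simpl; auto.
    + rewrite LL'; simpl. apply Permutation_cons; auto.
      apply Permutation_cons_inv with (y, g), Permutation_cons_inv with (x, f).
      rewrite <- LL, <- (pg_leaves HP0); simpl; rewrite Hc1, Hc2; perm.
    + intros d1 d2 z h z' h' [<-|H1] [<-|H2] Hz Hz'.
      * split; auto; intros _.
        exact (conn_trans (Hnew _ _ Hz) (conn_sym (Hnew _ _ Hz'))).
      * split; [|intros <-; exfalso; apply (Hvl nb (Tens f g)); simpl; auto].
        intros Hc'; exfalso; apply (Hold _ _ _ H2 Hz').
        exact (conn_trans (conn_sym Hc') (Hnew _ _ Hz)).
      * split; [|intros ->; exfalso; apply (Hvl nb (Tens f g)); simpl; auto].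
        intros Hc'; exfalso; apply (Hold _ _ _ H1 Hz).
        exact (conn_trans Hc' (Hnew _ _ Hz')).
      (* The other sequents are connected neither to [x] nor to [y], so joining these two does not
         affect them. *)
      * rewrite (proj2 SIM).
        -- rewrite conn_cons.
           assert (G := pg_blob HP0 d1 d2 z h z' h'); simpl in G; specialize (G (or_intror (or_intror H1)) (or_intror (or_intror H2)) Hz Hz').
           destruct (Hold1 _ _ _ H1 Hz); tauto.
        -- intros ->; apply (Hvl d1 h); simpl; auto.
        -- intros ->; apply (Hvl d2 h'); simpl; auto.
    + intros b' [<-|Hb'].
      * simpl; rewrite map_app.
        apply translates_tens with (map snd (snd b1)) (map snd (snd b2)).
        -- apply (pg_proof HP0 b1); simpl; auto.
        -- apply (pg_proof HP0 b2); simpl; auto.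
        -- apply (Permutation_map snd) in Hc1; exact Hc1.
        -- apply (Permutation_map snd) in Hc2; exact Hc2.
        -- assert (ND := pg_names HP0); simpl in ND; rewrite app_assoc in ND.
           apply NoDup_app_remove_r in ND; intros n Hn1 Hn2.
           apply in_perm in Hn2; destruct Hn2 as [ns Hns]; rewrite Hns in ND.
           apply NoDup_remove_2 in ND; apply ND, in_app_iff; auto.
      * apply (pg_proof HP0); simpl; auto.
    + simpl; rewrite names_par, <- app_assoc; exact (pg_names HP0).
    + discriminate.
  - unfold blob_parts; rewrite <- !flat_map_concat_map, Hbs; simpl; perm.
  - rewrite IV; reflexivity.
Qed.
End Steps.

(** * Completing the sequent proof *)

Section Sequentialize.
Variable A : Type.
Implicit Types (t l r X Y : ltree A) (F : list (ltree A)) (E B : edges) (bs : list (blob A)).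

Lemma sub_root X t F : In t F -> sub X t -> In (lroot X) (verts F).
Proof.
  intros Ht HX; unfold verts, inner.
  assert (K : In (lroot X) (map par_vertex (pars t)) \/ In (lroot X) (tens_verts t) \/
              In (lroot X) (map fst (lleaves t))).
  { clear Ht; induction HX as [|v l r _ IH|v l r _ IH|v l r _ IH|v l r _ IH];
      [destruct X| | | |]; simpl; auto; rewrite !map_app, !in_app_iff; tauto. }
  rewrite !in_app_iff, !in_map_iff, !in_flat_map; rewrite !in_map_iff in K.
  destruct K as [[e [H1 H2]]|[H|[e [H1 H2]]]]; [left; left|left; right|right].
  - exists e; split; auto; apply in_flat_map; eauto.
  - eauto.
  - exists e; split; auto; apply in_flat_map; eauto.
Qed.

(** With no tensor or par left, [E] alone connects all leaves, so only one sequent remains. *)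
Lemma progress_final E F bs : progress E F bs ->
  (forall t, In t F -> exists v f, t = LLeaf v f) ->
  exists P, translates P (map (@formula A) F) /\ Permutation (parts P) (blob_parts bs).
Proof.
  intros HP HF.
  assert (K : flat_map (@tens_edges A) F = [] /\ flat_map (@pars A) F = [] /\
    map (@formula A) F = map snd (flat_map (@lleaves A) F)).
  { clear HP; induction F as [|t F IH]; simpl; auto.
    destruct IH as [H1 [H2 H3]]; [intros; apply HF; simpl; auto|].
    destruct (HF t) as [v [f ->]]; [simpl; auto|]; simpl; rewrite H1, H2, H3; auto. }
  destruct K as [TE [PS FS]].
  assert (HC : forall u v, In u (verts F) -> In v (verts F) -> conn E u v).
  { intros u v Hu Hv; assert (H := pg_conn HP (fun _ => false) u v Hu Hv).
    now rewrite TE, PS, !app_nil_r in H. }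
  destruct bs as [|b bs]; [now destruct (pg_nonempty HP)|].
  (* A derived sequent has a formula because its linking has a leaf; a second, empty sequent is thus
     excluded. *)
  assert (HB : forall b', In b' (b :: bs) -> exists x f, In (x, f) (snd b')).
  { intros b' Hb'; destruct (translates_net (pg_proof HP b' Hb')) as [_ [H _]].
    destruct (snd b') as [|[x f] c]; [|exists x, f; simpl; auto].
    apply Permutation_sym, Permutation_nil in H; exfalso; revert H; clear.
    assert (K : forall t : tree A, names t <> []).
    { induction t as [| |]; [discriminate| |]; rewrite ?names_tens, ?names_par;
        intros H; apply app_eq_nil in H; tauto. }
    apply K. }
  assert (HV : forall b' x f, In b' (b :: bs) -> In (x, f) (snd b') -> In x (verts F)).
  { intros b' x f H1 H2; unfold verts; apply in_app_iff; right; apply in_map_iff.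
    exists (x, f); split; auto; eapply blob_leaf; eauto. }
  destruct bs as [|b2 bs].
  - exists (fst b); split.
    + apply tr_exch with (map snd (snd b)); [apply (pg_proof HP); simpl; auto|].
      rewrite FS; apply Permutation_map; rewrite <- (pg_leaves HP); simpl.
      now rewrite app_nil_r.
    + unfold blob_parts; simpl; now rewrite app_nil_r.
  - exfalso; destruct (HB b) as [x [f Hx]]; [simpl; auto|].
    destruct (HB b2) as [y [g Hy]]; [simpl; auto|].
    apply (@blob_head_notin A E F b (b2 :: bs) x f HP Hx).
    assert (b = b2) by (refine (proj1 (pg_blob HP b b2 x f y g _ _ Hx Hy) _);
      [simpl; auto|simpl; auto|apply HC; eapply HV; eauto; simpl; auto]).
    simpl; auto.
Qed.

Theorem progress_translates n : forall E F bs, length (inner F) = n -> progress E F bs ->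
  exists P, translates P (map (@formula A) F) /\ Permutation (parts P) (blob_parts bs).
Proof.
  induction n as [n IH] using lt_wf_ind; intros E F bs Hn HP.
  assert (KD : done E F bs ->
    exists P, translates P (map (@formula A) F) /\ Permutation (parts P) (blob_parts bs)).
  { intros [F' [E' [bs' [H1 [H2 [H3 H4]]]]]].
    destruct (IH (length (inner F'))) with (E := E') (F := F') (bs := bs')
      as [P [P1 P2]]; auto; [lia|].
    exists P; rewrite <- H2, <- H3; auto. }
  destruct (classic (exists t, In t F /\ ready_tens t)) as [[t [Ht [v [x [f [y [g Hs]]]]]]]|HR].
  { apply KD; eapply tens_step; eauto. }
  assert (HR' : forall t X, In t F -> sub X t -> ~ ready_tens X).
  { intros t X Ht HX [v [x [f [y [g Hs]]]]]; apply HR; exists t; split; auto.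
    exists v, x, f, y, g; eapply sub_trans; eauto. }
  (* As no tensor is ready, tensor edges lead from any subtree that is not a leaf to the conclusion
     of a par. *)
  assert (HD : forall t X, In t F -> sub X t -> (exists v f, X = LLeaf v f) \/
    exists q, In q (flat_map (@pars A) F) /\
      conn (E ++ flat_map (@tens_edges A) F) (lroot X) (par_vertex q)).
  { intros t X Ht HX; destruct (tens_descend X) as [H|[H|[q [H1 H2]]]]; auto.
    - exfalso; eapply HR'; eauto.
    - right; exists q; split.
      + apply in_flat_map; exists t; split; auto; eapply sub_pars; eauto.
      + revert H2; apply conn_incl, incl_appr. intros e He; apply in_flat_map.
        exists t; split; auto; eapply sub_tens_edges; eauto. }
  destruct (@contractible_or_nil vtx vtx_eq_dec (E ++ flat_map (@tens_edges A) F)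
    (flat_map (@pars A) F) (fun v => In v (verts F))) as [Hnil|[c [x [y [H1 [H2 H3]]]]]].
  - assert (H := pg_nodup HP); unfold verts, inner in H.
    eapply NoDup_app_remove_r, NoDup_app_remove_r; exact H.
  - apply (pg_forest HP).
  - intros c x y H; apply in_flat_map in H; destruct H as [t [Ht H]].
    destruct (pars_sub _ _ _ _ H) as [l [r [Hs [<- <-]]]]; repeat split.
    + apply (@sub_root (LPar c l r) t F Ht Hs).
    + apply (@sub_root l t F Ht); apply sub_trans with (2 := Hs); auto using sub.
    + apply (@sub_root r t F Ht); apply sub_trans with (2 := Hs); auto using sub.
  - intros s u v Hu Hv; now apply (pg_conn HP).
  - eapply progress_final; eauto; intros t Ht.
    destruct (HD t t Ht (sub_refl t)) as [H|[q [Hq _]]]; auto.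
    rewrite Hnil in Hq; destruct Hq.
  - apply in_flat_map in H1; destruct H1 as [t [Ht H1]].
    destruct (pars_sub _ _ _ _ H1) as [l [r [Hs [Hl Hr]]]].
    assert (Sl : sub l t) by (apply sub_trans with (2 := Hs); auto using sub).
    assert (Sr : sub r t) by (apply sub_trans with (2 := Hs); auto using sub).
    (* The component of the premises contains no conclusion of a par, so both premises are
       leaves. *)
    destruct (HD t l Ht Sl) as [[v [f ->]]|[q [Hq1 Hq2]]].
    2: { exfalso; apply (H3 q Hq1); rewrite <- Hl; now apply conn_sym. }
    destruct (HD t r Ht Sr) as [[w [g ->]]|[q [Hq1 Hq2]]].
    2: { exfalso; apply (H3 q Hq1); rewrite Hr in Hq2; eauto using conn_trans, conn_sym. }
    simpl in Hl, Hr; subst v w; apply KD; eapply par_step; eauto.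
    (* Nor does this component contain a tensor, which would lead to a par; so [E] alone connects
       [x] and [y]. *)
    apply conn_component with (flat_map (@tens_edges A) F); auto.
    intros a b Hab Hxa; apply in_flat_map in Hab; destruct Hab as [t' [Ht' Hab]].
    destruct (tens_edges_sub _ _ _ Hab) as [l' [r' Hs']].
    destruct (HD t' _ Ht' Hs') as [[v [h H]]|[q [Hq1 Hq2]]]; [discriminate|].
    apply (H3 q Hq1); apply conn_sym; eapply conn_trans; [exact Hxa|exact Hq2].
Qed.
End Sequentialize.

(** * Sequentialization *)

Section ParEquiv.
Variable A : Type.
Variable G : list (tree A).
Implicit Types (t l r P Q R X Y : tree A).

(** Quantifying over contexts makes this a congruence. For [equiv] that is not evident, as the side
    condition of [st_bot] refers to the whole graph. *)
Definition cequiv P Q : Prop := forall C, Defs.equiv G (fill C P) (fill C Q).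

Lemma cequiv_refl P : cequiv P P.
Proof. intros C; apply rst_refl. Qed.
Lemma cequiv_sym P Q : cequiv P Q -> cequiv Q P.
Proof. intros H C; apply rst_sym, H. Qed.
Lemma cequiv_trans P Q R : cequiv P Q -> cequiv Q R -> cequiv P R.
Proof. intros H1 H2 C; eapply rst_trans; [apply H1|apply H2]. Qed.
Lemma cequiv_local P Q : local_rule P Q -> cequiv P Q.
Proof. intros H C; now apply equiv_local. Qed.
Lemma cequiv_par P P' Q Q' : cequiv P P' -> cequiv Q Q' -> cequiv (Par P Q) (Par P' Q').
Proof.
  intros H1 H2 C; eapply rst_trans.
  - specialize (H1 (comp C (CPl (Hole A) Q))); rewrite !fill_comp in H1; exact H1.
  - specialize (H2 (comp C (CPr P' (Hole A)))); rewrite !fill_comp in H2; exact H2.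
Qed.

(** [d] is a default for the empty list, which [parts] never returns. *)
Fixpoint par_list (d : tree A) (ts : list (tree A)) : tree A :=
  match ts with
  | [] => d
  | [t] => t
  | t :: ts' => Par t (par_list d ts')
  end.

Lemma par_list_cons d t ts : ts <> [] -> par_list d (t :: ts) = Par t (par_list d ts).
Proof. destruct ts; [congruence|auto]. Qed.

Lemma par_list_app d ts us : ts <> [] -> us <> [] ->
  cequiv (Par (par_list d ts) (par_list d us)) (par_list d (ts ++ us)).
Proof.
  intros Hts Hus; induction ts as [|t ts IH]; [congruence|].
  destruct ts as [|t' ts].
  - simpl app; rewrite (@par_list_cons d t us) by auto; apply cequiv_refl.
  - change (cequiv (Par (Par t (par_list d (t' :: ts))) (par_list d us))
             (Par t (par_list d ((t' :: ts) ++ us)))).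
    eapply cequiv_trans; [apply cequiv_local, r_parA|].
    apply cequiv_par; [apply cequiv_refl|apply IH; discriminate].
Qed.

Lemma parts_nonempty P : parts P <> [].
Proof.
  induction P as [| |l IHl r IHr]; simpl; try discriminate.
  intros H; apply app_eq_nil in H; tauto.
Qed.

Lemma cequiv_parts d P : cequiv P (par_list d (parts P)).
Proof.
  induction P as [x k|l _ r _|l IHl r IHr]; try apply cequiv_refl.
  eapply cequiv_trans; [apply cequiv_par; eauto|].
  apply par_list_app; apply parts_nonempty.
Qed.

Lemma par_list_perm d ts us : Permutation ts us -> cequiv (par_list d ts) (par_list d us).
Proof.
  induction 1 as [|t ts us HP IH|t u ts|ts us vs _ IH1 _ IH2].
  - apply cequiv_refl.
  - destruct ts as [|t' ts].
    + apply Permutation_nil in HP; subst; apply cequiv_refl.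
    + assert (us <> []) by (intros ->; apply Permutation_sym, Permutation_nil in HP; discriminate).
      rewrite (@par_list_cons d t us) by auto; apply cequiv_par; [apply cequiv_refl|exact IH].
  - destruct ts as [|v ts].
    + apply cequiv_local, r_parC.
    + change (cequiv (Par u (Par t (par_list d (v :: ts)))) (Par t (Par u (par_list d (v :: ts))))).
      eapply cequiv_trans; [apply cequiv_sym, cequiv_local, r_parA|].
      eapply cequiv_trans; [|apply cequiv_local, r_parA].
      apply cequiv_par; [apply cequiv_local, r_parC|apply cequiv_refl].
  - eapply cequiv_trans; eauto.
Qed.

(** Each side is equivalent to the right-nested par of its parts, whose order is free. *)
Lemma parts_equiv P Q : Permutation (parts P) (parts Q) -> Defs.equiv G P Q.
Proof.
  intros H; change (Defs.equiv G (fill (Hole A) P) (fill (Hole A) Q)).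
  revert H; intros H; apply cequiv_trans with (par_list P (parts P)); [apply cequiv_parts|].
  eapply cequiv_trans; [apply par_list_perm; exact H|apply cequiv_sym, cequiv_parts].
Qed.

(** * Invariance of linkings and their leaves under the equivalence *)

Lemma subtree_ctx P p X : subtree P p = Some X -> exists C, P = fill C X /\ p = hole_path C.
Proof.
  revert P; induction p as [|[|] p IH]; intros P H.
  - exists (Hole A); destruct P; inversion H; auto.
  - destruct P as [|l r|l r]; try discriminate; destruct (IH _ H) as [C [-> ->]].
    + now exists (CTr l C).
    + now exists (CPr l C).
  - destruct P as [|l r|l r]; try discriminate; destruct (IH _ H) as [C [-> ->]].
    + now exists (CTl C r).
    + now exists (CPl C r).
Qed.

(** A leaf can occur in a linking without being a linking, as a bottom or an atom does; an internal
    node of a linking is always one. *)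
Definition is_node P : Prop := forall x k, P <> Leaf x k.

Lemma fill_node C X : is_node X -> is_node (fill C X).
Proof. intros H; destruct C; auto; intros x k; discriminate. Qed.

Lemma linking_fill C X Y : is_node X -> (linking X -> linking Y) ->
  linking (fill C X) -> linking (fill C Y).
Proof.
  intros HX H; induction C as [|C IH r|l C IH|C IH r|l C IH]; simpl; auto;
    assert (K := fill_node C HX); intros HL;
    inversion HL as [x|x y a|x y a|x L HL'|x L HL'|L M H1 H2]; subst;
    try (exfalso; eapply K; symmetry; eassumption);
    try (exfalso; eapply K; eassumption).
  - apply lk_botr; auto.
  - apply lk_botl; auto.
  - apply lk_par; auto.
  - apply lk_par; auto.
Qed.

Lemma local_rule_linking X Y : local_rule X Y ->
  is_node X /\ is_node Y /\ Permutation (leaves X) (leaves Y) /\ (linking X <-> linking Y).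
Proof.
  intros H; split; [destruct H; intros ? ?; discriminate|].
  split; [destruct H; intros ? ?; discriminate|].
  destruct H as [Q R|Q R S|Q R|i j Q].
  - split; [apply Permutation_app_comm|].
    split; intros H; inversion H; subst; apply lk_par; auto.
  - split; [simpl; now rewrite app_assoc|].
    split; intros H; inversion H as [| | | | |L M H1 H2]; subst.
    + inversion H1; subst; repeat apply lk_par; auto.
    + inversion H2; subst; repeat apply lk_par; auto.
  - split; [apply Permutation_app_comm|].
    split; intros H; inversion H; subst; constructor; auto.
  - split; [simpl; apply Permutation_refl|].
    assert (N : forall x, ~ linking (Leaf x (KBot A))) by (intros x Hx; inversion Hx).
    split; intros H.
    + inversion H as [| | |x L HL|x L HL|]; subst.
      inversion HL as [| | |x L HL'|x L HL'|]; subst; [now apply N in HL'|].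
      now apply lk_botr, lk_botl.
    + inversion H as [| | |x L HL|x L HL|]; subst.
      inversion HL as [| | |x L HL'|x L HL'|]; subst; [|now apply N in HL'].
      now apply lk_botl, lk_botr.
Qed.

Lemma bot_rule_linking Q R i :
  linking (Par Q (Tens R (Leaf i (KBot A)))) <-> linking (Tens (Par Q R) (Leaf i (KBot A))).
Proof.
  assert (N : forall x, ~ linking (Leaf x (KBot A))) by (intros x Hx; inversion Hx).
  split; intros H.
  - inversion H as [| | | | |L M H1 H2]; subst.
    inversion H2 as [| | |x L HL|x L HL|]; subst; [now apply N in HL|].
    now apply lk_botr, lk_par.
  - inversion H as [| | |x L HL|x L HL|]; subst; inversion HL; subst.
    apply lk_par; auto; now apply lk_botr.
Qed.

Lemma step_linking P Q : step G P Q ->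
  (linking P <-> linking Q) /\ Permutation (leaves P) (leaves Q).
Proof.
  intros [P0 p X Y HX HR|P0 p Q0 R i HX _]; apply subtree_ctx in HX;
    destruct HX as [C [-> ->]]; rewrite replace_fill.
  - destruct (local_rule_linking HR) as [N1 [N2 [HP HL]]].
    split; [split; apply linking_fill; tauto|now apply leaves_fill].
  - assert (HL := bot_rule_linking Q0 R i); split.
    + split; apply linking_fill; try (intros ? ?; discriminate); tauto.
    + apply leaves_fill; simpl; now rewrite app_assoc.
Qed.

Lemma equiv_linking P Q : Defs.equiv G P Q ->
  (linking P <-> linking Q) /\ Permutation (leaves P) (leaves Q).
Proof.
  induction 1 as [x y H|x|x y _ [IH1 IH2]|x y z _ [IH1 IH2] _ [IH3 IH4]].
  - now apply step_linking.
  - split; [tauto|reflexivity].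
  - split; [tauto|now symmetry].
  - split; [tauto|etransitivity; eauto].
Qed.
End ParEquiv.

(** * The initial state and the assembly of the sequent proof *)

Section Initial.
Variable A : Type.
Implicit Types (t l r P : tree A) (G : list (tree A)) (s : switching).

Fixpoint label (mk : list bool -> vtx) t (p : list bool) : ltree A :=
  match t with
  | Leaf x k => LLeaf (VL x) (Leaf x k)
  | Tens l r => LTens (mk p) (label mk l (p ++ [false])) (label mk r (p ++ [true]))
  | Par l r => LPar (mk p) (label mk l (p ++ [false])) (label mk r (p ++ [true]))
  end.

Fixpoint label_forest i G : list (ltree A) :=
  match G with
  | [] => []
  | t :: G' => label (VG i) t [] :: label_forest (S i) G'
  end.

Definition axiom_leaf (xk : nat * kind A) : vtx * tree A := (VL (fst xk), Leaf (fst xk) (snd xk)).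

Lemma formula_label mk t p : formula (label mk t p) = t.
Proof. revert p; induction t; intros p; simpl; congruence. Qed.

Lemma formula_label_forest i G : map (@formula A) (label_forest i G) = G.
Proof. revert i; induction G; intros i; simpl; [auto|]. now rewrite formula_label, IHG. Qed.

Lemma lroot_label mk t p : lroot (label mk t p) = rootv mk t p.
Proof. destruct t; auto. Qed.

Lemma lleaves_label mk t p : lleaves (label mk t p) = map axiom_leaf (leaves t).
Proof.
  revert p; induction t; intros p; simpl; auto; now rewrite IHt1, IHt2, map_app.
Qed.

Lemma lleaves_label_forest i G :
  flat_map (@lleaves A) (label_forest i G) = map axiom_leaf (concat (map (@leaves A) G)).
Proof.
  revert i; induction G; intros i; simpl; [auto|].
  now rewrite lleaves_label, IHG, map_app.
Qed.

Lemma kept_edges_label s mk t p : Permutation (kept_edges s mk t p)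
  (tens_edges (label mk t p) ++ map (pick s) (pars (label mk t p))).
Proof.
  revert p; induction t as [x k|l IHl r IHr|l IHl r IHr]; intros p; simpl; auto;
    rewrite IHl, IHr, !lroot_label, map_app; perm.
Qed.

Lemma kept_forest_label s i G : Permutation (kept_forest s i G)
  (flat_map (@tens_edges A) (label_forest i G) ++ map (pick s) (flat_map (@pars A) (label_forest i G))).
Proof.
  revert i; induction G as [|t G IH]; intros i; simpl; auto.
  rewrite kept_edges_label, IH, map_app; perm.
Qed.

Lemma tverts_label mk t p : Permutation
  ((map par_vertex (pars (label mk t p)) ++ tens_verts (label mk t p)) ++ map fst (lleaves (label mk t p)))
  (tverts mk t p).
Proof.
  revert p; induction t as [x k|l IHl r IHr|l IHl r IHr]; intros p; simpl; auto;
    rewrite <- IHl, <- IHr, !map_app; unfold par_vertex; simpl; perm.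
Qed.

Lemma verts_label_forest i G : Permutation (verts (label_forest i G)) (forest_verts i G).
Proof.
  unfold verts, inner; revert i; induction G as [|t G IH]; intros i; simpl; auto.
  rewrite <- IH, <- tverts_label, !map_app; perm.
Qed.

Lemma inner_label_forest i G v : In v (inner (label_forest i G)) -> exists j q, v = VG j q.
Proof.
  assert (K : forall mk t p, (In v (map par_vertex (pars (label mk t p))) \/
    In v (tens_verts (label mk t p))) -> exists q, v = mk q).
  { intros mk; induction t as [x k|l IHl r IHr|l IHl r IHr]; intros p; simpl;
      rewrite ?map_app, ?in_app_iff.
    - tauto.
    - intros [[H|H]|[H|[H|H]]]; eauto.
    - intros [[H|[H|H]]|[H|H]]; eauto. exists p; symmetry; exact H. }
  unfold inner; revert i; induction G as [|t G IH]; intros i; simpl; [tauto|].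
  rewrite map_app, !in_app_iff; specialize (IH (S i)); rewrite in_app_iff in IH.
  specialize (K (VG i) t []); intros [[H|H]|[H|H]]; auto;
    destruct K as [q ->]; eauto.
Qed.

Lemma tverts_shape mk t p u : In u (tverts mk t p) ->
  (exists x, u = VL x /\ In x (names t)) \/ exists q, u = mk (p ++ q).
Proof.
  revert p; induction t as [x k|l IHl r IHr|l IHl r IHr]; intros p; simpl.
  - intros [<-|[]]; left; exists x; simpl; auto.
  - rewrite in_app_iff, names_tens; intros [<-|[H|H]].
    + right; exists []; now rewrite app_nil_r.
    + destruct (IHl _ H) as [[x [-> Hx]]|[q ->]]; [left; exists x; rewrite in_app_iff; auto|].
      right; exists (false :: q); now rewrite <- app_assoc.
    + destruct (IHr _ H) as [[x [-> Hx]]|[q ->]]; [left; exists x; rewrite in_app_iff; auto|].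
      right; exists (true :: q); now rewrite <- app_assoc.
  - rewrite in_app_iff, names_par; intros [<-|[H|H]].
    + right; exists []; now rewrite app_nil_r.
    + destruct (IHl _ H) as [[x [-> Hx]]|[q ->]]; [left; exists x; rewrite in_app_iff; auto|].
      right; exists (false :: q); now rewrite <- app_assoc.
    + destruct (IHr _ H) as [[x [-> Hx]]|[q ->]]; [left; exists x; rewrite in_app_iff; auto|].
      right; exists (true :: q); now rewrite <- app_assoc.
Qed.

Lemma NoDup_app_common (T : Type) (a b : list T) x : NoDup (a ++ b) -> In x a -> In x b -> False.
Proof.
  intros H Ha Hb; apply in_perm in Ha; destruct Ha as [a' Ha]; rewrite Ha in H.
  inversion H as [|? ? N _]; apply N, in_app_iff; auto.
Qed.

Lemma tverts_NoDup mk t p : proper mk -> NoDup (names t) -> NoDup (tverts mk t p).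
Proof.
  intros Hmk.
  assert (K : forall l r p, NoDup (names l ++ names r) ->
    NoDup (tverts mk l (p ++ [false])) -> NoDup (tverts mk r (p ++ [true])) ->
    NoDup (mk p :: tverts mk l (p ++ [false]) ++ tverts mk r (p ++ [true]))).
  { intros l r p0 HN Hl Hr; constructor.
    - rewrite in_app_iff; intros [H|H]; apply tverts_shape in H;
        destruct H as [[x [H _]]|[q H]]; try (now apply Hmk in H); now apply (outside_self Hmk) in H.
    - apply NoDup_disjoint_app; auto; intros u H1 H2; apply tverts_shape in H1, H2.
      destruct H1 as [[x [-> H1]]|[q ->]], H2 as [[y [H2 H2']]|[q' H2]].
      + inversion H2; subst; eapply NoDup_app_common; eauto.
      + symmetry in H2; now apply Hmk in H2.
      + now apply Hmk in H2.
      + assert (Hd : true <> false) by discriminate.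
        now apply (outside_sibling Hmk p0 q Hd) in H2. }
  revert p; induction t as [x k|l IHl r IHr|l IHl r IHr]; intros p; simpl.
  - repeat constructor; auto.
  - rewrite names_tens; intros H; apply K; eauto using NoDup_app_remove_l, NoDup_app_remove_r.
  - rewrite names_par; intros H; apply K; eauto using NoDup_app_remove_l, NoDup_app_remove_r.
Qed.

Lemma forest_verts_shape i G u : In u (forest_verts i G) ->
  (exists x, u = VL x /\ In x (forest_names G)) \/ exists j q, i <= j /\ u = VG j q.
Proof.
  unfold forest_names; revert i; induction G as [|t G IH]; intros i; simpl; [tauto|].
  rewrite in_app_iff; intros [H|H].
  - apply tverts_shape in H; destruct H as [[x [-> H]]|[q ->]];
      [left; exists x; rewrite in_app_iff; auto|right; exists i, q; auto].
  - destruct (IH _ H) as [[x [-> H']]|[j [q [Hj ->]]]];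
      [left; exists x; rewrite in_app_iff; auto|right; exists j, q; split; [lia|auto]].
Qed.

Lemma forest_verts_NoDup i G : NoDup (forest_names G) -> NoDup (forest_verts i G).
Proof.
  unfold forest_names; revert i; induction G as [|t G IH]; intros i; simpl; [constructor|].
  intros HN; apply NoDup_disjoint_app.
  - apply tverts_NoDup; [apply proper_VG|eapply NoDup_app_remove_r; exact HN].
  - apply IH; eapply NoDup_app_remove_l; exact HN.
  - intros u H1 H2; apply tverts_shape in H1; apply forest_verts_shape in H2.
    destruct H1 as [[x [-> H1]]|[q ->]], H2 as [[y [H2 H2']]|[j [q' [Hj H2]]]];
      try discriminate.
    + inversion H2; subst; eapply NoDup_app_common; eauto.
    + inversion H2; lia.
Qed.

Lemma star_conn s mk t p x : star t -> In x (names t) ->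
  conn (leaf_edges s mk t p) (rep s mk t p) (VL x).
Proof.
  intros H; revert p; induction H as [y|y z a|y L HL IH]; intros p; simpl.
  - intros [<-|[]]; apply conn_refl.
  - intros [<-|[<-|[]]]; [apply conn_refl|apply conn_in; simpl; auto].
  - intros [<-|Hx]; [apply conn_refl|].
    eapply conn_trans; [apply conn_in; simpl; left; reflexivity|].
    apply conn_wk; auto.
Qed.

Lemma star_translates t : star t -> NoDup (names t) ->
  translates t (map snd (map axiom_leaf (leaves t))).
Proof.
  induction 1 as [y|y z a|y L HL IH]; intros HN; simpl.
  - constructor.
  - constructor; intros ->; inversion HN as [|? ? N _]; apply N; simpl; auto.
  - rewrite names_tens in HN; simpl in HN; inversion HN; subst; constructor; auto.
Qed.

Lemma names_in_parts P t x : In t (parts P) -> In x (names t) -> In x (names P).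
Proof.
  induction P as [y k|l _ r _|l IHl r IHr]; simpl.
  - intros [<-|[]]; auto.
  - intros [<-|[]]; auto.
  - rewrite names_par, !in_app_iff; tauto.
Qed.

(** A par adds no edge between its sides, so the components of the linking are its stars, whatever
    the switching. *)
Lemma parts_conn s mk P p : Forall (@star A) (parts P) -> NoDup (names P) ->
  forall t t' x y, In t (parts P) -> In t' (parts P) -> In x (names t) -> In y (names t') ->
    (conn (leaf_edges s mk P p) (VL x) (VL y) <-> t = t').
Proof.
  assert (K : forall P p, parts P = [P] -> Forall (@star A) (parts P) ->
    forall t t' x y, In t (parts P) -> In t' (parts P) -> In x (names t) -> In y (names t') ->
    (conn (leaf_edges s mk P p) (VL x) (VL y) <-> t = t')).
  { intros P0 p0 HP HS t t' x y H1 H2 Hx Hy; rewrite HP in *; inversion HS; subst.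
    destruct H1 as [<-|[]], H2 as [<-|[]]; split; auto; intros _.
    eapply conn_trans; [apply conn_sym|]; apply star_conn; auto. }
  revert p; induction P as [y k|l _ r _|l IHl r IHr]; intros p; [intros; now apply K|intros; now apply K|].
  rewrite names_par; simpl; intros HS HN; apply Forall_app in HS; destruct HS as [Sl Sr].
  assert (Nl := NoDup_app_remove_r _ _ HN); assert (Nr := NoDup_app_remove_l _ _ HN).
  set (El := leaf_edges s mk l (p ++ [false])); set (Er := leaf_edges s mk r (p ++ [true])).
  assert (Wl : within (is_leaf_of l) El) by (eapply psw_within, psw_rep).
  assert (Wr : within (is_leaf_of r) Er) by (eapply psw_within, psw_rep).
  assert (Hd : forall w, is_leaf_of l w -> is_leaf_of r w -> False).
  { intros w [n [-> H1]] [m [Hm H2]]; inversion Hm; subst; eapply NoDup_app_common; eauto. }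
  assert (HL : forall t x, In t (parts l) -> In x (names t) -> is_leaf_of l (VL x)).
  { intros t x H1 H2; exists x; split; auto; eapply names_in_parts; eauto. }
  assert (HR : forall t x, In t (parts r) -> In x (names t) -> is_leaf_of r (VL x)).
  { intros t x H1 H2; exists x; split; auto; eapply names_in_parts; eauto. }
  assert (HC : forall x y, conn (El ++ Er) (VL x) (VL y) ->
    VL x = VL y \/ (is_leaf_of l (VL x) /\ is_leaf_of l (VL y) /\ conn El (VL x) (VL y)) \/
    (is_leaf_of r (VL x) /\ is_leaf_of r (VL y) /\ conn Er (VL x) (VL y))).
  { intros x y H; destruct (conn_app_disjoint Wl Wr Hd H) as [H'|H'];
      [destruct (conn_within Wl H') as [|[? ?]]|destruct (conn_within Wr H') as [|[? ?]]]; auto. }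
  intros t t' x y H1 H2 Hx Hy; apply in_app_iff in H1, H2.
  destruct H1 as [H1|H1], H2 as [H2|H2].
  - rewrite <- (IHl (p ++ [false]) Sl Nl t t' x y); auto; split.
    + intros H; apply HC in H; destruct H as [->|[[_ [_ H]]|[H _]]]; auto using conn_refl.
      exfalso; eauto.
    + apply conn_incl, incl_appl, incl_refl.
  - assert (Lx := HL _ _ H1 Hx); assert (Ry := HR _ _ H2 Hy); split.
    + intros H; exfalso; apply HC in H; destruct H as [H|[[_ [H _]]|[H _]]];
        [rewrite H in Lx| |]; eauto.
    + intros <-; exfalso; eauto.
  - assert (Rx := HR _ _ H1 Hx); assert (Ly := HL _ _ H2 Hy); split.
    + intros H; exfalso; apply HC in H; destruct H as [H|[[H _]|[_ [H _]]]];
        [rewrite H in Rx| |]; eauto.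
    + intros <-; exfalso; eauto.
  - rewrite <- (IHr (p ++ [true]) Sr Nr t t' x y); auto; split.
    + intros H; apply HC in H; destruct H as [->|[[H _]|[_ [_ H]]]]; auto using conn_refl.
      exfalso; eauto.
    + apply conn_incl, incl_appr, incl_refl.
Qed.

Lemma leaf_edges_ext s s' mk t p : (forall q, s (mk q) = s' (mk q)) ->
  rep s mk t p = rep s' mk t p /\ leaf_edges s mk t p = leaf_edges s' mk t p.
Proof.
  intros H; revert p; induction t as [x k|l IHl r IHr|l IHl r IHr]; intros p; simpl; auto;
    destruct (IHl (p ++ [false])) as [-> ->], (IHr (p ++ [true])) as [-> ->]; auto.
  rewrite H; auto.
Qed.

Definition initial_blobs P : list (blob A) :=
  map (fun t => (t, map axiom_leaf (leaves t))) (parts P).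

Lemma leaves_parts P : concat (map (@leaves A) (parts P)) = leaves P.
Proof.
  induction P as [x k|l _ r _|l IHl r IHr]; simpl; rewrite ?app_nil_r; auto.
  now rewrite map_app, concat_app, IHl, IHr.
Qed.

Lemma in_axiom_leaves t v f :
  In (v, f) (map axiom_leaf (leaves t)) -> exists x, v = VL x /\ In x (names t).
Proof.
  intros H; apply in_map_iff in H; destruct H as [[x k] [H1 H2]]; inversion H1; subst.
  exists x; split; auto; apply in_map_iff; now exists (x, k).
Qed.

Lemma initial_progress P G : net P G -> NoDup (names P) ->
  Permutation (leaves P) (concat (map (@leaves A) G)) -> Forall (@star A) (parts P) ->
  progress (leaf_edges (fun _ => false) VP P []) (label_forest 0 G) (initial_blobs P).
Proof.
  intros HN HD HL HS; set (E := leaf_edges (fun _ => false) VP P []).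
  assert (HP : Permutation (names P) (forest_names G)).
  { apply (Permutation_map fst) in HL; unfold forest_names, names.
    rewrite concat_map, map_map in HL; exact HL. }
  (* The choices in the linking are fixed to [false]; only those in the forest vary with [s]. *)
  assert (HT : forall s, tree_on (is_leaf_of P)
    (E ++ kept_forest (fun v => match v with VP _ => false | _ => s v end) 0 G)).
  { intros s; set (s' := fun v : vtx => match v with VP _ => false | _ => s v end).
    assert (HE : E = leaf_edges s' VP P []) by (apply leaf_edges_ext; auto).
    rewrite HE; apply tree_on_sim with (1 := sim_sym (leaf_kept_sim s' P G)).
    - apply is_leaf_vtx.
    - eapply HN; [apply psw_rep|apply fsw_leaf_forest]. }
  assert (HK : forall s, Permutation
    (E ++ kept_forest (fun v => match v with VP _ => false | _ => s v end) 0 G)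
    ((E ++ flat_map (@tens_edges A) (label_forest 0 G)) ++
      map (pick s) (flat_map (@pars A) (label_forest 0 G)))).
  { intros s; rewrite kept_forest_label, app_assoc; apply Permutation_app_head.
    erewrite map_ext_in; [reflexivity|]; intros [[c x] y] Hc; simpl.
    destruct (@inner_label_forest 0 G c) as [j [q ->]]; auto.
    apply in_app_iff; left; apply in_map_iff; now exists (c, x, y). }
  assert (HB : forall b, In b (initial_blobs P) -> In (fst b) (parts P) /\
     snd b = map axiom_leaf (leaves (fst b))).
  { intros b Hb; apply in_map_iff in Hb; destruct Hb as [t [<- Ht]]; auto. }
  constructor.
  - apply (Permutation_NoDup (Permutation_sym (verts_label_forest 0 G))).
    apply forest_verts_NoDup; now rewrite <- HP.
  - intros s; apply (forest_perm (HK s)), HT.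
  - intros s u v Hu Hv; apply (conn_perm (HK s)); destruct (HT s) as [_ HC].
    rewrite verts_label_forest in Hu, Hv.
    set (s' := fun v : vtx => match v with VP _ => false | _ => s v end) in *.
    destruct (forest_verts_conn s' _ _ _ Hu) as [x [Hx Cx]].
    destruct (forest_verts_conn s' _ _ _ Hv) as [y [Hy Cy]].
    assert (W : forall a b, conn (kept_forest s' 0 G) a b -> conn (E ++ kept_forest s' 0 G) a b)
      by (intros a b; apply conn_incl, incl_appr, incl_refl).
    apply conn_trans with (VL x); [auto|]; apply conn_trans with (VL y); [|auto using conn_sym].
    apply HC; [exists x|exists y]; split; auto; now rewrite HP.
  - intros v Hv; destruct (inner_label_forest _ _ _ Hv) as [j [q ->]].
    apply within_avoid with (is_leaf_of P); [eapply psw_within, psw_rep|].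
    intros [x [H _]]; discriminate.
  - rewrite lleaves_label_forest, <- HL, <- leaves_parts.
    unfold initial_blobs; rewrite map_map, concat_map, map_map; reflexivity.
  - intros b b' x f y g Hb Hb' Hx Hy.
    destruct (HB _ Hb) as [B1 B2], (HB _ Hb') as [B1' B2']; rewrite B2 in Hx; rewrite B2' in Hy.
    apply in_axiom_leaves in Hx, Hy; destruct Hx as [n [-> Hn]], Hy as [m [-> Hm]].
    unfold E; rewrite (parts_conn _ VP P [] HS HD (fst b) (fst b') n m); auto; split.
    + intros H; destruct b as [t c], b' as [t' c']; simpl in *; congruence.
    + congruence.
  - intros b Hb; destruct (HB _ Hb) as [B1 B2]; rewrite B2.
    apply star_translates; [rewrite Forall_forall in HS; auto|].
    clear - B1 HD; induction P as [x k|l _ r _|l IHl r IHr]; simpl in B1.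
    + destruct B1 as [<-|[]]; auto.
    + destruct B1 as [<-|[]]; auto.
    + rewrite names_par in HD; apply in_app_iff in B1; destruct B1;
        eauto using NoDup_app_remove_l, NoDup_app_remove_r.
  - unfold initial_blobs; rewrite map_map; simpl.
    replace (concat (map (fun t => names t) (parts P))) with (names P); auto.
    unfold names; rewrite <- (leaves_parts P), concat_map, map_map; reflexivity.
  - unfold initial_blobs; destruct (parts P) eqn:H; [|discriminate].
    exfalso; now apply (parts_nonempty P).
Qed.

Lemma parts_idem P : concat (map (@parts A) (parts P)) = parts P.
Proof.
  induction P as [x k|l _ r _|l IHl r IHr]; simpl; auto.
  now rewrite map_app, concat_app, IHl, IHr.
Qed.

Theorem correct_sequentializable P G : pre_proof_graph P G -> net P G -> sequentializable P G.
Proof.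
  intros [HL [HD HP]] HN.
  assert (HO : ok P G).
  { split; auto; apply pre_proof_graph_forest_names; now repeat split. }
  destruct (reach_stars HL (Hole A) HO) as [P1 [H1 [H2 [H3 H4]]]]; simpl in *.
  assert (HD1 : NoDup (names P1))
    by (apply (Permutation_NoDup (names_perm _ _ H4)); auto).
  assert (HP1 : Permutation (leaves P1) (concat (map (@leaves A) G)))
    by (rewrite <- H4; auto).
  destruct (progress_translates eq_refl (initial_progress H3 HD1 HP1 H1)) as [P2 [H5 H6]].
  rewrite formula_label_forest in H5; exists P2; split; auto.
  (* The sequent proof has a linking with the same stars as [P1], so the two differ by associativity
     and commutativity of par. *)
  eapply rst_trans; [exact H2|]; apply parts_equiv; rewrite H6.
  unfold blob_parts, initial_blobs; rewrite map_map; simpl.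
  rewrite parts_idem; reflexivity.
Qed.
End Initial.

Unset Implicit Arguments.

Theorem theorem1p8 (A : Type) (P : tree A) (G : list (tree A)) :
  pre_proof_graph P G -> (sequentializable P G <-> proof_net P G).
Proof.
  intros HG; assert (HG' := HG); destruct HG' as [HL [HD HP]]; split.
  - intros [P' [HE HT]]; exists P'; split; auto.
    destruct (translates_net HT) as [H1 [H2 H3]]; now apply correct_net.
  - intros [P' [HE HC]].
    (* The equivalence preserves linkings and leaves, so the correct representative is again a
       pre-proof graph. *)
    destruct (equiv_linking HE) as [L1 L2].
    assert (HG1 : pre_proof_graph P' G).
    { split; [tauto|split].
      - apply (Permutation_NoDup (names_perm _ _ L2)); auto.
      - now rewrite <- L2. }
    assert (HN : net P' G).
    { apply correct_net; auto; [apply HG1|now apply pre_proof_graph_forest_names]. }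
    destruct (correct_sequentializable HG1 HN) as [P2 [H1 H2]].
    exists P2; split; auto; eapply rst_trans; eauto.
Qed.
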